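(* Let $\alpha\ge0$ and let $s$ be a real number such that $0<s<3\alpha+2$. Then for all nonzero $f\in L^2_\alpha(\mathbb{K})$ and all measurable subsets $E\subset\widehat{\mathbb{K}}$ such that $0<\gamma_\alpha(E)<+\infty$, $$\left(\int_E|\mathcal{F}_{LB}(f)(\lambda,m)|^2\,d\gamma_\alpha(\lambda,m)\right)^{\frac12}<K_{\alpha,s}\ \gamma_\alpha(E)^{\frac{s}{2(3\alpha+2)}}\ \big\|\,|(x,t)|^s f\,\big\|_{\alpha,2},$$ where $$K_{\alpha,s}=\left(\frac{B\left(\frac{\alpha+1}{2},\frac{2\alpha+1}{2}\right)(3\alpha+2-s)}{4^{\alpha+1}\pi\,\Gamma(\alpha+1)\,s^2}\right)^{\frac{s}{2(3\alpha+2)}}\frac{3\alpha+2}{3\alpha+2-s}$$ and $B$ is the Euler beta function. (The norm on the right-hand side may be infinite.)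
   Context: Fix $\alpha\ge 0$. Let $\mathbb{K}=[0,+\infty)\times[0,+\infty)$, with points $(x,t)$, and $\widehat{\mathbb{K}}=[0,+\infty)\times\mathbb{N}$ (with $0\in\mathbb{N}$), with points $(\lambda,m)$. Measure on $\mathbb{K}$: $dm_\alpha(x,t)=\frac{1}{\pi\Gamma(\alpha+1)}x^{2\alpha+1}t^{2\alpha}\,dx\,dt$. $L^p_\alpha(\mathbb{K})$ denotes $L^p(\mathbb{K},m_\alpha)$ with norm $\|\cdot\|_{\alpha,p}$. Homogeneous norm: $|(x,t)|=(x^4+4t^2)^{1/4}$. Laguerre-Bessel transform: for $(\lambda,m)\in\widehat{\mathbb{K}}$ put $\varphi_{(\lambda,m)}(x,t)=j_{\alpha-\frac12}(\lambda t)\,\mathcal{L}_m^\alpha(\lambda x^2)$, where $j_\nu(z)=\Gamma(\nu+1)\sum_{k\ge0}\frac{(-1)^k}{k!\,\Gamma(\nu+k+1)}(z/2)^{2k}$ is the normalized Bessel function, $\mathcal{L}_m^\alpha(z)=e^{-z/2}L_m^\alpha(z)/L_m^\alpha(0)$, and $L_m^\alpha$ is the Laguerre polynomial of degree $m$ and order $\alpha$. For $f\in L^1_\alpha(\mathbb{K})$, $$\mathcal{F}_{LB}(f)(\lambda,m)=\int_{\mathbb{K}}f(x,t)\,\varphi_{(\lambda,m)}(x,t)\,dm_\alpha(x,t).$$ Measure on $\widehat{\mathbb{K}}$: $\gamma_\alpha$ is given by $$\int_{\widehat{\mathbb{K}}} g\,d\gamma_\alpha=c_\alpha\sum_{m=0}^\infty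 L_m^\alpha(0)\int_0^{+\infty} g(\lambda,m)\,\lambda^{3\alpha+1}\,d\lambda ,$$ where $c_\alpha>0$ is the normalizing constant for which the Plancherel formula $\|f\|_{\alpha,2}=\|\mathcal{F}_{LB}(f)\|_{\gamma_\alpha,2}$ holds for all $f\in L^1_\alpha(\mathbb{K})\cap L^2_\alpha(\mathbb{K})$ (namely $c_\alpha=\frac{2\pi}{2^{2\alpha-1}\Gamma(\alpha+\frac12)^2}$); here $\|\cdot\|_{\gamma_\alpha,2}$ is the norm of $L^2(\widehat{\mathbb{K}},\gamma_\alpha)$. On $L^2_\alpha(\mathbb{K})$, $\mathcal{F}_{LB}$ denotes the resulting isometric extension to $L^2_\alpha(\mathbb{K})\to L^2(\widehat{\mathbb{K}},\gamma_\alpha)$. *)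

(* Defs.v *)
From HB Require Import structures.
From mathcomp Require Import all_boot all_order all_algebra.
From mathcomp Require Import all_classical all_reals all_analysis.
From mathcomp Require Import measurable_realfun complex.

Set Implicit Arguments.
Unset Strict Implicit.
Unset Printing Implicit Defensive.
Import Order.TTheory GRing.Theory Num.Theory.
Import numFieldNormedType.Exports.
Local Open Scope classical_set_scope.
Local Open Scope ring_scope.
Local Open Scope complex_scope.

Section special_functions.
Context {R : realType}.
Implicit Types (a b nu z : R) (m : nat).
Local Notation leb := (@lebesgue_measure R).

Definition Gamma a : R := \int[leb]_(t in `]0, +oo[) (t `^ (a - 1) * expR (- t)).

Definition Beta a b : R :=
  \int[leb]_(t in `]0, 1[) (t `^ (a - 1) * (1 - t) `^ (b - 1)).

Definition bessel_j nu z : R :=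
  Gamma (nu + 1) *
  limn (series (fun k : nat =>
    (-1) ^+ k / (k`!%:R * Gamma (nu + k%:R + 1)) * (z / 2) ^+ (2 * k)%N)).

(* L_m^a = \sum_(k <= m) (-1)^k 'C(m + a, m - k) 'X^k / k!, the generalized
   binomial coefficient being written with Gamma *)
Definition laguerre a m : {poly R} :=
  \poly_(k < m.+1)
    ((-1) ^+ k * Gamma (m%:R + a + 1)
     / (Gamma (k%:R + a + 1) * (m - k)`!%:R * k`!%:R)).

Definition laguerre_fun a m z : R :=
  expR (- z / 2) * (laguerre a m).[z] / (laguerre a m).[0].

Definition phi a (w : R * nat) (z : R * R) : R :=
  bessel_j (a - 2^-1) (w.1 * z.2) * laguerre_fun a w.2 (w.1 * z.1 ^+ 2).

Lemma Gamma_ge0 a : 0 <= Gamma a.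
Proof. by apply: Rintegral_ge0 => t _; rewrite mulr_ge0 ?powR_ge0 ?expR_ge0. Qed.

Lemma laguerre0_ge0 a m : 0 <= (laguerre a m).[0].
Proof.
rewrite horner_coef0 coef_poly /= expr0 mul1r.
by rewrite divr_ge0 ?mulr_ge0 ?Gamma_ge0 ?ler0n.
Qed.

End special_functions.

(* The two underlying spaces, as subsets of R * R and R * nat; both measures
   below are carried by them, and nothing below depends on the values of a
   function outside of them. *)
Definition KK {R : realType} : set (R * R) := [set z | 0 <= z.1 /\ 0 <= z.2].

Definition KKhat {R : realType} : set (R * nat) := [set w | 0 <= w.1].

Section measures.
Context {R : realType}.
Variable alpha : R.
Local Notation leb := (@lebesgue_measure R).

Definition m_density (z : R * R) : R :=
  (pi * Gamma (alpha + 1))^-1 * z.1 `^ (2 * alpha + 1) * z.2 `^ (2 * alpha).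

Definition m_alpha (A : set (R * R)) : \bar R :=
  (\int[leb \x leb]_(z in A `&` KK) (m_density z)%:E)%E.

Definition c_alpha : R :=
  2 * pi / (2 `^ (2 * alpha - 1) * Gamma (alpha + 2^-1) ^+ 2).

(* c_alpha * \sum_m L_m^alpha(0) * \int_0^oo 1_A(lambda, m) lambda^(3 alpha + 1) dlambda *)
Definition gamma_alpha (A : set (R * nat)) : \bar R :=
  (c_alpha%:E * \sum_(0 <= m <oo) ((laguerre alpha m).[0]%:E *
     \int[leb]_(l in ysection (A `&` KKhat) m) (l `^ (3 * alpha + 1))%:E))%E.

Lemma measurable_KK : measurable (@KK R).
Proof.
rewrite (_ : KK = `[0, +oo[%classic `*` `[0, +oo[%classic).
  exact: measurableX.
by apply/seteqP; split => -[x t] /=; rewrite !in_itv/= !andbT.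
Qed.

Lemma measurable_KKhat : measurable (@KKhat R).
Proof.
rewrite (_ : KKhat = `[0, +oo[%classic `*` setT).
  exact: measurableX.
by apply/seteqP; split => -[x t] /=; rewrite !in_itv/= !andbT => // -[].
Qed.

Lemma m_density_ge0 z : 0 <= m_density z.
Proof.
by rewrite !mulr_ge0 ?powR_ge0 ?invr_ge0 ?mulr_ge0 ?pi_ge0 ?Gamma_ge0.
Qed.

Lemma measurable_m_density : measurable_fun setT m_density.
Proof.
apply: measurable_funM; first apply: measurable_funM => //.
- exact: (measurableT_comp (measurable_powR _) measurable_fst).
- exact: (measurableT_comp (measurable_powR _) measurable_snd).
Qed.

Lemma c_alpha_ge0 : 0 <= c_alpha.
Proof.
by rewrite divr_ge0 ?mulr_ge0 ?pi_ge0 ?powR_ge0 ?exprn_ge0 ?Gamma_ge0.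
Qed.

Let m_alpha0 : m_alpha set0 = 0%E.
Proof. by rewrite /m_alpha set0I integral_set0. Qed.

Let m_alpha_ge0 A : (0 <= m_alpha A)%E.
Proof. by apply: integral_ge0 => z _; rewrite lee_fin m_density_ge0. Qed.

Let m_alpha_sigma_additive : semi_sigma_additive m_alpha.
Proof.
move=> A mA tA mUA.
have -> : m_alpha (\bigcup_n A n) = (\sum_(0 <= n <oo) m_alpha (A n))%E.
  rewrite /m_alpha setI_bigcupl ge0_integral_bigcup//.
  - by move=> k; apply: measurableI; [exact: mA | exact: measurable_KK].
  - apply/measurable_EFinP; apply: measurable_funTS.
    exact: measurable_m_density.
  - by move=> z _; rewrite lee_fin m_density_ge0.
  - exact: trivIset_setIr.
by apply: is_cvg_nneseries => n _ _; exact: m_alpha_ge0.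
Qed.

HB.instance Definition _ := isMeasure.Build _ _ _
  m_alpha m_alpha0 m_alpha_ge0 m_alpha_sigma_additive.

Let slice_ge0 m A :
  (0 <= (laguerre alpha m).[0]%:E *
     \int[leb]_(l in ysection (A `&` KKhat) m) (l `^ (3 * alpha + 1))%:E)%E.
Proof.
apply: mule_ge0; first by rewrite lee_fin laguerre0_ge0.
by apply: integral_ge0 => l _; rewrite lee_fin powR_ge0.
Qed.

Let gamma_alpha0 : gamma_alpha set0 = 0%E.
Proof.
rewrite /gamma_alpha eseries0 ?mule0// => m _ _.
by rewrite set0I ysection0 integral_set0 mule0.
Qed.

Let gamma_alpha_ge0 A : (0 <= gamma_alpha A)%E.
Proof.
apply: mule_ge0; first by rewrite lee_fin c_alpha_ge0.
exact: nneseries_ge0.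
Qed.

Let gamma_alpha_sigma_additive : semi_sigma_additive gamma_alpha.
Proof.
move=> A mA tA mUA.
have -> : gamma_alpha (\bigcup_n A n) = (\sum_(0 <= n <oo) gamma_alpha (A n))%E.
  rewrite /gamma_alpha nneseriesZl ?lee_fin ?c_alpha_ge0//; last first.
    by move=> n _; exact: nneseries_ge0.
  rewrite nneseries_interchange//; congr (_ * _)%E.
  apply: eq_eseriesr => m _.
  rewrite setI_bigcupl ysection_bigcup ge0_integral_bigcup//.
  - rewrite nneseriesZl// => n _.
    by apply: integral_ge0 => l _; rewrite lee_fin powR_ge0.
  - move=> n; apply: measurable_ysection.
    by apply: measurableI; [exact: mA | exact: measurable_KKhat].
  - apply/measurable_EFinP; apply: measurable_funTS.
    exact: measurable_powR.
  - by move=> l _; rewrite lee_fin powR_ge0.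
  - by apply: trivIset_ysection; exact: trivIset_setIr.
by apply: is_cvg_nneseries => n _ _; exact: gamma_alpha_ge0.
Qed.

HB.instance Definition _ := isMeasure.Build _ _ _
  gamma_alpha gamma_alpha0 gamma_alpha_ge0 gamma_alpha_sigma_additive.

End measures.

Section complex_functions.
Context d (T : measurableType d) (R : realType).
Variable mu : {measure set T -> \bar R}.
Implicit Types (D : set T) (f : T -> R[i]) (p : \bar R).

Definition cmeasurable D f :=
  measurable_fun D (fun x => complex.Re (f x)) /\
  measurable_fun D (fun x => complex.Im (f x)).

Definition cintegral D f : R[i] :=
  (\int[mu]_(x in D) complex.Re (f x)) +i* (\int[mu]_(x in D) complex.Im (f x)).

Definition cLnorm D p f : \bar R :=
  'N[mu]_p[(fun x => (ComplexField.Normc.normc (f x))%:E) \_ D]%E.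

Definition cLp D p f := cmeasurable D f /\ (cLnorm D p f < +oo)%E.

End complex_functions.

Section laguerre_bessel_transform.
Context {R : realType}.
Variable alpha : R.

Definition hnorm (z : R * R) : R := (z.1 ^+ 4 + 4 * z.2 ^+ 2) `^ 4^-1.

Definition F_LB (f : R * R -> R[i]) (w : R * nat) : R[i] :=
  cintegral (m_alpha alpha) KK (fun z => f z * (phi alpha w z)%:C).

(* g represents the image of f under the continuous extension of F_LB from
   L^1 \cap L^2, dense in L^2, to L^2. *)
Definition is_F_LB2 (f : R * R -> R[i]) (g : R * nat -> R[i]) :=
  cLp (gamma_alpha alpha) KKhat 2%:E g /\
  exists f_ : nat -> R * R -> R[i],
  [/\ forall n, cLp (m_alpha alpha) KK 1%E (f_ n) /\
                cLp (m_alpha alpha) KK 2%:E (f_ n),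
      cLnorm (m_alpha alpha) KK 2%:E (fun z => f_ n z - f z)
        @[n --> \oo] --> 0%E &
      cLnorm (gamma_alpha alpha) KKhat 2%:E (fun w => F_LB (f_ n) w - g w)
        @[n --> \oo] --> 0%E].

(* F_LB on L^2. By the Plancherel theorem, every f in L^2 has an image g, unique
   up to a gamma_alpha-null set; xget selects a representative. *)
Definition F_LB2 (f : R * R -> R[i]) : R * nat -> R[i] :=
  xget (fun=> 0) [set g | is_F_LB2 f g].

Definition K_const (s : R) : R :=
  (Beta ((alpha + 1) / 2) ((2 * alpha + 1) / 2) * (3 * alpha + 2 - s)
   / (4 `^ (alpha + 1) * pi * Gamma (alpha + 1) * s ^+ 2))
    `^ (s / (2 * (3 * alpha + 2)))
  * ((3 * alpha + 2) / (3 * alpha + 2 - s)).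

End laguerre_bessel_transform.

(* Main.v *)
(**
  Only the contraction half of the Plancherel theorem is needed. The Laguerre functions are
  orthogonal for a power weight, so Bessel's inequality bounds the x-part of the transform at
  each fixed lambda. The t-part is a Hankel transform, and its L^2 bound is obtained from the
  same Bessel inequality: at scale [1 / (4 N)] the Laguerre function of degree [~ rho^2 N]
  tends to the Bessel kernel at [rho], so the discrete inequality passes to the limit by
  Fatou's lemma. Tonelli combines the two parts, the constants multiplying to 1.

  Then f is split at homogeneous radius r. The inner part has, by Cauchy-Schwarz, an L^1 norm
  at most [C r^(3 alpha + 2 - s) N] with [N = || |(x,t)|^s f ||_2], where the integral of
  [|(x,t)|^(-2s)] over the ball is computed with the parabolic substitution [t = x^2 u / 2]
  and a Beta integral; since the kernel is bounded by 1, this bounds its transform uniformly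
  on E. The outer part has L^2 norm at most [r^(-s) N]. Optimizing in r gives the
  inequality with a constant smaller than K_(alpha,s) by the factor
  [2^(s / (2 (3 alpha + 2)))], which is why the inequality is strict.
*)

(* The bound 1 on the kernel has two unrelated sources. For order 0, [laguerre 0 m] at [x] is, up to
   sign and a factorial, the Charlier polynomial of degree [m] at the integer [m], and one term of
   its squared Poisson norm is at most the whole; orders [alpha >= 0] follow because their Laguerre
   polynomials are combinations of those of order 0 with nonnegative coefficients. For the Bessel
   factor, an energy of Bessel's equation is nonincreasing as soon as the order is at least -1/2,
   which is [alpha >= 0] again. The Hankel bound has to cover orders in [-1/2, 0), beyond the reach
   of the Charlier argument; there a cruder bound on Laguerre functions is used, which stays finite
   in the scaling limit. [F_LB2] is a choice. If [f] has an image [g], the only access to [g] is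
   through integrable functions [f_ n] close to [f], so every estimate is made on their transforms
   and passed to the limit. If there is no image, the chosen value is 0 and the claim is positivity
   of the right-hand side. *)
From HB Require Import structures.
Require Import Defs.
From mathcomp Require Import all_boot all_order all_algebra.
From mathcomp Require Import all_classical all_reals all_analysis.
From mathcomp Require Import complex measurable_realfun ring lra.

Set Implicit Arguments.
Unset Strict Implicit.
Unset Printing Implicit Defensive.
Import Order.TTheory GRing.Theory Num.Theory.
Import numFieldNormedType.Exports.
Local Open Scope classical_set_scope.
Local Open Scope ring_scope.

(** * Substitution on the half line *)

Section positive_half_line.
Context {R : realType}.
Local Notation leb := (@lebesgue_measure R).
Implicit Types (F f G : R -> R) (a b : R).

Local Notation pos := (`]0, +oo[%classic : set R).

(** Compact exhaustion of the open half line. Integrands that may be singular at 0 or have infinite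
    integral are treated on these intervals and recovered by monotone convergence. *)
Definition itvn (n : nat) : set R := `[n.+1%:R^-1, n.+1%:R]%classic.

Lemma invn_lt n : (n.+1%:R^-1 : R) <= n.+1%:R.
Proof. by rewrite (le_trans (y := 1))// ?invf_le1 ?ler1n. Qed.

Lemma near_pos (x : R) : 0 < x -> \forall y \near x, 0 < y.
Proof. by move=> x0; exact: lt_nbhsr. Qed.

Lemma bigcup_itv_oy : \bigcup_n itvn n = pos.
Proof.
apply/seteqP; split => x /=.
  move=> [n _]; rewrite /itvn/= !in_itv/= andbT => /andP[+ _].
  by apply: lt_le_trans; rewrite invr_gt0.
rewrite in_itv/= andbT => x0.
pose n : nat := maxn (Num.truncn x) (Num.truncn x^-1).
exists n => //=; rewrite /itvn/= in_itv/=; apply/andP; split.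
  rewrite invf_ple ?posrE//; apply/ltW.
  by apply: (lt_le_trans (truncnS_gt _)); rewrite ler_nat ltnS leq_maxr.
by apply/ltW/(lt_le_trans (truncnS_gt _)); rewrite ler_nat ltnS leq_maxl.
Qed.

Lemma nd_itv_oy : nondecreasing_seq itvn.
Proof.
move=> m n mn; apply/subsetPset => x; rewrite /itvn/= !in_itv/= => /andP[mx xm].
apply/andP; split; last by rewrite (le_trans xm)// ler_nat ltnS.
by rewrite (le_trans _ mx)// lef_pV2 ?posrE// ler_nat ltnS.
Qed.

Lemma cvg_integral_oy f :
  measurable_fun pos f -> (forall x : R, 0 < x -> 0 <= f x) ->
  (\int[leb]_(x in itvn n) (f x)%:E)%E @[n --> \oo] -->
  (\int[leb]_(x in pos) (f x)%:E)%E.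
Proof.
move=> mf f0; rewrite -bigcup_itv_oy.
have sub n : itvn n `<=` pos.
  by rewrite -bigcup_itv_oy => x nx; exists n.
apply: ge0_nondecreasing_set_cvg_integral => //.
- exact: nd_itv_oy.
- by move=> n; exact: measurable_itv.
- by move=> n; apply/measurable_EFinP; exact: measurable_funS mf.
- by move=> n x /sub/=; rewrite in_itv/= andbT => x0; rewrite lee_fin f0.
Qed.

Lemma continuous_pos_within f a b : 0 < a ->
  (forall x : R, 0 < x -> {for x, continuous f}) -> {within `[a, b], continuous f}.
Proof.
move=> a0 cf; apply: continuous_in_subspaceT => x; rewrite inE/= in_itv/= => /andP[ax _].
exact/cf/(lt_le_trans a0).
Qed.

Lemma continuous_pos_measurable f :
  (forall x : R, 0 < x -> {for x, continuous f}) -> measurable_fun pos f.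
Proof.
move=> cf; apply: open_continuous_measurable_fun => //.
by move=> x; rewrite inE/= in_itv/= andbT; exact: cf.
Qed.

Lemma derive_pos_LR F f a b : 0 < a -> a < b ->
  (forall x : R, 0 < x -> is_derive x 1 F (f x)) -> derivable_oo_LRcontinuous F a b.
Proof.
move=> a0 ab dF.
have cF (x : R) : 0 < x -> {for x, continuous F}.
  by move=> x0; apply: differentiable_continuous; apply/derivable1_diffP; have [] := dF x x0.
split.
- move=> x; rewrite in_itv/= => /andP[ax _].
  by have [] := dF x (lt_trans a0 ax).
- exact/cvg_at_right_filter/cF.
- exact/cvg_at_left_filter/cF/(lt_trans a0).
Qed.

Lemma FTC_pos F f a b : 0 < a -> a <= b ->
  (forall x : R, 0 < x -> is_derive x 1 F (f x)) ->
  (forall x : R, 0 < x -> {for x, continuous f}) ->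
  (\int[leb]_(x in `[a, b]) (f x)%:E = (F b - F a)%:E)%E.
Proof.
move=> a0 + dF cf; rewrite le_eqVlt => /predU1P[<-|ab].
  by rewrite set_itv1 integral_set1 subrr.
rewrite EFinB (@continuous_FTC2 _ _ F)//.
- exact: continuous_pos_within.
- exact: derive_pos_LR dF.
- move=> x; rewrite in_itv/= => /andP[ax _].
  by have [_ <-] := dF x (lt_trans a0 ax); rewrite derive1E.
Qed.

Section substitution.
Variables (F f G : R -> R) (D : set R).
Hypothesis dF : forall x : R, 0 < x -> is_derive x 1 F (f x).
Hypothesis cf : forall x : R, 0 < x -> {for x, continuous f}.
Hypothesis imF : D = F @` pos.
Hypothesis cG : forall x, D x -> {for x, continuous G}.
Hypothesis G0 : forall x, D x -> 0 <= G x.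

Let cF (x : R) : 0 < x -> {for x, continuous F}.
Proof.
by move=> x0; apply: differentiable_continuous; apply/derivable1_diffP; have [] := dF x0.
Qed.

Let dFE (x : R) : 0 < x -> F^`()%classic x = f x.
Proof. by move=> x0; have [_ <-] := dF x0; rewrite derive1E. Qed.

Let cdF (x : R) : 0 < x -> {for x, continuous F^`()%classic}.
Proof.
move=> x0; rewrite /prop_for /continuous_at dFE//.
apply: cvg_trans (cf x0); apply: near_eq_cvg.
by near=> y; rewrite dFE//; near: y; exact: near_pos.
Unshelve. all: by end_near. Qed.

Let DF (x : R) : 0 < x -> D (F x).
Proof. by move=> x0; rewrite imF; exists x => //=; rewrite in_itv/= andbT. Qed.

Let mGFf : measurable_fun pos (fun x => G (F x) * f x).
Proof.
apply: continuous_pos_measurable => x x0; apply: cvgM; last exact: cf.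
by apply: continuous_comp; [exact: cF|exact/cG/DF].
Qed.

Let exhaustion : (\bigcup_n F @` itvn n)%classic = D.
Proof. by rewrite -image_bigcup bigcup_itv_oy imF. Qed.

Let cvg_D : (forall n : nat, measurable (F @` itvn n)) ->
  (forall n : nat, exists a b, F @` itvn n = `[a, b]%classic) ->
  (\int[leb]_(x in F @` itvn n) (G x)%:E)%E @[n --> \oo] -->
  (\int[leb]_(x in D) (G x)%:E)%E.
Proof.
move=> mFn itvFn; rewrite -exhaustion.
have sub n : F @` itvn n `<=` D.
  by rewrite -exhaustion => x nx; exists n.
apply: ge0_nondecreasing_set_cvg_integral => //.
- move=> m n mn; apply/subsetPset; apply: image_subset.
  by apply/subsetPset; exact: nd_itv_oy.
- move=> n; apply/measurable_EFinP; have [a [b ab]] := itvFn n; rewrite ab.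
  apply: subspace_continuous_measurable_fun => //.
  apply: continuous_in_subspaceT => x /set_mem; rewrite -ab => /sub; exact: cG.
- by move=> n x /sub Dx; rewrite lee_fin G0.
Qed.

(** On each [itvn n] the image is a closed interval by the intermediate value theorem, and the usual
    change of variables applies; both sides are then monotone limits, so the identity holds in the
    extended reals. *)
Lemma ge0_substitution_incr : (forall x : R, 0 < x -> 0 <= f x) ->
  (forall x y : R, 0 < x -> x < y -> F x < F y) ->
  (\int[leb]_(x in D) (G x)%:E)%E = (\int[leb]_(x in pos) (G (F x) * f x)%:E)%E.
Proof.
move=> f0 incrF.
have homoF (x y : R) : 0 < x -> x <= y -> F x <= F y.
  by move=> x0; rewrite le_eqVlt => /predU1P[->//|/incrF - /(_ x0)/ltW].
have i0 n : 0 < n.+1%:R^-1 :> R by rewrite invr_gt0.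
have imn n : F @` itvn n = `[F n.+1%:R^-1, F n.+1%:R]%classic.
  apply/seteqP; split => [y [x + <-]|y] /=.
    rewrite /itvn/= !in_itv/= => /andP[nx xn]; have x0 : 0 < x.
      by rewrite (lt_le_trans _ nx).
    by rewrite !homoF.
  rewrite in_itv/= => ny.
  have [|x xn Fx] := @IVT _ F _ _ y (invn_lt n) (continuous_pos_within (i0 n) cF).
    by have Fn := homoF _ _ (i0 n) (invn_lt n); rewrite (min_idPl Fn) (max_idPr Fn).
  by exists x.
have limD := cvg_D (fun n => eq_ind_r measurable (measurable_itv _) (imn n))
  (fun n => ex_intro _ _ (ex_intro _ _ (imn n))).
rewrite -(cvg_lim _ limD)//; apply: cvg_lim => //.
have /(cvg_integral_oy mGFf) : forall x : R, 0 < x -> 0 <= G (F x) * f x.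
  by move=> x x0; rewrite mulr_ge0 ?f0// G0//; exact: DF.
apply: cvg_trans; apply: near_eq_cvg; near=> n.
rewrite imn integration_by_substitution_increasing//.
- apply: eq_integral => x; rewrite inE /itvn/= in_itv/= => /andP[nx _].
  by rewrite fctE dFE// (lt_le_trans _ nx).
- exact: invn_lt.
- move=> x y; rewrite !in_itv/= => /andP[nx _] _; apply: incrF.
  by rewrite (lt_le_trans _ nx).
- move=> x; rewrite in_itv/= => /andP[nx _]; apply: cdF.
  by rewrite (lt_trans _ nx).
- by apply: cvgP; apply: cvg_at_right_filter; exact: cdF.
- by apply: cvgP; apply: cvg_at_left_filter; exact: cdF.
- apply: derive_pos_LR dF => //.
  (* [itvn 0] is the single point 1, whereas [derive_pos_LR] asks for a nondegenerate interval. *)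
  have n0 : (0 < n)%N by near: n; exact: nbhs_infty_gt.
  by rewrite (@lt_trans _ _ 1)// ?invf_lt1// ltr1n ltnS.
- rewrite -imn; apply: continuous_in_subspaceT => x /set_mem[y + <-].
  rewrite /itvn/= in_itv/= => /andP[ny _]; apply/cG/DF.
  by rewrite (lt_le_trans _ ny).
Unshelve. all: by end_near. Qed.

Lemma ge0_substitution_decr : (forall x : R, 0 < x -> f x <= 0) ->
  (forall x y : R, 0 < x -> x < y -> F y < F x) ->
  (\int[leb]_(x in D) (G x)%:E)%E = (\int[leb]_(x in pos) (G (F x) * - f x)%:E)%E.
Proof.
move=> f0 decrF.
have homoF (x y : R) : 0 < x -> x <= y -> F y <= F x.
  by move=> x0; rewrite le_eqVlt => /predU1P[->//|/decrF - /(_ x0)/ltW].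
have i0 n : 0 < n.+1%:R^-1 :> R by rewrite invr_gt0.
have imn n : F @` itvn n = `[F n.+1%:R, F n.+1%:R^-1]%classic.
  apply/seteqP; split => [y [x + <-]|y] /=.
    rewrite /itvn/= !in_itv/= => /andP[nx xn]; have x0 : 0 < x.
      by rewrite (lt_le_trans _ nx).
    by rewrite !homoF.
  rewrite in_itv/= => ny.
  have [|x xn Fx] := @IVT _ F _ _ y (invn_lt n) (continuous_pos_within (i0 n) cF).
    by have Fn := homoF _ _ (i0 n) (invn_lt n); rewrite (min_idPr Fn) (max_idPl Fn).
  by exists x.
have limD := cvg_D (fun n => eq_ind_r measurable (measurable_itv _) (imn n))
  (fun n => ex_intro _ _ (ex_intro _ _ (imn n))).
rewrite -(cvg_lim _ limD)//; apply: cvg_lim => //.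
have mGFf' : measurable_fun pos (fun x => G (F x) * - f x).
  rewrite [X in measurable_fun _ X](_ : _ = -%R \o (fun x => G (F x) * f x)).
    exact: measurableT_comp.
  by apply/funext => x /=; rewrite mulrN.
have /(cvg_integral_oy mGFf') : forall x : R, 0 < x -> 0 <= G (F x) * - f x.
  by move=> x x0; rewrite mulr_ge0 ?oppr_ge0 ?f0// G0//; exact: DF.
apply: cvg_trans; apply: near_eq_cvg; near=> n.
rewrite imn integration_by_substitution_decreasing//.
- apply: eq_integral => x; rewrite inE /itvn/= in_itv/= => /andP[nx _].
  by rewrite -(dFE (lt_le_trans (i0 n) nx)).
- exact: invn_lt.
- move=> x y; rewrite !in_itv/= => _ /andP[nx _]; apply: decrF.
  by rewrite (lt_le_trans _ nx).
- move=> x; rewrite in_itv/= => /andP[nx _]; apply: cdF.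
  by rewrite (lt_trans _ nx).
- by apply: cvgP; apply: cvg_at_right_filter; exact: cdF.
- by apply: cvgP; apply: cvg_at_left_filter; exact: cdF.
- apply: derive_pos_LR dF => //.
  have n0 : (0 < n)%N by near: n; exact: nbhs_infty_gt.
  by rewrite (@lt_trans _ _ 1)// ?invf_lt1// ltr1n ltnS.
- rewrite -imn; apply: continuous_in_subspaceT => x /set_mem[y + <-].
  rewrite /itvn/= in_itv/= => /andP[ny _]; apply/cG/DF.
  by rewrite (lt_le_trans _ ny).
Unshelve. all: by end_near. Qed.

End substitution.
End positive_half_line.

(** * Real powers: derivatives, limits, decay against the exponential *)

Section powers.
Context {R : realType}.

Lemma ln_le_subr1 (x : R) : 0 < x -> ln x <= x - 1.
Proof. by move=> x0; rewrite -{1}[x](subrKC 1) le_ln1Dx// ltrBrDr addNr. Qed.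

Lemma powRD_gt0 (x p q : R) : 0 < x -> x `^ (p + q) = x `^ p * x `^ q.
Proof. by move=> x0; rewrite powRD// (gt_eqF x0) implybT. Qed.

Lemma powRB_gt0 (x p q : R) : 0 < x -> x `^ (p - q) = x `^ p / x `^ q.
Proof. by move=> x0; rewrite powRB// (gt_eqF x0) implybT. Qed.

Lemma is_derive_powR (p x : R) : 0 < x -> is_derive x 1 (fun y : R => y `^ p) (p * x `^ (p - 1)).
Proof.
move=> x0; have xpos : x \in `]0, +oo[ by rewrite in_itv/= x0.
split; first exact: derivable_powR.
by rewrite -derive1E powR_derive1.
Qed.

Lemma continuous_powR (p x : R) : 0 < x -> {for x, continuous (fun y : R => y `^ p)}.
Proof.
move=> /is_derive_powR => /(_ p)[dp _].
by apply: differentiable_continuous; apply/derivable1_diffP.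
Qed.

Lemma cvg_invn_powR (p : R) : 0 < p -> (n.+1%:R^-1 : R) `^ p @[n --> \oo] --> (0 : R).
Proof.
move=> p0; have /cvgrPdist_lt/= h := @powR_cvg0 R p p0.
apply/cvgrPdist_lt => e e0; have [d /= d0 hd] := h _ e0.
have [N _ HN] : \forall n \near \oo, (n.+1%:R^-1 : R) < d.
  have := @cvg_harmonic R; move=> /cvgrPdist_lt/(_ _ d0); apply: filterS => n.
  by rewrite sub0r normrN ger0_norm /harmonic/=.
near=> n; apply: hd => //=.
rewrite sub0r normrN ger0_norm//; apply: HN => /=; near: n; exact: nbhs_infty_ge.
Unshelve. all: by end_near. Qed.

(** Keep only the term of degree [k.+1] of the exponential series. The one spare power gives the
    decay [1 / x], which removes the boundary term at infinity in [eGammaD1]. *)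
Lemma powR_expRN_le (c x : R) (k : nat) : c <= k%:R -> 1 <= x ->
  x `^ c * expR (- x) <= k.+1`!%:R / x.
Proof.
move=> ck x1; have x0 : 0 < x by rewrite (lt_le_trans _ x1).
apply: (@le_trans _ _ (x ^+ k * expR (- x))).
  by rewrite ler_wpM2r ?expR_ge0// -powR_mulrn ?(ltW x0)// ler_powR.
rewrite expRN ler_pdivlMr// mulrAC -exprSr ler_pdivrMr ?expR_gt0//.
rewrite -ler_pdivrMl ?ltr0n ?fact_gt0// mulrC.
by apply: le_trans (expR_ge1Dxn k (ltW x0)); rewrite lerDr ler01.
Qed.

End powers.

(** * The Gamma function *)

Section gamma.
Context {R : realType}.
Local Notation leb := (@lebesgue_measure R).
Local Notation pos := (`]0, +oo[%classic : set R).
Implicit Types (c t : R).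

Definition gamma_fun c t : R := t `^ (c - 1) * expR (- t).

(** The Gamma integral before [fine] is applied: its finiteness is a theorem, [eGamma_fin], and
    until then [Gamma] could hide an infinite value. *)
Definition eGamma c : \bar R := (\int[leb]_(t in pos) (gamma_fun c t)%:E)%E.

Lemma gamma_fun_ge0 c t : 0 <= gamma_fun c t.
Proof. by rewrite mulr_ge0 ?powR_ge0 ?expR_ge0. Qed.

Lemma continuous_expRN t : {for t, continuous (fun x : R => expR (- x))}.
Proof. by apply: continuous_comp; [exact: opp_continuous|exact: continuous_expR]. Qed.

Lemma continuous_gamma_fun c t : 0 < t -> {for t, continuous (gamma_fun c)}.
Proof. by move=> t0; apply: cvgM; [exact: continuous_powR|exact: continuous_expRN]. Qed.

Lemma measurable_gamma_fun c : measurable_fun setT (gamma_fun c).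
Proof.
apply: measurable_funM; first exact: measurable_powR.
by apply: measurableT_comp => //; exact: measurableT_comp.
Qed.

Lemma eGamma_ge0 c : (0 <= eGamma c)%E.
Proof. by apply: integral_ge0 => t _; rewrite lee_fin gamma_fun_ge0. Qed.

Lemma cvg_eGamma c :
  (\int[leb]_(t in itvn n) (gamma_fun c t)%:E)%E @[n --> \oo] --> eGamma c.
Proof.
apply: cvg_integral_oy => [|t _]; last exact: gamma_fun_ge0.
by apply: measurable_funTS; exact: measurable_gamma_fun.
Qed.

Lemma integrable_gamma_fun_itvn c n : leb.-integrable (itvn n) (EFin \o gamma_fun c).
Proof.
apply: continuous_compact_integrable; first exact: segment_compact.
by apply: continuous_pos_within; [rewrite invr_gt0|exact: continuous_gamma_fun].
Qed.

Lemma is_derive_expRN t : is_derive t 1 (fun x : R => expR (- x)) (- expR (- t)).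
Proof.
have d1 : is_derive t 1 (fun x : R => - x) (- 1) by apply: is_deriveN.
apply: is_derive_eq (is_derive1_comp (is_derive_expR _) d1) _.
by rewrite mulrN1.
Qed.

Lemma is_derive_powR_expRN c t : 0 < t ->
  is_derive t 1 (fun x => x `^ c * expR (- x))
    (c * gamma_fun c t - gamma_fun (c + 1) t).
Proof.
move=> t0; have := is_derive_powR c t0 => dp.
have de : is_derive t 1 (fun x : R => expR (- x)) (- expR (- t)).
  exact: is_derive_expRN.
apply: is_derive_eq (is_deriveM dp de) _.
by rewrite /gamma_fun addrK /GRing.scale/=; ring.
Qed.

(** Integration by parts on each [itvn n]; the boundary values of [x ^ c * exp (- x)] tend to 0 at
    both ends. The identity is needed in the extended reals because finiteness is deduced from
    it. *)
Lemma eGammaD1 c : 0 < c -> (eGamma (c + 1) = c%:E * eGamma c)%E.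
Proof.
move=> c0; pose F x : R := x `^ c * expR (- x).
have cF : (F n.+1%:R - F n.+1%:R^-1)%:E @[n --> \oo] --> (0 : \bar R)%E.
  apply: cvg_EFin; first exact: nearW.
  rewrite -[0 in X in _ --> X](subr0 (0 : R)); apply: cvgB.
  - pose k := (Num.truncn c).+1.
    apply: (@squeeze_cvgr _ _ _ _ (cst 0) (fun n => k.+1`!%:R * n.+1%:R^-1)).
    + apply: nearW => n; rewrite mulr_ge0 ?powR_ge0 ?expR_ge0//=.
      by rewrite powR_expRN_le ?ler1n// ltW// truncnS_gt.
    + exact: cvg_cst.
    + rewrite -(mulr0 (k.+1`!%:R)); apply: cvgMr; exact: cvg_harmonic.
  - apply: (@squeeze_cvgr _ _ _ _ (cst 0) (fun n => n.+1%:R^-1 `^ c)).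
    + apply: nearW => n; rewrite mulr_ge0 ?powR_ge0 ?expR_ge0//=.
      by rewrite ler_piMr ?powR_ge0// expR_le1 oppr_le0.
    + exact: cvg_cst.
    + exact: cvg_invn_powR.
have h n : (\int[leb]_(t in itvn n) (gamma_fun (c + 1) t)%:E +
    (F n.+1%:R - F n.+1%:R^-1)%:E = c%:E * \int[leb]_(t in itvn n) (gamma_fun c t)%:E)%E.
  rewrite -integralZl//; last 2 first.
  - exact: measurable_itv.
  - exact: integrable_gamma_fun_itvn.
  pose f t := c * gamma_fun c t - gamma_fun (c + 1) t.
  have cf (x : R) : 0 < x -> {for x, continuous f}.
    move=> x0; apply: cvgB; last exact: continuous_gamma_fun.
    by apply: cvgMr; exact: continuous_gamma_fun.
  have i0 : 0 < n.+1%:R^-1 :> R by rewrite invr_gt0.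
  have <- := FTC_pos i0 (invn_lt n) (fun x x0 => is_derive_powR_expRN c x0) cf.
  rewrite -integralD_EFin//.
  - by apply: eq_integral => t _; rewrite /= -EFinM -EFinD addrC subrK.
  - exact: measurable_itv.
  - exact: integrable_gamma_fun_itvn.
  - apply: continuous_compact_integrable; first exact: segment_compact.
    exact: continuous_pos_within.
have h1 := @cvg_eGamma (c + 1); have h2 := @cvg_eGamma c.
have h3 : (c%:E * \int[leb]_(t in itvn n) (gamma_fun c t)%:E)%E @[n --> \oo] -->
    (c%:E * eGamma c)%E by apply: cvgeZl.
rewrite -(cvg_lim _ h3)//; apply/esym/cvg_lim => //.
rewrite (_ : (fun n => _) = (fun n => (\int[leb]_(t in itvn n) (gamma_fun (c + 1) t)%:E +
    (F n.+1%:R - F n.+1%:R^-1)%:E)%E)); last by apply/funext.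
rewrite -[eGamma (c + 1)]adde0; apply: cvgeD => //.
by rewrite fin_num_adde_defl.
Qed.

Lemma eGamma1 : eGamma 1 = 1%E.
Proof.
rewrite -(cvg_lim _ (@cvg_eGamma 1))//; apply: cvg_lim => //.
have i0 n : 0 < n.+1%:R^-1 :> R by rewrite invr_gt0.
have dF (x : R) : 0 < x -> is_derive x 1 (fun x : R => - expR (- x)) (expR (- x)).
  by move=> x0; apply: is_derive_eq (is_deriveN (is_derive_expRN x)) _; rewrite opprK.
rewrite (_ : (fun n => _) = fun n => (- expR (- n.+1%:R) + expR (- n.+1%:R^-1))%:E).
  apply: cvg_EFin; first exact: nearW.
  rewrite -[X in _ --> X]add0r; apply: cvgD.
    rewrite -oppr0; apply: cvgN; rewrite (cvg_shiftS (fun n => expR (- n%:R))).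
    exact: cvgn_expR.
  rewrite -[X in _ --> X](@expR0 R) -[X in expR X]oppr0.
  apply: continuous_cvg; first exact: continuous_expR.
  by apply: cvgN; exact: cvg_harmonic.
apply/funext => n.
transitivity (\int[leb]_(t in itvn n) (expR (- t))%:E)%E.
  by apply: eq_integral => t _; rewrite /gamma_fun subrr powRr0 mul1r.
rewrite (FTC_pos (i0 n) (invn_lt n) dF) ?opprK// => x _; exact: continuous_expRN.
Qed.

Lemma eGammaSn_fin (n : nat) : (eGamma n.+1%:R < +oo)%E.
Proof.
elim: n => [|n IH]; first by rewrite eGamma1 ltry.
by rewrite -[n.+2%:R]natr1 eGammaD1 ?ltr0n// lte_mul_pinfty.
Qed.

(** For an exponent [x >= 1], [t ^ (x - 1) <= 1 + t ^ k] reduces the claim to integer arguments.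
    Below 1 the functional equation is read backwards: [c * eGamma c] is finite. *)
Lemma eGamma_fin c : 0 < c -> (eGamma c < +oo)%E.
Proof.
have H (x : R) : 1 <= x -> (eGamma x < +oo)%E.
  move=> x1; pose k := (Num.truncn x).+1.
  have xk : x - 1 <= k%:R by rewrite lerBlDr (le_trans (ltW (truncnS_gt _)))// lerDl.
  apply: (@le_lt_trans _ _ (eGamma 1 + eGamma k.+1%:R)%E); last first.
    by rewrite eGamma1 lte_add_pinfty ?ltry// eGammaSn_fin.
  rewrite -ge0_integralD//; last 4 first.
  - by move=> t _; rewrite lee_fin gamma_fun_ge0.
  - by apply/measurable_EFinP/measurable_funTS; exact: measurable_gamma_fun.
  - by move=> t _; rewrite lee_fin gamma_fun_ge0.
  - by apply/measurable_EFinP/measurable_funTS; exact: measurable_gamma_fun.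
  apply: ge0_le_integral => //.
  - by move=> t _; rewrite lee_fin gamma_fun_ge0.
  - by apply/measurable_EFinP/measurable_funTS; exact: measurable_gamma_fun.
  - by apply/measurable_EFinP/measurable_funTS/measurable_funD; exact: measurable_gamma_fun.
  move=> t /=; rewrite in_itv/= andbT => t0.
  rewrite -EFinD lee_fin /gamma_fun -mulrDl ler_wpM2r ?expR_ge0// subrr powRr0.
  rewrite -[k.+1%:R]natr1 addrK powR_mulrn ?(ltW t0)//.
  have [t1|t1] := lerP t 1.
    rewrite (le_trans (y := 1))// ?lerDl ?exprn_ge0 ?(ltW t0)//.
    by rewrite -[leRHS](powRr0 t) ger_powR ?t0//= subr_ge0.
  rewrite (le_trans (y := t ^+ k))// ?lerDr// -powR_mulrn ?(ltW t0)//.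
  by rewrite ler_powR ?(ltW t1).
move=> c0; have [c1|c1] := lerP 1 c; first exact: H.
have := H (c + 1); rewrite lerDr (ltW c0) eGammaD1// => /(_ isT).
have [->|] := eqVneq (eGamma c) +oo%E; first by rewrite gt0_muley ?lte_fin.
by move=> ? _; rewrite ltey.
Qed.

Lemma EFin_Gamma c : 0 < c -> (Gamma c)%:E = eGamma c.
Proof.
by move=> c0; rewrite /Gamma/Rintegral fineK// ge0_fin_numE ?eGamma_ge0// eGamma_fin.
Qed.

Lemma GammaD1 c : 0 < c -> Gamma (c + 1) = c * Gamma c.
Proof.
move=> c0; apply: EFin_inj.
by rewrite EFinM !EFin_Gamma ?eGammaD1// ltr_wpDr.
Qed.

Lemma Gamma_nat (n : nat) : Gamma (n%:R + 1) = n`!%:R :> R.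
Proof.
elim: n => [|n IH]; first by apply: EFin_inj; rewrite EFin_Gamma add0r ?eGamma1.
by rewrite GammaD1 ?ltr0n// -natr1 IH natr1 factS natrM.
Qed.

Lemma integrable_gamma_fun c : 0 < c -> leb.-integrable pos (EFin \o gamma_fun c).
Proof.
move=> c0; apply/integrableP; split.
  by apply/measurable_EFinP/measurable_funTS; exact: measurable_gamma_fun.
apply: le_lt_trans (eGamma_fin c0); rewrite le_eqVlt; apply/predU1P; left.
by apply: eq_integral => t _; rewrite /= ger0_norm ?gamma_fun_ge0.
Qed.

Lemma GammaE c : Gamma c = \int[leb]_(t in pos) gamma_fun c t.
Proof. by []. Qed.

Lemma integrable_gamma_fun2 (a b c d : R) : 0 < c -> 0 < d ->
  leb.-integrable pos (EFin \o (fun t => a * gamma_fun c t + b * gamma_fun d t)).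
Proof.
move=> c0 d0.
have -> : EFin \o (fun t => a * gamma_fun c t + b * gamma_fun d t) =
  ((fun t => a%:E * (EFin \o gamma_fun c) t) \+ (fun t => b%:E * (EFin \o gamma_fun d) t))%E by [].
by apply: integrableD => //; apply: integrableZl => //; exact: integrable_gamma_fun.
Qed.

Lemma Rintegral_gamma_fun2 (a b c d : R) : 0 < c -> 0 < d ->
  \int[leb]_(t in pos) (a * gamma_fun c t + b * gamma_fun d t) = a * Gamma c + b * Gamma d.
Proof.
move=> c0 d0.
rewrite RintegralD//; last 2 first.
- have -> : EFin \o (fun t => a * gamma_fun c t) = (fun t => a%:E * (EFin \o gamma_fun c) t)%E by [].
  by apply: integrableZl => //; exact: integrable_gamma_fun.
- have -> : EFin \o (fun t => b * gamma_fun d t) = (fun t => b%:E * (EFin \o gamma_fun d) t)%E by [].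
  by apply: integrableZl => //; exact: integrable_gamma_fun.
by rewrite !RintegralZl//; exact: integrable_gamma_fun.
Qed.

(* Jensen-type bounds for the moments of the Gamma(m + 1) law: integrate the tangent-line
   inequality [t ^ nu >= M ^ nu * (1 + nu * ln (t / M))], where [ln] is bounded below by
   [1 - M / t] if [0 <= nu] and above by [t / M - 1] if [nu <= 0]. *)
Lemma Gamma_ge_pow (m : nat) (nu : R) : (0 < m)%N -> 0 <= nu ->
  m`!%:R * m%:R `^ nu <= Gamma (m%:R + nu + 1).
Proof.
move=> m0 nu0; have M0 : 0 < m%:R :> R by rewrite ltr0n.
have M1 : 0 < m%:R + 1 :> R by rewrite ltr_wpDl.
have -> : m`!%:R * m%:R `^ nu = \int[leb]_(t in pos)
   (m%:R `^ nu * (1 + nu) * gamma_fun (m%:R + 1) t +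
    - (m%:R `^ nu * nu * m%:R) * gamma_fun m%:R t) :> R.
  by rewrite Rintegral_gamma_fun2// -Gamma_nat GammaD1//; ring.
rewrite GammaE; apply: le_Rintegral => //.
- exact: integrable_gamma_fun2.
- by apply: integrable_gamma_fun; rewrite ltr_wpDl// addr_ge0// ltW.
move=> t /=; rewrite in_itv/= andbT => t0.
rewrite /gamma_fun !addrK.
have -> : t `^ (m%:R + nu) = m%:R `^ nu * (t / m%:R) `^ nu * t `^ m%:R.
  rewrite -powRM ?(ltW M0) ?divr_ge0 ?(ltW t0) ?(ltW M0)// mulrCA divff ?gt_eqF// mulr1.
  by rewrite addrC powRD_gt0.
rewrite powRB_gt0// powRr1 ?(ltW t0)//.
rewrite [leLHS](_ : _ = m%:R `^ nu * (1 + nu * (1 - m%:R / t)) * (t `^ m%:R * expR (- t))).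
  rewrite -[leRHS]mulrA ler_wpM2r ?mulr_ge0 ?powR_ge0 ?expR_ge0// ler_wpM2l ?powR_ge0//.
  rewrite [leRHS]/powR gt_eqF ?divr_gt0// (le_trans _ (expR_ge1Dx _))//.
  rewrite lerD2l ler_wpM2l// -[t / m%:R]invrK lnV ?posrE ?invr_gt0 ?divr_gt0// invf_div lerNr opprB.
  by rewrite ln_le_subr1// divr_gt0.
by field; exact: lt0r_neq0.
Qed.

(** The base [m.+1] is the mean of [t], at which the linear correction integrates to 0; in
    [Gamma_ge_pow] the correction is in [1 / t], whose mean is [1 / m], hence the base [m] there. *)
Lemma Gamma_ge_pow_le0 (m : nat) (nu : R) : -1 < nu -> nu <= 0 ->
  m`!%:R * m.+1%:R `^ nu <= Gamma (m%:R + nu + 1).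
Proof.
move=> nu1 nu0; have M0 : 0 < m.+1%:R :> R by rewrite ltr0n.
have m1 : 0 < m%:R + 1 :> R by rewrite ltr_wpDl.
have m2 : 0 < m%:R + 1 + 1 :> R by rewrite addr_gt0.
have -> : m`!%:R * m.+1%:R `^ nu = \int[leb]_(t in pos)
   (m.+1%:R `^ nu * (1 - nu) * gamma_fun (m%:R + 1) t +
    m.+1%:R `^ nu * nu / m.+1%:R * gamma_fun (m%:R + 1 + 1) t) :> R.
  rewrite Rintegral_gamma_fun2// (GammaD1 m1) Gamma_nat natr1; field.
  by rewrite nat1r gt_eqF.
rewrite GammaE; apply: le_Rintegral => //.
- exact: integrable_gamma_fun2.
- by apply: integrable_gamma_fun; rewrite -addrA ltr_wpDl// -ltrBlDr sub0r.
move=> t /=; rewrite in_itv/= andbT => t0.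
rewrite /gamma_fun !addrK.
have -> : t `^ (m%:R + nu) = m.+1%:R `^ nu * (t / m.+1%:R) `^ nu * t `^ m%:R.
  rewrite -powRM ?(ltW M0) ?divr_ge0 ?(ltW t0) ?(ltW M0)// mulrCA divff ?gt_eqF// mulr1.
  by rewrite addrC powRD_gt0.
rewrite powRD_gt0//.
rewrite powRr1 ?(ltW t0)//.
rewrite [leLHS](_ : _ = m.+1%:R `^ nu * (1 + nu * (t / m.+1%:R - 1)) * (t `^ m%:R * expR (- t))).
  rewrite -[leRHS]mulrA ler_wpM2r ?mulr_ge0 ?powR_ge0 ?expR_ge0// ler_wpM2l ?powR_ge0//.
  rewrite [leRHS]/powR gt_eqF ?divr_gt0// (le_trans _ (expR_ge1Dx _))//.
  rewrite lerD2l ler_wnM2l//.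
  by rewrite ln_le_subr1// divr_gt0.
by field; rewrite nat1r; exact: lt0r_neq0.
Qed.

(** [Gamma_ge_pow] at degree 1 gives positivity at [c + 2], and two steps of the recursion bring it
    down to [c]. *)
Lemma Gamma_gt0 c : 0 < c -> 0 < Gamma c :> R.
Proof.
move=> c0; have : 0 < Gamma (c + 1 + 1) :> R.
  rewrite (addrC c) -[X in X + c](natr1 0) add0r.
  apply: lt_le_trans (Gamma_ge_pow (ltn0Sn 0) (ltW c0)).
  by rewrite mulr_gt0 ?ltr0n ?fact_gt0// powR_gt0.
by rewrite !GammaD1 ?addr_gt0// pmulr_rgt0 ?addr_gt0// pmulr_rgt0.
Qed.

Lemma gaussian_moment (d c : R) : 0 < d -> 0 < c ->
  (\int[leb]_(t in pos) (t `^ (2 * c - 1) * expR (- (d * t ^+ 2)))%:E =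
   (Gamma c / (2 * d `^ c))%:E)%E.
Proof.
move=> d0 c0.
(* Inverse of [t |-> d * t ^ 2], which turns the Gaussian into the integrand of Gamma. *)
pose F y : R := (y / d) `^ 2^-1.
pose f y : R := 2^-1 * (y / d) `^ (2^-1 - 1) / d.
have dF (x : R) : 0 < x -> is_derive x 1 F (f x).
  move=> x0; have xd : 0 < x / d by rewrite divr_gt0.
  have d1 : is_derive x 1 (fun y : R => y / d) d^-1.
    have -> : (fun y : R => y / d) = d^-1 \*: id by apply/funext => y /=; rewrite mulrC.
    apply: is_derive_eq (is_deriveZ _ _) _; exact: mulr1.
  have := is_derive1_comp (f := fun y => y `^ 2^-1) (g := fun y => y / d) (is_derive_powR 2^-1 xd) d1.
  exact.
have cf (x : R) : 0 < x -> {for x, continuous f}.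
  move=> x0; have xd : 0 < x / d by rewrite divr_gt0.
  have c1 : {for x, continuous (fun y : R => y / d)} by apply: cvgMl; exact: cvg_id.
  have c2 := continuous_comp c1 (@continuous_powR _ (2^-1 - 1) _ xd).
  by apply: cvgMl; apply: cvgMr; exact: c2.
have FK (x : R) : 0 < x -> F (d * x ^+ 2) = x.
  move=> x0; rewrite /F mulrAC divff ?gt_eqF// mul1r -powR_mulrn ?(ltW x0)//.
  by rewrite -powRrM divff// powRr1 // ltW.
have imF : pos = F @` pos.
  apply/seteqP; split => [x|_ [x + <-]] /=; rewrite !in_itv/= !andbT => x0.
    by exists (d * x ^+ 2); rewrite ?FK//= in_itv/= andbT mulr_gt0// exprn_gt0.
  by move: x0; rewrite in_itv/= andbT => x0; exact: (powR_gt0 _ (divr_gt0 x0 d0)).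
have cG (x : R) : pos x -> {for x, continuous (fun t => t `^ (2 * c - 1) * expR (- (d * t ^+ 2)))}.
  rewrite /= in_itv/= andbT => x0; apply: cvgM; first exact: continuous_powR.
  have c1 : {for x, continuous (fun t : R => - (d * t ^+ 2))}.
    by apply: cvgN; apply: cvgMr; exact: exprn_continuous.
  exact: (continuous_comp c1 (@continuous_expR _ _)).
rewrite [LHS](ge0_substitution_incr dF cf imF cG); last 3 first.
- by move=> x _; rewrite mulr_ge0 ?powR_ge0 ?expR_ge0.
- by move=> x x0; rewrite /f !mulr_ge0 ?powR_ge0 ?invr_ge0 ?(ltW d0).
- move=> x y x0 xy; rewrite /F gt0_ltr_powR ?invr_gt0 ?nnegrE ?divr_ge0 ?(ltW d0) ?(ltW x0)//.
    by rewrite (ltW (lt_trans x0 xy)).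
  by rewrite ltr_pM2r ?invr_gt0.
rewrite [in RHS]mulrC EFinM EFin_Gamma// /eGamma -ge0_integralZl_EFin//; last 3 first.
- by move=> t _; rewrite lee_fin gamma_fun_ge0.
- by apply/measurable_EFinP/measurable_funTS; exact: measurable_gamma_fun.
- by rewrite invr_ge0 mulr_ge0 ?powR_ge0.
apply: eq_integral => y; rewrite inE/= in_itv/= andbT => y0.
have yd : 0 < y / d by rewrite divr_gt0.
rewrite -EFinM; congr EFin; rewrite /f /gamma_fun /F -powRrM -powR_mulrn ?powR_ge0// -powRrM.
rewrite mulVf// powRr1 ?(ltW yd)// (mulrC d) divfK ?gt_eqF//.
rewrite -[y in RHS](divfK (lt0r_neq0 d0)) (powRM _ (ltW yd) (ltW d0)).
rewrite [d `^ (c - 1)]powRB_gt0// powRr1 ?(ltW d0)//.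
have -> : (y / d) `^ (c - 1) = (y / d) `^ (2^-1 * (2 * c - 1)) * (y / d) `^ (2^-1 - 1).
  by rewrite -powRD_gt0//; congr (_ `^ _); field.
rewrite divfK ?gt_eqF//; field.
by rewrite !gt_eqF ?powR_gt0.
Qed.

End gamma.

(** * Laguerre functions are bounded by 1 *)

Section charlier.
Context {R : realType}.
Variable x : R.
Implicit Types (m n k : nat) (g h : nat -> R).

(* [x ^ m] times the Charlier polynomial of degree [m]; at [n = 0] the truncated [n.-1]
   is harmless since its coefficient vanishes. *)
Fixpoint charlier m n : R :=
  if m is m'.+1 then x * charlier m' n - n%:R * charlier m' n.-1 else 1.

(** The lowering relation. By [pois_pred] the step [g |-> x * g n - n * g n.-1] of the recurrence is
    adjoint to [- x] times the forward difference for the Poisson weight, so this relation yields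
    the norms. *)
Lemma charlier_diff m n :
  charlier m.+1 n.+1 - charlier m.+1 n = - m.+1%:R * charlier m n.
Proof.
elim: m n => [n|m IH n]; first by rewrite /= -natr1; ring.
have e0 k : charlier m.+1 k.+1 = charlier m.+1 k - m.+1%:R * charlier m k.
  by rewrite -[LHS](subrK (charlier m.+1 k)) IH; ring.
have e1 k : charlier m.+2 k = x * charlier m.+1 k - k%:R * charlier m.+1 k.-1 by [].
case: n => [|n].
  have e2 : charlier m.+1 0 = x * charlier m 0 by rewrite /= mul0r subr0.
  by rewrite !e1 e0/= -/(charlier m.+1 0) e2 -[m.+2%:R]natr1; ring.
have e2 : charlier m.+1 n.+1 = x * charlier m n.+1 - n.+1%:R * charlier m n by [].
have e3 : charlier m.+1 n = charlier m.+1 n.+1 + m.+1%:R * charlier m n by rewrite e0; ring.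
rewrite !e1 [n.+2.-1]/= [n.+1.-1]/= (e0 n.+1) e3 -[m.+2%:R]natr1 -[n.+2%:R]natr1.
transitivity (- m.+1%:R * (x * charlier m n.+1 - n.+1%:R * charlier m n) - charlier m.+1 n.+1).
  by ring.
by rewrite -e2; ring.
Qed.

Lemma charlierE m n : charlier m n =
  \sum_(j < m.+1) 'C(m, j)%:R * (-1) ^+ j * (n ^_ j)%:R * x ^+ (m - j).
Proof.
elim: m n => [n|m IH n]; first by rewrite big_ord1 bin0 ffactn0 expr0 !mulr1.
rewrite /= !IH [RHS]big_ord_recl bin0 ffactn0 expr0 subn0 !mul1r.
under [in RHS]eq_bigr => j _ do rewrite /= /bump/= add1n binS ffactnS subSS !natrD natrM.
rewrite mulr_sumr big_ord_recl/= bin0 ffactn0 expr0 subn0 !mul1r -exprS.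
rewrite -!addrA; congr (_ + _).
have -> : \sum_(i < m) x * ('C(m, bump 0 i)%:R * (-1) ^+ bump 0 i * (n ^_ bump 0 i)%:R * x ^+ (m - bump 0 i)) =
  \sum_(i < m.+1) 'C(m, i.+1)%:R * (-1) ^+ i.+1 * (n%:R * (n.-1 ^_ i)%:R) * x ^+ (m - i) :> R.
  rewrite [RHS]big_ord_recr/= bin_small// !mul0r addr0; apply: eq_bigr => i _.
  have -> : bump 0 i = i.+1 by rewrite /bump leq0n.
  have -> : (m - i)%N = (m - i.+1).+1 by rewrite subnS prednK ?subn_gt0.
  by rewrite ffactnS natrM [x ^+ _.+1]exprS; ring.
rewrite [n%:R * _]mulr_sumr -sumrB; apply: eq_bigr => i _; rewrite exprS; ring.
Qed.

Hypothesis x0 : 0 <= x.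

Lemma norm_charlier m n : `|charlier m n| <= (x + n%:R) ^+ m.
Proof.
have pos k : 0 <= x + k%:R by rewrite addr_ge0.
elim: m n => [n|m IH n]; first by rewrite normr1.
rewrite /= exprS mulrDl (le_trans (ler_normB _ _))// !normrM (ger0_norm x0) normr_nat.
rewrite lerD// ler_wpM2l// (le_trans (IH _))// lerXn2r ?nnegrE//.
by rewrite lerD2l ler_nat leq_pred.
Qed.

(** Polynomial growth. The shape [(a + n) ^ k] is stable under products and shifts and is dominated
    by [k! * exp (a + n)], which is what makes Poisson sums converge. *)
Definition pgrowth g := exists a k, 0 <= a /\ forall n, `|g n| <= (a + n%:R) ^+ k.

Lemma pgrowthM g h : pgrowth g -> pgrowth h -> pgrowth (fun n => g n * h n).
Proof.
move=> [a [k [a0 ga]]] [b [l [b0 hb]]]; exists (a + b), (k + l)%N.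
split=> [|n]; first by rewrite addr_ge0.
rewrite normrM exprD ler_pM// (le_trans (ga _), le_trans (hb _))// lerXn2r ?nnegrE ?addr_ge0//.
- by rewrite lerD2r lerDl.
- by rewrite lerD2r lerDr.
Qed.

Lemma pgrowth_charlier m : pgrowth (charlier m).
Proof. by exists x, m; split => // n; exact: norm_charlier. Qed.

Lemma pgrowthS g : pgrowth g -> pgrowth (g \o S).
Proof.
move=> [a [k [a0 ga]]]; exists (a + 1), k; split; first by rewrite addr_ge0.
by move=> n; rewrite (le_trans (ga _))// -natr1 addrAC addrA.
Qed.

Lemma pgrowth_pred g : pgrowth g -> pgrowth (fun n => n%:R * g n.-1).
Proof.
move=> [a [k [a0 ga]]]; exists a, k.+1; split => // n.
rewrite normrM exprS ler_pM//; first by rewrite normr_nat lerDr.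
by rewrite (le_trans (ga _))// lerXn2r ?nnegrE ?addr_ge0// lerD2l ler_nat leq_pred.
Qed.

(** Since [(a + n) ^ k <= k! * exp (a + n)], the series is dominated by a multiple of the
    exponential series at [x * e]. *)
Lemma cvg_pgrowth g : pgrowth g -> cvgn (series (fun n => exp_coeff x n * g n)).
Proof.
move=> [a [k [a0 ga]]]; apply: normed_cvg; rewrite /normed_series_of/=.
have key n : `|exp_coeff x n * g n| <= k`!%:R * expR a * exp_coeff (x * expR 1) n.
  rewrite normrM ger0_norm ?exp_coeff_ge0// (le_trans (ler_wpM2l _ (ga n))) ?exp_coeff_ge0//.
  rewrite /exp_coeff/= exprMn.
  have -> : k`!%:R * expR a * (x ^+ n * expR 1 ^+ n / n`!%:R) =
      x ^+ n / n`!%:R * (k`!%:R * expR (a + n%:R)).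
    by rewrite expRD -expRM_natl mulr1; ring.
  rewrite ler_wpM2l ?divr_ge0 ?exprn_ge0//.
  case: k {ga} => [|k]; first by rewrite expr0 fact0 mul1r (le_trans _ (expR_ge1Dx _))// lerDl addr_ge0.
  rewrite -ler_pdivrMl ?ltr0n ?fact_gt0// mulrC (le_trans _ (expR_ge1Dxn k _)) ?addr_ge0//.
  by rewrite lerDr.
apply: (series_le_cvg _ _ key) => //.
- move=> n; apply: mulr_ge0; first by rewrite mulr_ge0 ?expR_ge0.
  by rewrite exp_coeff_ge0// mulr_ge0 ?expR_ge0.
- by apply: is_cvg_seriesZ; exact: is_cvg_series_exp_coeff.
Qed.

(* Unnormalized expectation for the Poisson law of parameter [x]; the Charlier polynomials
   are orthogonal for it. *)
Definition pois g := limn (series (fun n => exp_coeff x n * g n)).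

Lemma pois_pred g : pgrowth g -> pois (fun n => n%:R * g n.-1) = x * pois g.
Proof.
move=> pg; apply: cvg_lim => //.
rewrite -(cvg_shiftS _).
have -> : (fun n => series (fun n => exp_coeff x n * (n%:R * g n.-1)) n.+1) =
    (fun n => x * series (fun n => exp_coeff x n * g n) n).
  apply/funext => n; rewrite /series/= big_nat_recl// mul0r mulr0 add0r mulr_sumr.
  apply: eq_bigr => i _; rewrite /exp_coeff/= factS natrM exprS; field.
  by rewrite !gt_eqF ?ltr0n ?fact_gt0// nat1r ltr0n.
by apply: cvgMr; exact: cvg_pgrowth.
Qed.

Lemma poisD g h : pgrowth g -> pgrowth h -> pois (fun n => g n + h n) = pois g + pois h.
Proof.
move=> pg ph; apply: cvg_lim => //.
have -> : series (fun n => exp_coeff x n * (g n + h n)) =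
    series (fun n => exp_coeff x n * g n) \+ series (fun n => exp_coeff x n * h n).
  by apply/funext => n; rewrite /series/= -big_split; apply: eq_bigr => i _; exact: mulrDr.
by apply: cvgD; exact: cvg_pgrowth.
Qed.

Lemma poisZ c g : pgrowth g -> pois (fun n => c * g n) = c * pois g.
Proof.
move=> pg; apply: cvg_lim => //.
have -> : series (fun n => exp_coeff x n * (c * g n)) =
    (fun n => c * series (fun n => exp_coeff x n * g n) n).
  by apply/funext => n; rewrite /series/= mulr_sumr; apply: eq_bigr => i _; exact: mulrCA.
by apply: cvgMr; exact: cvg_pgrowth.
Qed.

(** One factor of the square is expanded by the recurrence; [pois_pred] moves its shift onto the
    other factor, and the forward difference that appears is evaluated by [charlier_diff], leaving
    [m.+1] times the previous square. *)
Lemma pois_charlier_sqr m : pois (fun n => charlier m n ^+ 2) = m`!%:R * x ^+ m * expR x.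
Proof.
elim: m => [|m IH].
  rewrite /pois/= expr0 !mul1r expRE.
  rewrite /pseries; congr (limn (series _)); apply/funext => n.
  by rewrite expr1n mulr1 /exp_coeff/= mulrC.
have pc := pgrowth_charlier.
(* The second factor is written at [n.-1.+1] to fit [pois_pred]; it differs from [n] only at 0,
   where the coefficient [n] vanishes. *)
have -> : (fun n => charlier m.+1 n ^+ 2) = (fun n => x * (charlier m n * charlier m.+1 n) +
    -1 * (n%:R * (charlier m n.-1 * charlier m.+1 n.-1.+1))).
  apply/funext => -[|n]; rewrite /= expr2; ring.
have p1 := pgrowthM (pc m) (pc m.+1).
have p2 := pgrowthM (pc m) (pgrowthS (pc m.+1)).
have p3 := pgrowth_pred p2.
have pgZ c g : pgrowth g -> pgrowth (fun n => c * g n).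
  move=> pg; apply: pgrowthM pg; exists `|c|, 1%N; split => // n.
  by rewrite expr1 lerDl.
rewrite poisD ?(poisZ, pois_pred p2)//; [|exact: pgZ|exact: pgZ].
transitivity (x * (pois (fun n => charlier m n * charlier m.+1 n) +
    -1 * pois (fun n => charlier m n * charlier m.+1 n.+1))); first by ring.
rewrite -poisZ// -poisD//; last exact: pgZ.
have -> : (fun n => charlier m n * charlier m.+1 n + -1 * (charlier m n * charlier m.+1 n.+1)) =
    (fun n => m.+1%:R * charlier m n ^+ 2).
  apply/funext => n; transitivity (- charlier m n * (charlier m.+1 n.+1 - charlier m.+1 n)).
    by ring.
  by rewrite charlier_diff; ring.
rewrite poisZ; last by have := pgrowthM (pc m) (pc m).
by rewrite IH factS natrM exprS; ring.
Qed.

(* Keep only the term [n = m] of the nonnegative series [pois_charlier_sqr]. *)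
Lemma charlier_diag_le m : x ^+ m * charlier m m ^+ 2 <= m`!%:R ^+ 2 * x ^+ m * expR x.
Proof.
have p2 : pgrowth (fun n => charlier m n ^+ 2).
  by have := pgrowthM (pgrowth_charlier m) (pgrowth_charlier m).
have f0 n : 0 <= exp_coeff x n * charlier m n ^+ 2 by rewrite mulr_ge0 ?exp_coeff_ge0// sqr_ge0.
have := nondecreasing_cvgn_le _ (cvg_pgrowth p2) m.+1; rewrite -/(pois _) pois_charlier_sqr.
move=> /(_ (nondecreasing_series (fun n _ _ => f0 n))).
rewrite /series/= big_nat_recr//= => h.
have : exp_coeff x m * charlier m m ^+ 2 <= m`!%:R * x ^+ m * expR x.
  by apply: le_trans h; rewrite lerDr sumr_ge0.
have -> : exp_coeff x m * charlier m m ^+ 2 = x ^+ m * charlier m m ^+ 2 / m`!%:R.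
  by rewrite /exp_coeff/= mulrAC.
rewrite ler_pdivrMr ?ltr0n ?fact_gt0// => /le_trans; apply.
by rewrite le_eqVlt; apply/predU1P; left; ring.
Qed.

Lemma laguerre0E m : (laguerre 0 m).[x] =
  \sum_(k < m.+1) (-1) ^+ k * 'C(m, k)%:R / k`!%:R * x ^+ k.
Proof.
rewrite /laguerre horner_poly; apply: eq_bigr => k _; congr (_ * _).
rewrite !addr0 !Gamma_nat -!mulrA; congr (_ * _).
rewrite -(bin_fact (ltn_ord k : k <= m)%N) !natrM; field.
by rewrite !gt_eqF ?ltr0n ?fact_gt0.
Qed.

Lemma charlier_diag m : charlier m m = (-1) ^+ m * m`!%:R * (laguerre 0 m).[x].
Proof.
rewrite charlierE laguerre0E mulr_sumr (reindex_inj rev_ord_inj)/=.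
apply: eq_bigr => k _; have km : (k <= m)%N by rewrite -ltnS.
have -> : (-1) ^+ m = (-1) ^+ (m - k) * (-1) ^+ k :> R by rewrite -exprD subnK.
rewrite subSS bin_sub// subKn//.
have -> : (-1) ^+ (m - k) * (-1) ^+ k * m`!%:R * ((-1) ^+ k * 'C(m, k)%:R / k`!%:R * x ^+ k) =
   'C(m, k)%:R * (-1) ^+ (m - k) * (m`!%:R / k`!%:R) * x ^+ k * ((-1) ^+ k * (-1) ^+ k) :> R by ring.
rewrite -exprMn mulrNN mulr1 expr1n mulr1; congr (_ * _ * _).
apply: (mulIf (_ : k`!%:R != 0)); first by rewrite gt_eqF ?ltr0n ?fact_gt0.
by rewrite divfK ?gt_eqF ?ltr0n ?fact_gt0// -natrM -{2}(subKn km) ffact_fact// leq_subr.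
Qed.

(* The Charlier polynomial of degree [m] at [m] is a Laguerre polynomial in [x]. *)
Lemma norm_laguerre0_le m : `|(laguerre 0 m).[x]| <= expR (x / 2).
Proof.
rewrite -ler_sqr ?nnegrE ?expR_ge0// real_normK ?num_real// -expRM_natl mulrC divfK//.
(* [charlier_diag_le] carries a factor [x ^ m], which has to be cancelled; at 0 the polynomial is
   evaluated directly. *)
have [xE|xn0] := eqVneq x 0.
  rewrite laguerre0E big_ord_recl big1 => [|i _]; last by rewrite xE lift0 expr0n mulr0.
  by rewrite /= !expr0 bin0 fact0 !mulr1 divr1 addr0 expr1n xE expR0.
have xp : 0 < x by rewrite lt_neqAle eq_sym xn0.
have := charlier_diag_le m; rewrite charlier_diag.
have -> : x ^+ m * ((-1) ^+ m * m`!%:R * (laguerre 0 m).[x]) ^+ 2 =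
    (laguerre 0 m).[x] ^+ 2 * (m`!%:R ^+ 2 * x ^+ m).
  by rewrite !exprMn sqrr_sign; ring.
by rewrite [leRHS]mulrC ler_pM2r// mulr_gt0 ?exprn_gt0 ?ltr0n ?fact_gt0.
Qed.

End charlier.

(** * Generalized binomial coefficients, and Laguerre functions of order [a >= 0] *)

Section pochhammer.
Context {R : realType}.
Implicit Types (a b c z : R) (m n k : nat).

(** The rising factorial over [n!], that is the coefficient of [z ^ n] in [(1 - z) ^ (- a)]. *)
Definition poch a n : R := (\prod_(i < n) (a + i%:R)) / n`!%:R.

Lemma poch0 a : poch a 0 = 1.
Proof. by rewrite /poch big_ord0 fact0 divr1. Qed.

Lemma pochS a n : n.+1%:R * poch a n.+1 = (a + n%:R) * poch a n.
Proof.
rewrite /poch big_ord_recr/= factS natrM; field.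
by rewrite !gt_eqF ?ltr0n ?fact_gt0// nat1r ltr0n.
Qed.

Lemma poch_ge0 a n : 0 <= a -> 0 <= poch a n.
Proof. by move=> a0; rewrite divr_ge0// prodr_ge0// => i _; rewrite addr_ge0. Qed.

Lemma poch1 n : poch 1 n = 1.
Proof.
elim: n => [|n IH]; first exact: poch0.
by apply: (mulfI (_ : n.+1%:R != 0)); rewrite ?pnatr_eq0// pochS IH !mulr1 nat1r.
Qed.

(** Chu-Vandermonde, the product rule for the generating functions. In the induction the factor
    [n.+1] is split as [i + (n.+1 - i)] and [pochS] is applied to each half. *)
Lemma pochD a b n : poch (a + b) n = \sum_(i < n.+1) poch a i * poch b (n - i).
Proof.
elim: n => [|n IH]; first by rewrite big_ord1 subnn !poch0 mulr1.
apply: (mulfI (_ : n.+1%:R != 0)); rewrite ?pnatr_eq0// pochS IH !mulr_sumr.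
have -> : \sum_(i < n.+2) n.+1%:R * (poch a i * poch b (n.+1 - i)) =
    \sum_(i < n.+2) i%:R * poch a i * poch b (n.+1 - i) +
    \sum_(i < n.+2) poch a i * ((n.+1 - i)%:R * poch b (n.+1 - i)).
  rewrite -big_split; apply: eq_bigr => i _; have := ltn_ord i; rewrite ltnS => /subnK {1}<-.
  by rewrite natrD /=; ring.
rewrite [X in _ = X + _]big_ord_recl !mul0r add0r [X in _ = _ + X]big_ord_recr/= subnn mul0r mulr0 addr0.
rewrite -big_split; apply: eq_bigr => i _ /=.
rewrite /bump/= add1n subSS pochS subSn; last by rewrite -ltnS.
rewrite pochS -{1}(subnK (_ : i <= n)%N) -1?ltnS// natrD; ring.
Qed.

Lemma Gamma_poch c n : 0 < c -> Gamma (n%:R + c) = n`!%:R * poch c n * Gamma c.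
Proof.
move=> c0; elim: n => [|n IH]; first by rewrite add0r fact0 poch0 !mul1r.
have nc : 0 < n%:R + c by rewrite ltr_wpDl.
rewrite -natr1 addrAC (GammaD1 nc) IH factS natrM.
have -> : n.+1%:R * n`!%:R * poch c n.+1 * Gamma c = n`!%:R * (n.+1%:R * poch c n.+1) * Gamma c.
  by ring.
by rewrite pochS; ring.
Qed.

Lemma coef_laguerre a m k : -1 < a -> (laguerre a m)`_k =
  if (k <= m)%N then (-1) ^+ k / k`!%:R * poch (k%:R + a + 1) (m - k) else 0.
Proof.
move=> a1; rewrite /laguerre coef_poly ltnS; case: leqP => // km.
have c0 : 0 < k%:R + a + 1 :> R by rewrite -addrA ltr_wpDl// -ltrBlDr sub0r.
have -> : m%:R + a + 1 = (m - k)%:R + (k%:R + a + 1) :> R by rewrite -{1}(subnK km) natrD; ring.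
rewrite Gamma_poch//; field.
by rewrite !gt_eqF ?ltr0n ?fact_gt0//= Gamma_gt0.
Qed.

Lemma laguerre_at0 a m : -1 < a -> (laguerre a m).[0] = poch (a + 1) m.
Proof. by move=> a1; rewrite horner_coef0 coef_laguerre// fact0 divr1 mul1r subn0 add0r. Qed.

(** Coefficientwise this is [pochD]. For [a >= 0] the weights are nonnegative, so bounds of order 0
    pass to order [a]. *)
Lemma laguerre_sum a m : -1 < a ->
  laguerre a m = \sum_(k < m.+1) poch a (m - k) *: laguerre 0 k.
Proof.
move=> a1; apply/polyP => j; rewrite coef_sum coef_laguerre//.
under eq_bigr => k _ do rewrite coefZ coef_laguerre ?ltrN10// addr0 natr1.
case: leqP => jm; last first.
  by rewrite big1// => k _; rewrite leqNgt (leq_trans _ jm)// mulr0.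
rewrite (_ : j%:R + a + 1 = j.+1%:R + a); last by rewrite -natr1; ring.
rewrite pochD mulr_sumr -(big_mkord xpredT (fun k => poch a (m - k) *
  (if (j <= k)%N then (-1) ^+ j / j`!%:R * poch j.+1%:R (k - j) else 0))).
rewrite (big_cat_nat (leq0n j) (leqW jm))/= [X in _ = X + _]big_nat_cond [X in _ = X + _]big1 ?add0r => [|k]; last first.
  by rewrite andbT => /andP[_ kj]; rewrite leqNgt kj mulr0.
rewrite -{1}[j in RHS]add0n big_addn subSn// big_mkord; apply: eq_bigr => i _.
rewrite leq_addl addnK [(i + j)%N]addnC subnDA; ring.
Qed.

(** The order 0 polynomials equal 1 at 0, so [laguerre_sum] at 0 says that the normalizing value is
    exactly the sum of the weights; bounding each term by [exp (z / 2)] loses nothing in the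
    constant. *)
Lemma norm_laguerre_fun_le1 a m z : 0 <= a -> 0 <= z -> `|laguerre_fun a m z| <= 1.
Proof.
move=> a0 z0; have a1 : -1 < a by rewrite (lt_le_trans _ a0).
have p0 k : 0 <= poch a k by exact: poch_ge0.
have L0 : 0 < (laguerre a m).[0].
  rewrite laguerre_at0// divr_gt0 ?ltr0n ?fact_gt0// prodr_gt0// => i _.
  by rewrite ltr_wpDr// ltr_wpDl.
rewrite /laguerre_fun normrM normfV (gtr0_norm L0) ler_pdivrMr// mul1r.
rewrite normrM (ger0_norm (expR_ge0 _)) mulNr expRN mulrC ler_pdivrMr ?expR_gt0//.
rewrite !laguerre_sum// !horner_sum mulr_suml (le_trans (ler_norm_sum _ _ _))//.
apply: ler_sum => k _; rewrite !hornerZ normrM (ger0_norm (p0 _)) -[leRHS]mulrA.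
apply: ler_wpM2l => //.
rewrite laguerre_at0 ?ltrN10// add0r poch1 mul1r; exact: norm_laguerre0_le.
Qed.

End pochhammer.

(** * The normalized Bessel function is bounded by 1 *)

Section bessel.
Context {R : realType}.
Variable nu : R.
Hypothesis hnu : - 2^-1 <= nu.
Implicit Types (x z w : R) (k n : nat).

Let nu1_gt0 : 0 < nu + 1.
Proof. by rewrite -ltrBlDr sub0r (lt_le_trans _ hnu)// ltrN2 invf_lt1// ltr1n. Qed.

Definition bessel_coef k : R := Gamma (nu + 1) / (k`!%:R * Gamma (nu + k%:R + 1)).

Lemma bessel_coefS k : bessel_coef k = k.+1%:R * (nu + k%:R + 1) * bessel_coef k.+1.
Proof.
rewrite /bessel_coef factS natrM.
have c0 : 0 < nu + k%:R + 1 by rewrite addrAC ltr_wpDr.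
have -> : nu + k.+1%:R + 1 = nu + k%:R + 1 + 1 by rewrite -natr1; ring.
rewrite (GammaD1 c0); field.
by rewrite !gt_eqF ?Gamma_gt0 ?ltr0n ?fact_gt0//= nat1r ltr0n.
Qed.

Lemma bessel_coef_ge0 k : 0 <= bessel_coef k.
Proof. by rewrite divr_ge0 ?mulr_ge0 ?Gamma_ge0. Qed.

Lemma bessel_coef0 : bessel_coef 0 = 1.
Proof. by rewrite /bessel_coef fact0 mul1r addr0 divff// gt_eqF ?Gamma_gt0. Qed.

(** The 2 is paid at the first step, where the divisor [nu + 1] may be as small as 1/2; each later
    step divides by at least its integer index. *)
Lemma bessel_coef_le k : bessel_coef k <= 2 / k`!%:R.
Proof.
elim: k => [|k IH]; first by rewrite bessel_coef0 fact0 divr1 ler1n.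
have bS n : bessel_coef n.+1 = bessel_coef n / (n.+1%:R * (nu + n%:R + 1)).
  have c0 : 0 < nu + n%:R + 1 by rewrite addrAC ltr_wpDr.
  by rewrite [bessel_coef n]bessel_coefS mulrAC divff ?mul1r// gt_eqF ?mulr_gt0.
have nu2 : 2^-1 <= nu + 1 by move: hnu; lra.
case: k IH => [|k] IH.
  rewrite bS bessel_coef0 addr0 !mul1r divr1 -[leRHS]invrK lef_pV2 ?posrE ?invr_gt0//.
have -> : 2 / k.+2`!%:R = 2 / k.+1`!%:R / k.+2%:R :> R.
  by rewrite factS natrM invfM mulrCA mulrC.
rewrite bS ler_pM ?bessel_coef_ge0//.
  by rewrite invr_ge0 mulr_ge0// addrAC addr_ge0// ltW.
have c1 : 1 <= nu + k.+1%:R + 1 by rewrite -natr1; move: nu2 (ler0n R k); lra.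
rewrite lef_pV2 ?posrE ?mulr_gt0//; last by rewrite (lt_le_trans _ c1).
by rewrite ler_peMr.
Qed.

(** Coefficients of the Bessel function as a power series in [w = z ^ 2], see [bessel_jE]. *)
Definition bessel_pcoef k : R := (-1) ^+ k * bessel_coef k / 4 ^+ k.

Lemma norm_bessel_pcoef k : `|bessel_pcoef k| <= 2 / k`!%:R.
Proof.
rewrite /bessel_pcoef normrM normrM normrX normrN1 expr1n mul1r.
rewrite ger0_norm ?bessel_coef_ge0// (le_trans _ (bessel_coef_le k))//.
by rewrite ger0_norm ?invr_ge0 ?exprn_ge0// ler_piMr ?bessel_coef_ge0// invf_le1 ?exprn_gt0// exprn_ege1// ler1n.
Qed.

Lemma cvg_pseries_fact (c : nat -> R) C w : (forall k, `|c k| <= C / k`!%:R) ->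
  cvgn (pseries c w).
Proof.
move=> cC; apply: normed_cvg; rewrite /normed_series_of/=.
have C0 : 0 <= C by have := cC 0%N; rewrite fact0 divr1; exact: le_trans.
have key k : `|c k * w ^+ k| <= C * exp_coeff `|w| k.
  rewrite normrM normrX /exp_coeff/= mulrA mulrAC ler_wpM2r ?exprn_ge0//.
apply: (series_le_cvg _ _ key) => //.
- by move=> k; rewrite mulr_ge0 ?exp_coeff_ge0.
- by apply: is_cvg_seriesZ; exact: is_cvg_series_exp_coeff.
Qed.

(** The bound [C / k!] survives formal differentiation with the same constant, so all derived series
    converge everywhere; it is applied three times to differentiate the Bessel series twice. *)
Lemma diffs_fact (c : nat -> R) C : (forall k, `|c k| <= C / k`!%:R) ->
  forall k, `|pseries_diffs c k| <= C / k`!%:R.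
Proof.
move=> cC k; rewrite /pseries_diffs normrM normr_nat -ler_pdivlMl//.
by rewrite (le_trans (cC _))// factS natrM invfM mulrCA.
Qed.

Let c0 := bessel_pcoef.
Let c1 := pseries_diffs c0.
Let c2 := pseries_diffs c1.

Definition bessel_fun w : R := limn (pseries bessel_pcoef w).
Let J1 w : R := limn (pseries c1 w).
Let J2 w : R := limn (pseries c2 w).

Let hc0 := norm_bessel_pcoef.
Let hc1 := diffs_fact hc0.
Let hc2 := diffs_fact hc1.
Let hc3 := diffs_fact hc2.

Let dJ0 w : is_derive w 1 bessel_fun (J1 w).
Proof.
apply: (pseries_snd_diffs (K := `|w| + 1)); [exact: cvg_pseries_fact hc0|exact: cvg_pseries_fact hc1|exact: cvg_pseries_fact hc2|].
by rewrite [ltRHS]ger0_norm ?addr_ge0// ltrDl.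
Qed.

Let dJ1 w : is_derive w 1 J1 (J2 w).
Proof.
apply: (pseries_snd_diffs (K := `|w| + 1)); [exact: cvg_pseries_fact hc1|exact: cvg_pseries_fact hc2|exact: cvg_pseries_fact hc3|].
by rewrite [ltRHS]ger0_norm ?addr_ge0// ltrDl.
Qed.

(** Bessel's equation in the variable [w]; coefficient by coefficient it is [bessel_coefS]. *)
Lemma bessel_ode w : w * J2 w + (nu + 1) * J1 w + bessel_fun w / 4 = 0.
Proof.
have h2 := pseries_diffs_equiv (cvg_pseries_fact (w := w) hc2).
have h1 : pseries c1 w @ \oo --> J1 w by exact: cvg_pseries_fact hc1.
have h0 : pseries c0 w @ \oo --> bessel_fun w by exact: cvg_pseries_fact hc0.
transitivity (limn (fun n => w * series (fun i => i%:R * c1 i * w ^+ i.-1) n +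
  (nu + 1) * pseries c1 w n + pseries c0 w n / 4)).
  by apply/esym/cvg_lim => //; apply: cvgD; [apply: cvgD; exact: cvgMr|exact: cvgMl].
rewrite [X in limn X](_ : _ = cst 0); first exact: (cvg_lim (@Rhausdorff R) (cvg_cst (0 : R))).
apply/funext => n; rewrite /series/= /pseries /series/= !mulr_sumr mulr_suml -!big_split.
apply: big1 => i _ /=.
have -> : w * (i%:R * c1 i * w ^+ i.-1) = i%:R * c1 i * w ^+ i.
  by case: i => [|i]; rewrite ?mul0r ?mulr0// exprS; ring.
have -> : i%:R * c1 i * w ^+ i + (nu + 1) * (c1 i * w ^+ i) + c0 i * w ^+ i / 4 =
   ((nu + i%:R + 1) * c1 i + c0 i / 4) * w ^+ i by ring.
rewrite /c1 /pseries_diffs /c0 /bessel_pcoef (bessel_coefS i) !exprS; field.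
by rewrite expf_neq0.
Qed.

(* The energy [J ^ 2 + 4 w J' ^ 2] of the Bessel equation in the variable [w = z ^ 2] is
   nonincreasing. *)
Lemma norm_bessel_fun_le1 w : 0 <= w -> `|bessel_fun w| <= 1.
Proof.
move=> w0; pose E x := bessel_fun x ^+ 2 + 4 * x * J1 x ^+ 2.
have dE x : is_derive x 1 E (- 4 * (2 * nu + 1) * J1 x ^+ 2).
  have d0 := dJ0 x; have d1 := dJ1 x.
  apply: is_derive_eq.
  rewrite /GRing.scale/=.
  have -> : bessel_fun x = - 4 * (x * J2 x + (nu + 1) * J1 x).
    by have := bessel_ode x; lra.
  by ring.
have dr x : derivable E x 1 by have [] := dE x.
have : E w <= E 0.
  have cE : {within `[0, w], continuous E}.
    apply: continuous_subspaceT => x.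
    by apply: differentiable_continuous; apply/derivable1_diffP.
  apply: (ler0_derive1_le_cc (fun x _ => dr x) _ cE); rewrite ?in_itv/= ?lexx ?w0//.
  move=> x _; have [_] := dE x; rewrite derive1E => ->.
  (* The derivative of the energy is nonpositive through this sign, which accounts for the threshold
     -1/2 on the order. *)
  have nu2 : 0 <= 2 * nu + 1 by move: hnu; lra.
  rewrite -mulrA mulNr oppr_le0; exact: mulr_ge0 (ler0n _ _) (mulr_ge0 nu2 (sqr_ge0 _)).
rewrite /E mulr0 mul0r addr0.
have -> : bessel_fun 0 = 1.
  apply: cvg_lim => //; rewrite -(cvg_shiftS _).
  rewrite (_ : (fun n => _) = cst 1); first exact: cvg_cst.
  apply/funext => n; rewrite /pseries/series/= big_nat_recl//= expr0 mulr1 big1 => [|i _].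
    by rewrite /bessel_pcoef bessel_coef0 !expr0 mulr1 divr1 addr0.
  by rewrite exprS mul0r mulr0.
rewrite expr1n => Ew; rewrite -(@ler_sqr _ `|_|) ?nnegrE// real_normK ?num_real// expr1n.
apply: le_trans Ew; rewrite lerDl; exact: mulr_ge0 (mulr_ge0 (ler0n _ _) w0) (sqr_ge0 _).
Qed.

Lemma bessel_jE z : bessel_j nu z = bessel_fun (z ^+ 2).
Proof.
have G0 : Gamma (nu + 1) != 0 :> R by rewrite gt_eqF ?Gamma_gt0.
have h0 : pseries bessel_pcoef (z ^+ 2) @ \oo --> bessel_fun (z ^+ 2).
  exact: cvg_pseries_fact norm_bessel_pcoef.
rewrite /bessel_j; set l := limn _.
suff -> : l = (Gamma (nu + 1))^-1 * bessel_fun (z ^+ 2) by rewrite mulrA divff ?mul1r.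
apply: cvg_lim => //.
rewrite (_ : series _ = (fun n => (Gamma (nu + 1))^-1 * pseries bessel_pcoef (z ^+ 2) n)).
  exact: cvgMr.
apply/funext => n; rewrite /pseries/series/= mulr_sumr; apply: eq_bigr => k _.
rewrite /bessel_pcoef /bessel_coef exprMn exprVn exprM -exprM mulnC exprM.
have -> : (2 : R) ^+ (k * 2) = 4 ^+ k by rewrite mulnC exprM -natrX.
have gen (s f Z q c : R) : c != 0 -> s / f * (Z / q) = c^-1 * (s * (c / f) / q * Z).
  by move=> cn0; transitivity ((c^-1 * c) * (s / f * (Z / q))); [rewrite mulVf ?mul1r|ring].
exact: gen.
Qed.

Lemma norm_bessel_j_le1 z : `|bessel_j nu z| <= 1.
Proof. by rewrite bessel_jE norm_bessel_fun_le1 ?sqr_ge0. Qed.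

Lemma continuous_bessel_j : continuous (bessel_j nu).
Proof.
have -> : bessel_j nu = bessel_fun \o (fun z => z ^+ 2) by apply/funext => z; exact: bessel_jE.
move=> z; apply: continuous_comp; first exact: exprn_continuous.
by apply: differentiable_continuous; apply/derivable1_diffP; have [] := dJ0 (z ^+ 2).
Qed.

End bessel.

(** * The two measures *)

Section density.
Context d d' (X : measurableType d) (T : measurableType d') (R : realType).
Variables (mu : {measure set X -> \bar R}) (nu : {measure set T -> \bar R}).
Variables (phi : X -> T) (w : X -> R).
Hypothesis w0 : forall x, 0 <= w x.
Hypothesis mw : measurable_fun setT w.
Hypothesis mphi : measurable_fun setT phi.
Hypothesis nuE : forall A, measurable A -> nu A = (\int[mu]_(x in phi @^-1` A) (w x)%:E)%E.

Import HBNNSimple.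

(** Density and image measure are treated at once: [nu] is the image under [phi] of [w] times [mu].
    It is used with the identity for power weights, with the swap of coordinates for [gamma_alpha],
    and with a dilation for Lebesgue measure. *)
Lemma ge0_integral_density (f : T -> \bar R) :
  measurable_fun setT f -> (forall x, 0 <= f x)%E ->
  (\int[nu]_x f x = \int[mu]_x (f (phi x) * (w x)%:E))%E.
Proof.
move=> mf f0; pose h := nnsfun_approx measurableT mf.
have mwE : measurable_fun setT (EFin \o w) by exact/measurable_EFinP.
have hf x : (EFin \o h n) x @[n --> \oo] --> f x by exact: cvg_nnsfun_approx.
have mhn n : measurable_fun setT (fun x => (h n (phi x))%:E).
  by apply/measurable_EFinP; exact: measurableT_comp.
have mI n r : measurable_fun setT (fun x => (\1_(h n @^-1` [set r]) (phi x) : R)%:E).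
  by apply/measurable_EFinP; apply: measurableT_comp => //; exact: measurable_indic.
have nuh n : (\int[nu]_x (h n x)%:E = \int[mu]_x ((h n (phi x))%:E * (w x)%:E))%E.
  rewrite integralT_nnsfun sintegralE.
  transitivity (\int[mu]_x (\sum_(r \in range (h n)) (r * \1_(h n @^-1` [set r]) (phi x))%:E * (w x)%:E))%E; last first.
    apply: eq_integral => x _; rewrite [in RHS]fimfunE -fsumEFin//.
    by rewrite ge0_mule_fsuml// => y; exact: nnfun_muleindic_ge0.
  rewrite ge0_integral_fsum//; last 2 first.
  - by move=> r; under eq_fun do rewrite EFinM; do 2 (apply: emeasurable_funM => //).
  - by move=> r x _; rewrite EFinM mule_ge0 ?nnfun_muleindic_ge0 ?lee_fin.
  apply: eq_fsbigr => r; rewrite inE => -[t _ rt].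
  have r0 : 0 <= r by rewrite -rt.
  under eq_integral do rewrite EFinM -muleA.
  rewrite ge0_integralZl//; last 2 first.
  - exact: emeasurable_funM.
  - by move=> x _; rewrite mule_ge0 ?lee_fin.
  congr (_ * _)%E; rewrite nuE//.
  rewrite [LHS]integral_mkcond; apply: eq_integral => x _.
  by rewrite epatch_indic muleC.
have -> : (\int[nu]_x f x = limn (fun n => \int[nu]_x (h n x)%:E))%E.
  rewrite -monotone_convergence//.
  - by apply: eq_integral => x _; apply/esym/cvg_lim => //; exact: hf.
  - by move=> n; exact/measurable_EFinP.
  - by move=> n x _; rewrite lee_fin.
  - by move=> x _ a b ab; rewrite lee_fin; exact/lefP/nd_nnsfun_approx.
under eq_fun do rewrite nuh.
rewrite -monotone_convergence//.
- apply: eq_integral => x _; apply/cvg_lim => //.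
  by apply: cvgeZr => //; exact: hf.
- by move=> n; exact: emeasurable_funM.
- by move=> n x _; rewrite mule_ge0 ?lee_fin.
- by move=> x _ a b ab; rewrite lee_wpmul2r ?lee_fin//; exact/lefP/nd_nnsfun_approx.
Qed.

End density.

Section mpow.
Context {R : realType}.
Local Notation leb := (@lebesgue_measure R).
Variables (k p : R).

(** The absolute value makes the density nonnegative for every [k], so that [mpow] is a measure
    unconditionally; the indicator confines it to the half line. *)
Definition wpow (x : R) : R := `|k| * x `^ p * \1_(`[0, +oo[%classic) x.

Lemma wpow_ge0 x : 0 <= wpow x.
Proof. by rewrite !mulr_ge0 ?powR_ge0. Qed.

Lemma measurable_wpow : measurable_fun setT wpow.
Proof.
apply: measurable_funM; last by apply: measurable_indic; exact: measurable_itv.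
by apply: measurable_funM => //; exact: measurable_powR.
Qed.

Definition mpow (A : set R) : \bar R := (\int[leb]_(x in A) (wpow x)%:E)%E.

Let mpow0 : mpow set0 = 0%E.
Proof. by rewrite /mpow integral_set0. Qed.

Let mpow_ge0 A : (0 <= mpow A)%E.
Proof. by apply: integral_ge0 => x _; rewrite lee_fin wpow_ge0. Qed.

Let mpow_sigma_additive : semi_sigma_additive mpow.
Proof.
have mE : measurable_fun setT (EFin \o wpow) by apply/measurable_EFinP; exact: measurable_wpow.
apply: (@semi_sigma_additive_nng_induced _ _ R leb _ mE) => x.
by rewrite lee_fin wpow_ge0.
Qed.

HB.instance Definition _ := isMeasure.Build _ _ _ mpow mpow0 mpow_ge0 mpow_sigma_additive.

Lemma ge0_integral_mpow (f : R -> \bar R) : measurable_fun setT f -> (forall x, 0 <= f x)%E ->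
  (\int[mpow]_x f x = \int[leb]_x (f x * (wpow x)%:E))%E.
Proof.
move=> mf f0.
have mid : measurable_fun setT (idfun : measurableTypeR R -> R) by move=> _ Y mY; rewrite setTI.
exact: (@ge0_integral_density _ _ (measurableTypeR R) R R leb mpow idfun wpow wpow_ge0 measurable_wpow mid).
Qed.

Lemma ge0_integral_mpow_pos (f : R -> \bar R) : measurable_fun setT f -> (forall x, 0 <= f x)%E ->
  (\int[mpow]_x f x = \int[leb]_(x in `]0%R, +oo[) (f x * (`|k| * x `^ p)%:E))%E.
Proof.
move=> mf f0; rewrite ge0_integral_mpow//.
have mg : measurable_fun setT (fun x => f x * (`|k| * x `^ p)%:E)%E.
  apply: emeasurable_funM => //; apply/measurable_EFinP.
  by apply: measurable_funM => //; exact: measurable_powR.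
rewrite integral_itv_obnd_cbnd; last exact: measurable_funTS.
rewrite [RHS]integral_mkcond; apply: eq_integral => x _.
by rewrite epatch_indic /wpow EFinM muleA.
Qed.

Lemma mpow_sigma_finite : sigma_finite setT mpow.
Proof.
(* The power may fail to be integrable near 0, so the point 0 is put aside as a null set and the
   open half line is exhausted by [itvn]. *)
pose F n : set R := ~` `[0, +oo[%classic `|` [set 0] `|` itvn n.
have mF n : measurable (F n).
  apply: measurableU; last exact: measurable_itv.
  by apply: measurableU => //; apply: measurableC; exact: measurable_itv.
exists F.
  apply/seteqP; split => // x _.
  have [x0|x0|<-] := ltgtP (0 : R) x; last by exists 0%N => //; left; right.
    have : (`]0, +oo[%classic : set R) x by rewrite /= in_itv/= x0.
    by rewrite -bigcup_itv_oy => -[n _ nx]; exists n => //; right.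
  by exists 0%N => //; left; left; rewrite /= in_itv/= andbT; apply/negP; rewrite -ltNge.
move=> n; split; first exact: mF.
have mwE A : measurable_fun A (EFin \o wpow).
  by apply/measurable_EFinP/measurable_funTS; exact: measurable_wpow.
pose N : set R := ~` `[0, +oo[%classic; have mN : measurable N.
  by apply: measurableC; exact: measurable_itv.
apply: (@le_lt_trans _ _ (mpow (N `|` [set 0%R]) + mpow (itvn n))%E).
  apply: measureU2 => //; last exact: measurable_itv.
  exact: measurableU.
rewrite lte_add_pinfty//; last first.
  rewrite /mpow.
  have /integrable_lty : leb.-integrable (itvn n) (EFin \o (fun x => `|k| * x `^ p)).
    apply: continuous_compact_integrable; first exact: segment_compact.
    apply: continuous_pos_within; first by rewrite invr_gt0.
    by move=> x x0; apply: cvgMr; exact: continuous_powR.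
  move=> /(_ (measurable_itv _)); apply: le_lt_trans.
  apply: ge0_le_integral => //.
  - exact: measurable_itv.
  - by move=> x _; rewrite lee_fin wpow_ge0.
  - exact: mwE.
  - by apply/measurable_EFinP/measurable_funTS; apply: measurable_funM => //; exact: measurable_powR.
  - by move=> x _; rewrite lee_fin /wpow ler_piMr ?mulr_ge0 ?powR_ge0// indicE lern1 leq_b1.
apply: (@le_lt_trans _ _ (mpow N + mpow [set 0%R])%E); first exact: measureU2.
rewrite /mpow integral_set1 adde0 (eq_integral (cst 0%E)) ?integral0//.
by move=> x; rewrite inE/= => x0; rewrite /wpow indicE memNset// mulr0.
Qed.

HB.instance Definition _ := Measure_isSigmaFinite.Build _ _ _ mpow mpow_sigma_finite.

End mpow.

Section m_alpha_product.
Context {R : realType}.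
Local Notation leb := (@lebesgue_measure R).
Variable alpha : R.

Definition m_coef : R := (pi * Gamma (alpha + 1))^-1.

Definition mx := mpow m_coef (2 * alpha + 1).
Definition mt := mpow 1 (2 * alpha).

HB.instance Definition _ := SigmaFiniteMeasure.copy mx (mpow m_coef (2 * alpha + 1)).
HB.instance Definition _ := SigmaFiniteMeasure.copy mt (mpow 1 (2 * alpha)).

Lemma m_coef_ge0 : 0 <= m_coef.
Proof. by rewrite invr_ge0 mulr_ge0 ?pi_ge0 ?Gamma_ge0. Qed.

(** Opens the way to Tonelli: as a product of two power weights, [m_alpha] can be integrated in
    either order. The whole constant is placed in the factor [mx]. *)
Lemma m_alphaE A : measurable A -> m_alpha alpha A = (mx \x mt)%E A.
Proof.
move=> mA.
have mz (w : R -> R) : measurable_fun setT w -> measurable_fun [set: R * R] (fun z => w z.2).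
  by move=> mw; exact: (measurableT_comp mw measurable_snd).
have mz1 (w : R -> R) : measurable_fun setT w -> measurable_fun [set: R * R] (fun z => w z.1).
  by move=> mw; exact: (measurableT_comp mw measurable_fst).
pose w1 := wpow m_coef (2 * alpha + 1); pose w2 := wpow 1 (2 * alpha).
have mw1 : measurable_fun setT w1 := measurable_wpow _ _.
have mw2 : measurable_fun setT w2 := measurable_wpow _ _.
have mI : measurable_fun setT (fun z : R * R => (\1_A z : R)%:E).
  by apply/measurable_EFinP; exact: measurable_indic.
transitivity (\int[leb \x leb]_z ((\1_A z)%:E * (w2 z.2)%:E * (w1 z.1)%:E))%E.
  rewrite /m_alpha integral_mkcond; apply: eq_integral => -[x t] _ /=.
  rewrite patchE in_setI /KK/=.
  rewrite -!EFinM [\1_A _]indicE /w1 /w2 /wpow !indicE normr1 mul1r.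
  rewrite (ger0_norm m_coef_ge0).
  have -> : ((x, t) \in [set z : R * R | 0 <= z.1 /\ 0 <= z.2]) =
      (x \in (`[0, +oo[%classic : set R)) && (t \in (`[0, +oo[%classic : set R)).
    apply/idP/andP; rewrite !inE/= !in_itv/= !andbT => -[x0 t0]; by split.
  case: ((x, t) \in A) => /=; last by rewrite !mul0r.
  case: (x \in _) => /=; last by rewrite !mulr0.
  case: (t \in _) => /=; last by rewrite mulr0 mulr0 mul0r.
  by rewrite !mulr1 mul1r /m_density/= mulrC.
rewrite fubini_tonelli1//=; last 2 first.
- by apply: emeasurable_funM; [apply: emeasurable_funM => //|]; apply/measurable_EFinP; [exact: mz|exact: mz1].
- by move=> z; rewrite !mule_ge0// ?lee_fin ?wpow_ge0// indicE.
rewrite /product_measure1/= ge0_integral_mpow; last 2 first.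
- exact: measurable_fun_xsection.
- by move=> x; exact: measure_ge0.
apply: eq_integral => x _.
rewrite /fubini_F/= ge0_integralZr//; last 3 first.
- apply: emeasurable_funM; last exact/measurable_EFinP.
  apply/measurable_EFinP; apply: measurableT_comp; last exact: measurable_pair1.
  exact: measurable_indic.
- by move=> y _; rewrite mule_ge0 ?lee_fin ?wpow_ge0.
- by rewrite lee_fin wpow_ge0.
congr (_ * _)%E; rewrite /mt/= /mpow [RHS]integral_mkcond; apply: eq_integral => y _.
rewrite epatch_indic muleC; congr (_ * _)%E.
by rewrite /= !indicE mem_xsection.
Qed.

End m_alpha_product.

HB.instance Definition _ (R : realType) :=
  Measure_isSigmaFinite.Build _ nat R (@counting nat R) (sigma_finite_counting R).

Section gamma_alpha_slices.
Context {R : realType}.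
Local Notation leb := (@lebesgue_measure R).
Variable alpha : R.

Definition m_spec := mpow (1 : R) (3 * alpha + 1).
HB.instance Definition _ := SigmaFiniteMeasure.copy m_spec (mpow 1 (3 * alpha + 1)).

Definition g_coef (m : nat) : R := c_alpha alpha * (laguerre alpha m).[0].

Lemma g_coef_ge0 m : 0 <= g_coef m.
Proof. by rewrite mulr_ge0 ?c_alpha_ge0 ?laguerre0_ge0. Qed.

Lemma ge0_integral_gamma_alpha (f : R * nat -> \bar R) :
  measurable_fun setT f -> (forall w, 0 <= f w)%E ->
  (\int[gamma_alpha alpha]_w f w =
   \sum_(0 <= m <oo) ((g_coef m)%:E * \int[m_spec]_l f (l, m)))%E.
Proof.
move=> mf f0; pose p := 3 * alpha + 1.
(* The degree comes first, so that Tonelli leaves the sum outside and the integral in [l] inside;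
   [phi] swaps back. *)
pose X := (nat * measurableTypeR R)%type.
pose w (z : X) : R := g_coef z.1 * wpow 1 p z.2.
have w0 z : 0 <= w z by rewrite mulr_ge0 ?g_coef_ge0 ?wpow_ge0.
have mw : measurable_fun setT w.
  apply: measurable_funM; last exact: (measurableT_comp (measurable_wpow _ _) measurable_snd).
  have mg : measurable_fun setT g_coef by move=> _ Y mY.
  exact: (measurableT_comp mg measurable_fst).
pose phi (z : X) : R * nat := (z.2, z.1).
have mphi : measurable_fun setT phi.
  by apply: measurable_fun_pair; [exact: measurable_snd|exact: measurable_fst].
have step (g : R * nat -> \bar R) : measurable_fun setT g -> (forall z, 0 <= g z)%E ->
   (\int[counting \x leb]_z (g (phi z) * (w z)%:E) =
    \sum_(0 <= m <oo) ((g_coef m)%:E * \int[leb]_l (g (l, m) * (wpow 1 p l)%:E)))%E.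
  move=> mg g0; rewrite fubini_tonelli1//=; last 2 first.
  - apply: emeasurable_funM; last exact/measurable_EFinP.
    exact: measurableT_comp.
  - by move=> z; rewrite mule_ge0 ?lee_fin.
  rewrite ge0_integral_count; last first.
    by move=> m; apply: integral_ge0 => l _; rewrite mule_ge0 ?lee_fin.
  apply: eq_eseriesr => m _; rewrite /fubini_F -ge0_integralZl//.
  - by apply: eq_integral => l _; rewrite /w/= EFinM muleCA.
  - apply: emeasurable_funM; last by apply/measurable_EFinP; exact: measurable_wpow.
    exact: (measurableT_comp mg (measurable_pair2 _)).
  - by move=> l _; rewrite mule_ge0 ?lee_fin ?wpow_ge0.
  - by rewrite lee_fin g_coef_ge0.
rewrite (@ge0_integral_density _ _ X (R * nat)%type R (counting \x leb)%E (gamma_alpha alpha) phi w)//.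
  rewrite step//; apply: eq_eseriesr => m _; congr (_ * _)%E.
  rewrite ge0_integral_mpow//.
  exact: (measurableT_comp mf (measurable_pair2 _)).
move=> A mA.
have mI : measurable_fun setT (fun z : R * nat => (\1_A z : R)%:E).
  by apply/measurable_EFinP; exact: measurable_indic.
transitivity (\int[counting \x leb]_z ((\1_A (phi z))%:E * (w z)%:E))%E; last first.
  by rewrite [RHS]integral_mkcond; apply: eq_integral => z _; rewrite epatch_indic muleC.
rewrite (step (fun z => (\1_A z)%:E))//.
transitivity ((c_alpha alpha)%:E * \sum_(0 <= m <oo) ((laguerre alpha m).[0]%:E *
    \int[leb]_(l in ysection (A `&` KKhat) m) (l `^ p)%:E))%E; first by [].
rewrite -nneseriesZl; last first.
  move=> m _; rewrite mule_ge0 ?lee_fin ?laguerre0_ge0//.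
  by apply: integral_ge0 => l _; rewrite lee_fin powR_ge0.
apply: eq_eseriesr => m _; rewrite /g_coef (EFinM (c_alpha alpha)) -muleA.
congr (_ * (_ * _))%E.
rewrite [LHS]integral_mkcond; apply: eq_integral => l _.
rewrite patchE /wpow normr1 mul1r EFinM !indicE mem_ysection in_setI.
have -> : ((l, m) \in (KKhat : set (R * nat))) = (l \in (`[0, +oo[%classic : set R)).
  by apply/idP/idP; rewrite !inE/= in_itv/= andbT.
case: ((l, m) \in A) => /=; last by rewrite mul0e.
by case: (l \in _); rewrite ?mul1e ?mule1 ?mule0.
Qed.

End gamma_alpha_slices.

(** * Orthogonality of Laguerre functions *)

Section laguerre_functional.
Context {R : realType}.
Variable nu : R.
Hypothesis hnu : -1 < nu.
Implicit Types (p q : {poly R}) (m n j k : nat).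

Let nu1 : 0 < nu + 1.
Proof. by rewrite -ltrBlDr sub0r. Qed.

(* The functional [p |-> \int_0^oo p(y) y ^ nu e ^ (- y) dy]. *)
Definition gamma_mom p : R := \sum_(j < size p) p`_j * Gamma (j%:R + (nu + 1)).

Lemma gamma_mom_widen p n : (size p <= n)%N ->
  gamma_mom p = \sum_(j < n) p`_j * Gamma (j%:R + (nu + 1)).
Proof.
move=> pn; rewrite /gamma_mom (big_ord_widen n (fun j => p`_j * Gamma (j%:R + (nu + 1))))//.
rewrite big_mkcond; apply: eq_bigr => j _; case: ltnP => // jp.
by rewrite nth_default// mul0r.
Qed.

Lemma gamma_momD : {morph gamma_mom : p q / p + q}.
Proof.
move=> p q; pose n := maxn (size p) (size q).
rewrite (gamma_mom_widen (n := n)) ?(gamma_mom_widen (n := n) (p := p)) ?(gamma_mom_widen (n := n) (p := q));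
  rewrite ?leq_maxl ?leq_maxr ?(size_polyD)//.
by rewrite -big_split; apply: eq_bigr => j _; rewrite coefD mulrDl.
Qed.

Lemma gamma_momZ a p : gamma_mom (a *: p) = a * gamma_mom p.
Proof.
rewrite (gamma_mom_widen (size_scale_leq a p)) mulr_sumr.
by apply: eq_bigr => j _; rewrite coefZ mulrA.
Qed.

Lemma gamma_mom_sum I (r : seq I) (P : pred I) (F : I -> {poly R}) :
  gamma_mom (\sum_(i <- r | P i) F i) = \sum_(i <- r | P i) gamma_mom (F i).
Proof.
by apply: (big_morph _ gamma_momD); rewrite /gamma_mom size_poly0 big_ord0.
Qed.

Lemma gamma_momM p q : gamma_mom (p * q) = \sum_(j < size p) p`_j * gamma_mom ('X^j * q).
Proof.
rewrite -{1}[p]coefK poly_def mulr_suml gamma_mom_sum.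
by apply: eq_bigr => j _; rewrite -scalerAl gamma_momZ.
Qed.

(** An [m]-th finite difference. As a polynomial in [x], [poch x j] has degree [j] and leading
    coefficient [1 / j!], so the difference vanishes for [j < m] and is a sign for [j = m]; Pascal's
    rule reduces it to the first difference [pochB]. *)
Lemma diff_poch m j (x : R) : (j <= m)%N ->
  \sum_(k < m.+1) (-1) ^+ k * 'C(m, k)%:R * poch (x + k%:R) j = (j == m)%:R * (-1) ^+ m.
Proof.
have pochB y i : poch y i.+1 - poch (y + 1) i.+1 = - poch (y + 1) i :> R.
  apply: (mulfI (_ : i.+1%:R != 0)); rewrite ?pnatr_eq0//.
  rewrite mulrBr pochS; suff -> : (y + i%:R) * poch y i = y * poch (y + 1) i.
    by rewrite pochS -natr1; ring.
  rewrite /poch !mulrA; congr (_ / _).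
  transitivity (\prod_(k < i.+1) (y + k%:R)); first by rewrite big_ord_recr mulrC.
  rewrite big_ord_recl addr0; congr (_ * _); apply: eq_bigr => k _.
  by rewrite lift0 -natr1 [k%:R + 1]addrC addrA.
have rec m' j' y : \sum_(k < m'.+2) (-1) ^+ k * 'C(m'.+1, k)%:R * poch (y + k%:R) j' =
   \sum_(k < m'.+1) (-1) ^+ k * 'C(m', k)%:R * (poch (y + k%:R) j' - poch (y + 1 + k%:R) j') :> R.
  rewrite big_ord_recl bin0 expr0 mulr1 mul1r addr0.
  under eq_bigr => k _ do rewrite lift0 binS natrD mulrDr mulrDl.
  rewrite big_split/= addrA.
  under [RHS]eq_bigr => k _ do rewrite mulrBr.
  rewrite sumrB; congr (_ + _); last first.
    rewrite -sumrN; apply: eq_bigr => k _; rewrite exprS -[k.+1%:R]natr1 [k%:R + 1]addrC addrA; ring.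
  rewrite [in RHS]big_ord_recl bin0 expr0 mulr1 mul1r addr0 big_ord_recr/= bin_small// mulr0 mul0r addr0.
  by congr (_ + _); apply: eq_bigr => k _; rewrite lift0.
elim: m j x => [|m IH] j x.
  by rewrite leqn0 => /eqP ->; rewrite big_ord1 poch0 expr0 /= !mulr1.
rewrite rec; case: j => [|j] jm.
  by rewrite big1 ?mul0r// => k _; rewrite !poch0 subrr mulr0.
under eq_bigr => k _ do rewrite [x + 1 + _]addrAC pochB mulrN addrAC.
rewrite sumrN IH// eqSS exprS; ring.
Qed.

(** Once the Gamma values are written with [Gamma_poch], the sum of moments is the finite difference
    of [diff_poch]: this is the orthogonality to lower powers. *)
Lemma gamma_mom_Xlaguerre m j : (j <= m)%N ->
  gamma_mom ('X^j * laguerre nu m) = (j == m)%:R * (-1) ^+ m * Gamma (m%:R + (nu + 1)).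
Proof.
move=> jm.
have sL : (size (laguerre nu m) <= m.+1)%N by exact: size_poly.
rewrite (gamma_mom_widen (n := (j + m.+1))); last first.
  have [->|L0] := eqVneq (laguerre nu m) 0; first by rewrite mulr0 size_poly0.
  by rewrite mulrC size_mulXn// leq_add2l.
rewrite -(big_mkord xpredT (fun i => ('X^j * laguerre nu m)`_i * Gamma (i%:R + (nu + 1)))).
rewrite (big_cat_nat (leq0n j) (leq_addr _ _))/= big_nat_cond big1 ?add0r => [|i]; last first.
  by rewrite andbT => /andP[_ ij]; rewrite coefXnM ij mul0r.
rewrite -{1}[j]add0n big_addn addKn big_mkord.
transitivity (\sum_(k < m.+1) j`!%:R * Gamma (m%:R + (nu + 1)) / m`!%:R *
    ((-1) ^+ k * 'C(m, k)%:R * poch (nu + 1 + k%:R) j)).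
  apply: eq_bigr => k _; have km : (k <= m)%N by rewrite -ltnS.
  rewrite coefXnM ltnNge leq_addl/= addnK coef_laguerre// km.
  have kc : 0 < nu + 1 + k%:R by rewrite ltr_wpDr.
  rewrite (_ : (k + j)%:R + (nu + 1) = j%:R + (nu + 1 + k%:R)); last by rewrite natrD; ring.
  rewrite (_ : k%:R + nu + 1 = nu + 1 + k%:R); last by ring.
  rewrite (_ : m%:R + (nu + 1) = (m - k)%:R + (nu + 1 + k%:R)); last by rewrite -{1}(subnK km) natrD; ring.
  rewrite !Gamma_poch// -(bin_fact km) !natrM; field.
  by rewrite !gt_eqF ?ltr0n ?fact_gt0 ?bin_gt0.
rewrite -mulr_sumr diff_poch//; case: eqVneq => [->|_]; last by rewrite !mul0r mulr0.
field; by rewrite gt_eqF ?ltr0n ?fact_gt0.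
Qed.

Lemma gamma_mom_laguerre m n :
  gamma_mom (laguerre nu n * laguerre nu m) = (n == m)%:R * (Gamma (m%:R + (nu + 1)) / m`!%:R).
Proof.
wlog nm : m n / (n <= m)%N.
  move=> H; have [nm|/ltnW mn] := leqP n m; first exact: H.
  rewrite mulrC H// eq_sym; case: eqVneq => [->//|_]; by rewrite !mul0r.
have sL : (size (laguerre nu n) <= n.+1)%N by exact: size_poly.
rewrite gamma_momM.
transitivity (\sum_(j < n.+1) (laguerre nu n)`_j * gamma_mom ('X^j * laguerre nu m)).
  rewrite (big_ord_widen n.+1 (fun j => (laguerre nu n)`_j * gamma_mom ('X^j * laguerre nu m)))//.
  rewrite big_mkcond; apply: eq_bigr => j _; case: ltnP => // jp.
  by rewrite nth_default// mul0r.
rewrite big_ord_recr/= big1 ?add0r => [|j _]; last first.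
  rewrite gamma_mom_Xlaguerre; last by rewrite ltnW// (leq_trans _ nm).
  by rewrite ltn_eqF ?mul0r ?mulr0// (leq_trans _ nm).
rewrite gamma_mom_Xlaguerre// coef_laguerre// leqnn subnn poch0 mulr1.
case: eqVneq => [->|_]; last by rewrite !mul0r mulr0.
have -> : (true%:R : R) = 1 by [].
rewrite mul1r; have -> : (-1) ^+ m / m`!%:R * (1 * (-1) ^+ m * Gamma (m%:R + (nu + 1))) =
   ((-1) ^+ m * (-1) ^+ m) * (Gamma (m%:R + (nu + 1)) / m`!%:R) :> R by ring.
by rewrite -exprMn mulrNN mulr1 expr1n mul1r.
Qed.

Lemma laguerre0_Gamma m : (laguerre nu m).[0] = Gamma (m%:R + (nu + 1)) / (m`!%:R * Gamma (nu + 1)).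
Proof.
rewrite laguerre_at0// Gamma_poch//; field.
by rewrite !gt_eqF ?ltr0n ?fact_gt0// Gamma_gt0.
Qed.

Lemma laguerre0_gt0 m : 0 < (laguerre nu m).[0].
Proof.
have mc : 0 < m%:R + (nu + 1) by rewrite ltr_wpDl.
by rewrite laguerre0_Gamma divr_gt0 ?mulr_gt0 ?(Gamma_gt0 mc) ?(Gamma_gt0 nu1) ?ltr0n ?fact_gt0.
Qed.

End laguerre_functional.

(** * Bessel's inequality for an orthogonal sequence *)

Section bessel_inequality.
Context d (T : measurableType d) (R : realType) (mu : {measure set T -> \bar R}).
Implicit Types f g h : T -> R.

Lemma integrable_sqr_mul f g : measurable_fun setT f -> measurable_fun setT g ->
  mu.-integrable setT (fun x => (f x ^+ 2)%:E) ->
  mu.-integrable setT (fun x => (g x ^+ 2)%:E) ->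
  mu.-integrable setT (fun x => (f x * g x)%:E).
Proof.
move=> mf mg if2 ig2; apply: le_integrable (integrableD measurableT if2 ig2) => //.
  by apply/measurable_EFinP; exact: measurable_funM.
move=> x _ /=; rewrite lee_fin [leRHS]ger0_norm ?addr_ge0 ?sqr_ge0//.
rewrite ler_norml; apply/andP; split.
  have : 0 <= (f x + g x) ^+ 2 by exact: sqr_ge0.
  have : 0 <= f x ^+ 2 + g x ^+ 2 by rewrite addr_ge0 ?sqr_ge0.
  by rewrite sqrrD; lra.
have : 0 <= (f x - g x) ^+ 2 by exact: sqr_ge0.
have : 0 <= f x ^+ 2 + g x ^+ 2 by rewrite addr_ge0 ?sqr_ge0.
by rewrite sqrrB; lra.
Qed.

Variables (h : T -> R) (e : nat -> T -> R) (q : nat -> R).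
Hypothesis mh : measurable_fun setT h.
Hypothesis me : forall m, measurable_fun setT (e m).
Hypothesis ih : mu.-integrable setT (fun x => (h x ^+ 2)%:E).
Hypothesis ie : forall m, mu.-integrable setT (fun x => (e m x ^+ 2)%:E).
Hypothesis q0 : forall m, 0 < q m.
Hypothesis orth : forall m n, \int[mu]_x (e m x * e n x) = (m == n)%:R * q m.

Let A m := \int[mu]_x (h x * e m x).

(** The residual [r n] after [n] projections has squared norm equal to the difference of the two
    sides. The induction also carries that it is square integrable and that its pairing with each
    later [e k] is still [A k]. *)
Lemma bessel_inequality M :
  \sum_(m < M) A m ^+ 2 / q m <= \int[mu]_x (h x ^+ 2).
Proof.
pose r n x := h x - \sum_(m < n) A m / q m * e m x.
have rS n x : r n.+1 x = r n x - A n / q n * e n x.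
  by rewrite /r big_ord_recr/= opprD addrA.
have iee m n := integrable_sqr_mul (me m) (me n) (ie m) (ie n).
suff : [/\ measurable_fun setT (r M), mu.-integrable setT (fun x => (r M x ^+ 2)%:E),
    \int[mu]_x (r M x ^+ 2) = \int[mu]_x (h x ^+ 2) - \sum_(m < M) A m ^+ 2 / q m &
    forall k, (M <= k)%N -> \int[mu]_x (r M x * e k x) = A k].
  move=> [_ _ H _]; rewrite -subr_ge0 -H; apply: Rintegral_ge0 => x _; exact: sqr_ge0.
elim: M => [|n [mr ir IH1 IH2]].
  have r0 : r 0%N = h by apply/funext => x; rewrite /r big_ord0 subr0.
  by rewrite r0 big_ord0 subr0; split.
have ire k := integrable_sqr_mul mr (me k) ir (ie k).
have mS : measurable_fun setT (r n.+1).
  rewrite (_ : r n.+1 = (fun x => r n x - A n / q n * e n x)); last exact/funext.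
  by apply: measurable_funB => //; exact: measurable_funM.
have iZ c f : mu.-integrable setT (fun x => (f x)%:E) -> mu.-integrable setT (fun x => (c * f x)%:E).
  by move=> fi; exact: (integrableZl measurableT c fi).
have iB f g : mu.-integrable setT (fun x => (f x)%:E) -> mu.-integrable setT (fun x => (g x)%:E) ->
    mu.-integrable setT (fun x => (f x - g x)%:E).
  by move=> fi gi; exact: (integrableB measurableT fi gi).
set a := A n / q n.
have sqrE x : r n.+1 x ^+ 2 = r n x ^+ 2 - (2 * a * (r n x * e n x) - a ^+ 2 * (e n x * e n x)).
  by rewrite rS -/a; ring.
have i1 := iZ (2 * a) _ (ire n); have i2 := iZ (a ^+ 2) _ (iee n n).
split => //.
- rewrite (_ : (fun x => _) = (fun x => (r n x ^+ 2 - (2 * a * (r n x * e n x) - a ^+ 2 * (e n x * e n x)))%:E)).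
    by apply: (iB (fun x => r n x ^+ 2)) => //; exact: (iB (fun x => 2 * a * (r n x * e n x))).
  by apply/funext => x; rewrite sqrE.
- under eq_Rintegral do rewrite sqrE.
  rewrite RintegralB//; last exact: (iB (fun x => 2 * a * (r n x * e n x))).
  have I1 : \int[mu]_x (2 * a * (r n x * e n x)) = 2 * a * \int[mu]_x (r n x * e n x).
    exact: (@RintegralZl _ _ _ mu setT _ (2 * a) measurableT (ire n)).
  have I2 : \int[mu]_x (a ^+ 2 * (e n x * e n x)) = a ^+ 2 * \int[mu]_x (e n x * e n x).
    exact: (@RintegralZl _ _ _ mu setT _ (a ^+ 2) measurableT (iee n n)).
  rewrite RintegralB// I1 I2 IH1 IH2// orth eqxx mul1r.
  rewrite big_ord_recr/= /a; have := q0 n => qn; field.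
  by rewrite gt_eqF.
- move=> k nk; rewrite (_ : (fun x => _) = (fun x => r n x * e k x - a * (e n x * e k x))).
    have I2 : \int[mu]_x (a * (e n x * e k x)) = a * \int[mu]_x (e n x * e k x).
      exact: (@RintegralZl _ _ _ mu setT _ a measurableT (iee n k)).
    rewrite (RintegralB measurableT (ire k) (iZ a _ (iee n k))).
    by rewrite I2 orth ltn_eqF// mul0r mulr0 subr0 IH2// ltnW.
  by apply/funext => x; rewrite rS -/a; ring.
Qed.

End bessel_inequality.

(** * Bessel's inequality for scaled Laguerre functions in a power weight *)

Section laguerre_bessel_inequality.
Context {R : realType}.
Variables (k nu delta : R).
Hypothesis hk : 0 < k.
Hypothesis hnu : -1 < nu.
Hypothesis hd : 0 < delta.
Local Notation mu := (mpow k (2 * nu + 1)).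

Let nu1 : 0 < nu + 1.
Proof. by rewrite -ltrBlDr sub0r. Qed.

(** Products of two Laguerre functions are combinations of these, so all integrability and
    orthogonality reduce to [gauss_mom]. *)
Let gauss (j : nat) (t : R) : R := t ^+ (2 * j) * expR (- (delta * t ^+ 2)).

Let mgauss j : measurable_fun setT (gauss j).
Proof.
apply: measurable_funM; first exact: measurable_funX.
apply: measurableT_comp => //; apply: measurableT_comp => //.
by apply: measurable_funM => //; exact: measurable_funX.
Qed.

Let gauss_ge0 j t : 0 <= gauss j t.
Proof. by rewrite mulr_ge0 ?expR_ge0// exprM exprn_ge0// sqr_ge0. Qed.

(** Factor produced by [y = delta * t ^ 2], which carries the weight [k * t ^ (2 nu + 1)] to
    [y ^ nu]. *)
Let c0 : R := k / (2 * delta `^ (nu + 1)).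

Let gauss_mom j : (\int[mu]_t (gauss j t)%:E =
  (c0 * Gamma (j%:R + (nu + 1)) / delta ^+ j)%:E)%E.
Proof.
rewrite ge0_integral_mpow_pos; last 2 first.
- by apply/measurable_EFinP; exact: mgauss.
- by move=> t; rewrite lee_fin gauss_ge0.
have c1 : 0 < j%:R + (nu + 1) by rewrite ltr_wpDl.
pose g t := t `^ (2 * (j%:R + (nu + 1)) - 1) * expR (- (delta * t ^+ 2)).
transitivity (\int[lebesgue_measure]_(t in `]0%R, +oo[) (k%:E * (g t)%:E))%E.
  apply: eq_integral => t; rewrite inE/= in_itv/= andbT => t0.
  rewrite -!EFinM (gtr0_norm hk) /gauss /g; congr EFin.
  rewrite (_ : 2 * (j%:R + (nu + 1)) - 1 = (2 * j)%:R + (2 * nu + 1)); last by rewrite natrM; ring.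
  by rewrite (@powRD_gt0 _ t (2 * j)%:R (2 * nu + 1) t0) powR_mulrn ?(ltW t0)//; ring.
rewrite ge0_integralZl//; last 3 first.
- apply/measurable_EFinP/measurable_funTS; apply: measurable_funM; first exact: measurable_powR.
  apply: measurableT_comp => //; apply: measurableT_comp => //.
  by apply: measurable_funM => //; exact: measurable_funX.
- by move=> t _; rewrite lee_fin mulr_ge0 ?powR_ge0 ?expR_ge0.
- by rewrite lee_fin ltW.
rewrite gaussian_moment// -EFinM; congr EFin.
rewrite powRD_gt0// powR_mulrn ?(ltW hd)// /c0; field.
by rewrite !gt_eqF ?powR_gt0 ?exprn_gt0.
Qed.

Let igauss j : mu.-integrable setT (fun t => (gauss j t)%:E).
Proof.
apply/integrableP; split; first by apply/measurable_EFinP; exact: mgauss.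
by under eq_integral do rewrite gee0_abs ?lee_fin ?gauss_ge0//; rewrite gauss_mom ltry.
Qed.

Let gpoly (p : {poly R}) (t : R) : R := p.[delta * t ^+ 2] * expR (- (delta * t ^+ 2)).

Let gpolyE p t : gpoly p t = \sum_(j < size p) p`_j * delta ^+ j * gauss j t.
Proof.
rewrite /gpoly horner_coef mulr_suml; apply: eq_bigr => j _.
by rewrite /gauss exprMn exprM; ring.
Qed.

Let igpoly p : mu.-integrable setT (fun t => (gpoly p t)%:E).
Proof.
rewrite (_ : (fun t => _) = (fun t => \sum_(j < size p) ((p`_j * delta ^+ j)%:E * (gauss j t)%:E)))%E.
  by apply: integrable_sum => // j _; exact: integrableZl.
by apply/funext => t; rewrite gpolyE -sumEFin.
Qed.

Let Rint_gpoly p : \int[mu]_t gpoly p t = c0 * gamma_mom nu p.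
Proof.
apply: EFin_inj; rewrite /Rintegral fineK; last exact: integrable_fin_num.
transitivity (\int[mu]_t (\sum_(j < size p) ((p`_j * delta ^+ j)%:E * (gauss j t)%:E)))%E.
  by apply: eq_integral => t _; rewrite gpolyE -sumEFin.
rewrite integral_sum//; last by move=> j; exact: integrableZl.
rewrite /gamma_mom mulr_sumr -sumEFin; apply: eq_bigr => j _.
rewrite integralZl// gauss_mom -EFinM; congr EFin.
by field; rewrite gt_eqF ?exprn_gt0.
Qed.

Definition lag_fun m t : R := laguerre_fun nu m (delta * t ^+ 2).

Lemma measurable_lag_fun m : measurable_fun setT (lag_fun m).
Proof.
rewrite /lag_fun /laguerre_fun; apply: measurable_funM => //; apply: measurable_funM.
  apply: measurableT_comp => //; apply: measurable_funM => //; apply: measurableT_comp => //.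
  by apply: measurable_funM => //; exact: measurable_funX.
apply: (measurableT_comp (f := fun y => (laguerre nu m).[y])).
  apply: continuous_measurable_fun; exact: continuous_horner.
by apply: measurable_funM => //; exact: measurable_funX.
Qed.

Let lag_funM m n t : lag_fun m t * lag_fun n t =
  ((laguerre nu m).[0] * (laguerre nu n).[0])^-1 * gpoly (laguerre nu m * laguerre nu n) t.
Proof.
rewrite /lag_fun /laguerre_fun /gpoly hornerM invfM.
have -> : expR (- (delta * t ^+ 2)) = expR (- (delta * t ^+ 2) / 2) * expR (- (delta * t ^+ 2) / 2).
  by rewrite -expRD; congr expR; field.
ring.
Qed.

Lemma integrable_lag_funM m n : mu.-integrable setT (fun t => (lag_fun m t * lag_fun n t)%:E).
Proof.
rewrite (_ : (fun t => _) = (fun t => (((laguerre nu m).[0] * (laguerre nu n).[0])^-1)%:E *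
    (gpoly (laguerre nu m * laguerre nu n) t)%:E))%E; first exact: integrableZl.
by apply/funext => t; rewrite lag_funM.
Qed.

Lemma lag_fun_orthogonal m n : \int[mu]_t (lag_fun m t * lag_fun n t) =
  (m == n)%:R * (k * Gamma (nu + 1) / (2 * delta `^ (nu + 1) * (laguerre nu m).[0])).
Proof.
under eq_Rintegral do rewrite lag_funM.
rewrite (@RintegralZl _ _ _ mu setT _ _ measurableT (igpoly _)) Rint_gpoly gamma_mom_laguerre//.
case: eqVneq => [->|_]; last by rewrite !mul0r !mulr0.
rewrite (_ : (true%:R : R) = 1)// !mul1r.
have L0 := laguerre0_gt0 hnu n; have LE := laguerre0_Gamma hnu n.
have G0 := Gamma_gt0 nu1; have f0 : 0 < n`!%:R :> R by rewrite ltr0n fact_gt0.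
have -> : Gamma (n%:R + (nu + 1)) / n`!%:R = Gamma (nu + 1) * (laguerre nu n).[0].
  by rewrite LE; field; rewrite !gt_eqF.
rewrite /c0; field.
by rewrite !gt_eqF ?powR_gt0.
Qed.

(** The scale [delta] is free because the lemma serves twice: at the frequency itself for the
    x-variable, and at a scale tending to 0 for the Hankel transform. *)
Lemma laguerre_bessel_inequality (h : R -> R) M :
  measurable_fun setT h -> mu.-integrable setT (fun t => (h t ^+ 2)%:E) ->
  \sum_(m < M) (\int[mu]_t (h t * lag_fun m t)) ^+ 2 * (laguerre nu m).[0] *
     (2 * delta `^ (nu + 1) / (k * Gamma (nu + 1)))
  <= \int[mu]_t (h t ^+ 2).
Proof.
move=> mh ih.
pose q m := k * Gamma (nu + 1) / (2 * delta `^ (nu + 1) * (laguerre nu m).[0]).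
have q0 m : 0 < q m.
  by rewrite divr_gt0 ?mulr_gt0 ?Gamma_gt0 ?powR_gt0 ?laguerre0_gt0.
have := @bessel_inequality _ _ R mu h lag_fun q mh measurable_lag_fun ih
  (fun m => integrable_lag_funM m m) q0 lag_fun_orthogonal M.
apply: le_trans; rewrite le_eqVlt; apply/predU1P; left; apply: eq_bigr => m _.
rewrite /q -mulrA; congr (_ * _); rewrite invf_div; ring.
Qed.

End laguerre_bessel_inequality.

(** * The Hankel transform is a contraction *)

Section nonneg_integrals.
Context d (T : measurableType d) (R : realType) (mu : {measure set T -> \bar R}).
Implicit Types (D : set T).

(* Unlike [ge0_le_integral], no measurability is needed, the integral of a nonnegative
   function being a supremum over the simple functions below it. *)
Lemma le_integral_ge0 D (f g : T -> \bar R) : (forall x, D x -> 0 <= f x)%E ->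
  (forall x, D x -> f x <= g x)%E -> (\int[mu]_(x in D) f x <= \int[mu]_(x in D) g x)%E.
Proof.
move=> f0 fg; have g0 x : D x -> (0 <= g x)%E by move=> Dx; rewrite (le_trans (f0 x Dx))// fg.
rewrite !ge0_integralE//; apply: ge_ereal_sup => /= _ [h hf <-].
apply: ereal_sup_ubound; exists h => // x; rewrite (le_trans (hf x))//.
by rewrite /patch; case: ifPn => // /set_mem; exact: fg.
Qed.

Lemma le_limn_einf (u v : nat -> \bar R) : (forall n, u n <= v n)%E ->
  (limn_einf u <= limn_einf v)%E.
Proof.
move=> uv; rewrite !limn_einf_lim; apply: lee_lim; [exact: is_cvg_einfs|exact: is_cvg_einfs|].
apply: nearW => n; apply: le_ereal_inf_tmp => _ [k nk <-].
by apply: le_trans (uv k); apply: ereal_inf_lbound; exists k.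
Qed.

Lemma limn_einf_le (u : nat -> \bar R) C : (forall n, u n <= C)%E -> (limn_einf u <= C)%E.
Proof.
move=> uC; rewrite limn_einf_lim; apply: lime_le; first exact: is_cvg_einfs.
apply: nearW => n; apply: le_trans (uC n); apply: ereal_inf_lbound; exists n => //=.
Qed.

(** Two sequences, because in [hankel_inequality] the integral bound concerns a whole series [f n],
    while only one of its terms, [X n], has a known limit. *)
Lemma fatou_le D (f X : nat -> T -> \bar R) (g : T -> \bar R) C : measurable D ->
  (forall n, measurable_fun D (f n)) -> (forall n x, D x -> 0 <= f n x)%E ->
  (forall x, D x -> 0 <= g x)%E -> (forall n x, D x -> X n x <= f n x)%E ->
  (forall x, D x -> X ^~ x @ \oo --> g x) ->
  (forall n, \int[mu]_(x in D) f n x <= C)%E -> (\int[mu]_(x in D) g x <= C)%E.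
Proof.
move=> mD mf f0 g0 Xf Xg fC; apply: le_trans (limn_einf_le fC).
apply: le_trans (fatou mu mD mf f0); apply: le_integral_ge0 => // x Dx.
by rewrite -(cvg_limn_einf_sup (Xg x Dx)).1; apply: le_limn_einf => n; exact: Xf.
Qed.

Lemma Rdominated_cvg (f : nat -> T -> R) (l g : T -> R) :
  (forall n, measurable_fun setT (f n)) -> (forall x, f ^~ x @ \oo --> l x) ->
  mu.-integrable setT (EFin \o g) -> (forall n x, `|f n x| <= g x) ->
  \int[mu]_x f n x @[n --> \oo] --> \int[mu]_x l x.
Proof.
move=> mf fl ig fg.
have mfE n : measurable_fun setT (EFin \o f n) by apply/measurable_EFinP; exact: mf.
have flE x : setT x -> (f n x)%:E @[n --> \oo] --> (l x)%:E.
  by move=> _; apply: cvg_EFin; [exact: nearW|exact: fl].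
have gfin x : setT x -> (g x)%:E \is a fin_num by [].
have fgE n x : setT x -> (`|(f n x)%:E| <= (g x)%:E)%E by move=> _; rewrite lee_fin.
have := dominated_cvg measurableT mfE flE gfin ig fgE.
have mlE : measurable_fun setT (EFin \o l) by exact: emeasurable_fun_cvg mfE flE.
have [il _ _] := dominated_convergence measurableT mfE mlE (aeW mu flE) ig (aeW mu (fun x n Dx => fgE n x Dx)).
rewrite -[X in _ --> X -> _]fineK; last exact: integrable_fin_num.
by move/fine_cvg.
Qed.

End nonneg_integrals.

Section mpow_bounded.
Context {R : realType}.
Variables (k p b : R).
Hypothesis p0 : 0 <= p.

Lemma mpow_itv_lty : (mpow k p `[0%R, b] < +oo)%E.
Proof.
have -> : mpow k p `[0, b] = (\int[lebesgue_measure]_(x in `[0%R, b]) (wpow k p x)%:E)%E by [].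
apply: (@le_lt_trans _ _ (\int[lebesgue_measure]_(x in `[0%R, b]) (`|k| * `|b| `^ p)%:E)%E).
  apply: le_integral_ge0 => x /=; first by rewrite lee_fin wpow_ge0.
  rewrite in_itv/= => /andP[x0 xb]; rewrite lee_fin /wpow indicE mem_set/= ?in_itv/= ?x0// mulr1.
  by rewrite ler_wpM2l// ge0_ler_powR ?nnegrE// (le_trans xb)// ler_norm.
rewrite integral_cst//= lebesgue_measure_itv/=.
by case: ifPn => _; rewrite ?mule0// -EFinM ltry.
Qed.

Lemma integrable_mpow_bounded (h : R -> R) B : measurable_fun setT h ->
  (forall t, `|h t| <= B) -> (forall t, ~ `[0, b]%classic t -> h t = 0) ->
  (mpow k p).-integrable setT (fun t => (h t)%:E).
Proof.
move=> mh hB hs.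
have mI : measurable (`[0, b]%classic : set R) by exact: measurable_itv.
have -> : (fun t => (h t)%:E) = (fun t => (h t)%:E) \_ `[0, b]%classic.
  apply/funext => t; rewrite /patch; case: ifPn => // /negP nt.
  by rewrite hs// => tI; apply: nt; rewrite inE.
apply/(integrable_mkcond _ mI).
apply: measurable_bounded_integrable => //; first exact: mpow_itv_lty.
  exact: measurable_funTS.
exists B; split; first by rewrite num_real.
by move=> M BM t _ /=; rewrite (le_trans (hB t))// ltW.
Qed.

End mpow_bounded.

(** * Passage to the limit in series under a summable bound *)

Section tannery.
Context {R : realType}.
Implicit Types (a b B : nat -> R).

Lemma series_tail_le a B K : (forall k, `|a k| <= B k) -> cvgn (series B) ->
  `|limn (series a) - series a K| <= limn (series B) - series B K.
Proof.
move=> aB cB.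
have ca : cvgn (series a).
  by apply: normed_cvg; apply: (series_le_cvg _ _ aB) => // k; exact: le_trans (aB k).
have h j : (K <= j)%N -> `|series a j - series a K| <= series B j - series B K.
  elim: j => [|j IH]; first by rewrite leqn0 => /eqP ->; rewrite !subrr normr0.
  rewrite leq_eqVlt => /predU1P[<-|]; first by rewrite !subrr normr0.
  rewrite ltnS => /IH {}IH; rewrite !seriesSr !(addrAC _ _ (- _)).
  by rewrite (le_trans (ler_normD _ _))// lerD.
apply: (@ler_cvg_to _ \oo _ _ (fun j => `|series a j - series a K|) (fun j => series B j - series B K)).
- by apply: cvg_norm; apply: cvgB => //; exact: cvg_cst.
- by apply: cvgB => //; exact: cvg_cst.
- by exists K.
Qed.

Lemma tannery (a : nat -> nat -> R) b B : (forall n k, `|a n k| <= B k) ->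
  cvgn (series B) -> (forall k, a n k @[n --> \oo] --> b k) ->
  limn (series (a n)) @[n --> \oo] --> limn (series b).
Proof.
move=> aB cB ab.
have bB k : `|b k| <= B k.
  apply: (@ler_cvg_to _ \oo _ _ (fun n => `|a n k|) (fun=> B k)).
  - by apply: cvg_norm; exact: ab.
  - exact: cvg_cst.
  - exact: nearW.
apply/cvgrPdist_lt => e e0.
have e3 : 0 < e / 3 by rewrite divr_gt0.
(* [K] depends on the tail of [B] alone, so both tails are small uniformly in [n]; only then is [n]
   taken large for the first [K] terms. *)
have [K _ /(_ K (leqnn K)) KB] : \forall K \near \oo, `|limn (series B) - series B K| < e / 3.
  by move/cvgrPdist_lt : cB; exact.
have cK : series (a n) K @[n --> \oo] --> series b K.
  elim: K {KB} => [|K IH].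
    under eq_fun do rewrite /series/= big_geq//.
    by rewrite /series/= big_geq//; exact: cvg_cst.
  by under eq_fun do rewrite seriesSr; rewrite seriesSr; exact: cvgD.
have tl := ler_norm (limn (series B) - series B K).
near=> n.
have : `|series b K - series (a n) K| < e / 3 by near: n; move/cvgrPdist_lt : cK; exact.
have := series_tail_le K bB cB; have := series_tail_le K (aB n) cB.
set x := limn (series (a n)); set y := limn (series b); set X := series _ K; set Y := series b K.
move=> h1 h2 h3.
rewrite (_ : y - x = (y - Y) + (Y - X) - (x - X)); last by ring.
by rewrite (le_lt_trans (ler_normB _ _))// (le_lt_trans (lerD (ler_normD _ _) (lexx _)))//; lra.
Unshelve. all: by end_near. Qed.

End tannery.

(** * Convergence of Laguerre functions to the Bessel function *)

Section laguerre_to_bessel.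
Context {R : realType}.
Variable nu : R.
Hypothesis hnu : - 2^-1 <= nu.

Let nu1 : 0 < nu + 1.
Proof. by rewrite -ltrBlDr sub0r (lt_le_trans _ hnu)// ltrN2 invf_lt1// ltr1n. Qed.

(** Terms of the normalized Laguerre polynomial. The falling factorial vanishes for [k > m], so the
    finite sum is also an infinite series, the form required by [tannery]. *)
Definition lag_term m (z : R) k : R := (-1) ^+ k * bessel_coef nu k * (m ^_ k)%:R * z ^+ k.

Lemma laguerre_fun_sum m z :
  laguerre_fun nu m z = expR (- z / 2) * \sum_(k < m.+1) lag_term m z k.
Proof.
rewrite /laguerre_fun -mulrA; congr (_ * _).
rewrite (horner_coef_wide _ (size_poly _ _)) mulr_suml; apply: eq_bigr => k _.
have km : (k <= m)%N by rewrite -ltnS.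
rewrite horner_coef0 !coef_poly ltn_ord ltn0Sn /lag_term /bessel_coef subn0 expr0 mul1r fact0 add0r.
have := ffact_fact km => /(congr1 (fun i : nat => i%:R : R)); rewrite natrM => <-.
have G1 : 0 < Gamma (m%:R + nu + 1) :> R by rewrite Gamma_gt0// -addrA ltr_wpDl.
have G2 : 0 < Gamma (k%:R + nu + 1) :> R by rewrite Gamma_gt0// -addrA ltr_wpDl.
have G3 : 0 < Gamma (nu + 1) :> R by rewrite Gamma_gt0.
rewrite (addrC nu k%:R); move: G1 G2 G3.
have [f1 f2] : 0 < k`!%:R :> R /\ 0 < (m - k)`!%:R :> R by rewrite !ltr0n !fact_gt0.
have f3 : 0 < (m ^_ k)%:R :> R by rewrite ltr0n ffact_gt0.
move: f1 f2 f3; move: (Gamma _) (Gamma _) (Gamma _) => g1 g2 g3.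
move: (k`!%:R : R) ((m - k)`!%:R : R) ((m ^_ k)%:R : R) => a b c a0 b0 c0 h1 h2 h3.
by field; rewrite !gt_eqF.
Qed.

(** Through [m ^_ k <= m ^ k] the bound depends on [m] and [z] by their product only, the quantity
    kept bounded in the limit. *)
Lemma norm_lag_term m z k : 0 <= z -> `|lag_term m z k| <= 2 * exp_coeff (m%:R * z) k.
Proof.
move=> z0; have -> : `|lag_term m z k| = bessel_coef nu k * (m ^_ k)%:R * z ^+ k.
  rewrite /lag_term normrM normrM [`|_ * bessel_coef nu k|]normrM normrX normrN1 expr1n mul1r.
  by rewrite (ger0_norm (bessel_coef_ge0 nu k)) normr_nat (ger0_norm (exprn_ge0 _ z0)).
have -> : 2 * exp_coeff (m%:R * z) k = 2 / k`!%:R * (m%:R ^+ k * z ^+ k).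
  by rewrite /exp_coeff/= exprMn; ring.
rewrite -mulrA ler_pM ?bessel_coef_ge0 ?bessel_coef_le ?mulr_ge0 ?exprn_ge0//.
rewrite ler_wpM2r ?exprn_ge0// -natrX ler_nat.
by elim: k => // k IH; rewrite ffactnSr expnSr leq_mul// leq_subr.
Qed.

Lemma laguerre_funE m z : 0 <= z ->
  laguerre_fun nu m z = expR (- z / 2) * limn (series (lag_term m z)).
Proof.
move=> z0; rewrite laguerre_fun_sum; congr (_ * _); apply/esym/cvg_lim => //.
apply: cvg_near_cst; exists m.+1 => //= n /= mn.
rewrite /series/= (big_cat_nat (leq0n m.+1) mn)/= big_mkord [X in _ + X]big_nat_cond [X in _ + X]big1 ?addr0// => k.
by rewrite andbT => /andP[mk _]; rewrite /lag_term ffact_small// mulr0 mul0r.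
Qed.

(** Covers the negative orders that escape [norm_laguerre_fun_le1]; it supplies the dominating
    function in the Hankel limit. *)
Lemma norm_laguerre_fun_le m z : 0 <= z -> `|laguerre_fun nu m z| <= 2 * expR (m%:R * z).
Proof.
move=> z0; rewrite laguerre_fun_sum normrM (ger0_norm (expR_ge0 _)).
rewrite (le_trans (y := `|\sum_(k < m.+1) lag_term m z k|))//.
  by rewrite ler_piMl// -expR0 ler_expR mulNr oppr_le0 divr_ge0.
rewrite (le_trans (ler_norm_sum _ _ _))//.
apply: (le_trans (y := \sum_(k < m.+1) 2 * exp_coeff (m%:R * z) k)).
  by apply: ler_sum => k _; exact: norm_lag_term.
rewrite -mulr_sumr ler_wpM2l// /expR.
rewrite -(big_mkord xpredT (fun k => exp_coeff (m%:R * z) k)).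
apply: (nondecreasing_cvgn_le (u_ := series (exp_coeff (m%:R * z)))).
  by apply: nondecreasing_series => k _ _; apply: exp_coeff_ge0; rewrite mulr_ge0.
exact: is_cvg_series_exp_coeff.
Qed.

(** A Mehler-Heine limit: the exponential factor tends to 1 and [m ^_ k * z ^ k] to [w ^ k]. The
    argument [4 * w] compensates the powers of 4 in [bessel_pcoef]. *)
Lemma cvg_laguerre_bessel (m : nat -> nat) (z : nat -> R) (w : R) :
  (forall n, 0 <= z n) -> z n @[n --> \oo] --> (0 : R) ->
  (m n)%:R * z n @[n --> \oo] --> w ->
  laguerre_fun nu (m n) (z n) @[n --> \oo] --> bessel_fun nu (4 * w).
Proof.
move=> z0 z_0 mz.
under eq_fun do rewrite laguerre_funE//.
rewrite -[bessel_fun _ _]mul1r; apply: cvgM.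
  have h : - z n / 2 @[n --> \oo] --> - (0 : R) / 2 by apply: cvgMl; exact: cvgN.
  by have := cvg_comp _ _ h (@continuous_expR R (- 0 / 2)); rewrite oppr0 mul0r expR0.
have [W [_ WB]] : bounded_fun (fun n => (m n)%:R * z n : R^o).
  by apply: cvg_seq_bounded; apply/cvg_ex; exists w.
have mzW n : (m n)%:R * z n <= W + 1.
  by have := WB (W + 1) (ltr_pwDr ltr01 (lexx W)) n I; rewrite /= ger0_norm ?mulr_ge0.
rewrite /bessel_fun; apply: (@tannery _ _ _ (fun k => 2 * exp_coeff (W + 1) k)).
- move=> n k; rewrite (le_trans (norm_lag_term _ _ (z0 n)))// ler_wpM2l// /exp_coeff/=.
  by rewrite ler_wpM2r// lerXn2r// nnegrE ?mulr_ge0// (le_trans _ (mzW n))// mulr_ge0.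
- by apply: is_cvg_seriesZ; exact: is_cvg_series_exp_coeff.
move=> k; rewrite /= /lag_term /bessel_pcoef exprMn.
rewrite (_ : _ / 4 ^+ k * _ = (-1) ^+ k * bessel_coef nu k * w ^+ k); last by field; rewrite expf_neq0.
rewrite (_ : (fun n => _) = (fun n => (-1) ^+ k * bessel_coef nu k * ((m n ^_ k)%:R * z n ^+ k))); last first.
  by apply/funext => n; rewrite !mulrA.
apply: cvgMr; elim: k => [|k IH].
  by under eq_fun do rewrite ffactn0 !expr0 mul1r; exact: cvg_cst.
have -> : (fun n => (m n ^_ k.+1)%:R * z n ^+ k.+1) =
    (fun n => ((m n ^_ k)%:R * z n ^+ k) * ((m n - k)%:R * z n)).
  by apply/funext => n; rewrite ffactnSr natrM exprSr; ring.
rewrite exprSr; apply: cvgM => //.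
(* The lower bound also holds when [m n < k], where the truncated difference is 0. *)
apply: (@squeeze_cvgr _ _ _ _ (fun n => (m n)%:R * z n - k%:R * z n) (fun n => (m n)%:R * z n)) => //.
  near=> n; rewrite -mulrBl !ler_wpM2r// ?ler_nat ?leq_subr//.
  by rewrite lerBlDr -natrD ler_nat addnC -leq_subLR.
by rewrite -[X in _ --> X]subr0 -[X in _ - X](mulr0 k%:R); apply: cvgB => //; exact: cvgMr.
Unshelve. all: by end_near. Qed.

End laguerre_to_bessel.

(** * The Hankel inequality for bounded functions of bounded support *)

Section hankel.
Context {R : realType}.
Variables (nu b B : R) (h : R -> R).
Hypothesis hnu : - 2^-1 <= nu.
Hypothesis mh : measurable_fun setT h.
Hypothesis hB : forall t, `|h t| <= B.
Hypothesis hs : forall t, ~ `[0, b]%classic t -> h t = 0.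
Local Notation mu := (mpow 1 (2 * nu + 1)).
Local Notation leb := (@lebesgue_measure R).
Local Notation pos := (`]0, +oo[%classic : set R).

Let p0 : 0 <= 2 * nu + 1.
Proof. by move: hnu; lra. Qed.

Let nuN1 : -1 < nu.
Proof. by move: hnu; lra. Qed.

Let G0 : 0 < Gamma (nu + 1).
Proof. by apply: Gamma_gt0; move: hnu; lra. Qed.

Let B0 : 0 <= B.
Proof. exact: le_trans (hB 0). Qed.

(** With a degree close to [r ^ 2 * n.+1], degree times [step n * t ^ 2] tends to [(r * t) ^ 2 / 4],
    the value that [cvg_laguerre_bessel] turns into the Bessel kernel at [r * t]. *)
Let step n : R := (4 * n.+1%:R)^-1.
Let step_gt0 n : 0 < step n.
Proof. by rewrite invr_gt0 mulr_gt0. Qed.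

(** The base of the power in the lower bound on Gamma: [m] for [nu >= 0] by [Gamma_ge_pow], [m + 1]
    for [nu < 0] by [Gamma_ge_pow_le0]. *)
Let ell m : R := (m + (nu < 0)%R)%N%:R.
Let A n m : R := \int[mu]_t (h t * lag_fun nu (step n) m t).
(** Discrete form of the squared transform times [r ^ (2 nu)], with [4 * step n * ell m] standing
    for [r ^ 2]. *)
Let c n m : R := A n m ^+ 2 * (step n * ell m) `^ nu * 4 `^ nu.
(** Chosen so that the integral of [r] over it is [1 / (2 n.+1)], whatever the degree. Neighbours
    share an endpoint, which is harmless since [f] has only to dominate [X]. *)
Let I n m : set R := `[Num.sqrt (m%:R / n.+1%:R), Num.sqrt (m.+1%:R / n.+1%:R)]%classic.
(** The sum starts at degree 1: [Gamma_ge_pow] wants a positive degree and [FTC_pos] a positive left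
    endpoint. For fixed [r > 0] the relevant degree is positive once [n] is large. *)
Let f n (r : R) : \bar R := (\sum_(0 <= m <oo) ((c n m.+1)%:E * (r * \1_(I n m.+1) r)%:E))%E.

Let c_ge0 n m : 0 <= c n m.
Proof. by rewrite /c mulr_ge0 ?powR_ge0// mulr_ge0 ?powR_ge0 ?sqr_ge0. Qed.

Let term_ge0 n m r : 0 < r -> (0 <= (c n m.+1)%:E * (r * \1_(I n m.+1) r)%:E)%E.
Proof. by move=> r0; rewrite -EFinM lee_fin mulr_ge0// mulr_ge0 ?(ltW r0). Qed.

Let mterm n m : measurable_fun pos (fun r => ((c n m.+1)%:E * (r * \1_(I n m.+1) r)%:E)%E).
Proof.
apply: emeasurable_funM => //; apply/measurable_EFinP/measurable_funTS; apply: measurable_funM => //.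
by apply: measurable_indic; exact: measurable_itv.
Qed.

Let int_h2 : mu.-integrable setT (fun t => (h t ^+ 2)%:E).
Proof.
apply: (integrable_mpow_bounded 1 p0 (B := B ^+ 2) (b := b)).
- exact: measurable_funX.
- by move=> t; rewrite normrX lerXn2r// ?nnegrE.
- by move=> t /hs ->; rewrite expr0n.
Qed.

Let int_I n m : (\int[leb]_(r in pos) (r * \1_(I n m.+1) r)%:E = (2 * n.+1%:R)^-1%:E)%E.
Proof.
have N0 : 0 < n.+1%:R :> R by [].
have s0 : 0 < Num.sqrt (m.+1%:R / n.+1%:R) :> R by rewrite sqrtr_gt0 divr_gt0.
transitivity (\int[leb]_(r in pos) ((fun r : R => r%:E) \_ (I n m.+1)) r)%E.
  apply: eq_integral => r _; rewrite /patch indicE; case: ifPn => _; rewrite ?mulr1 ?mulr0//.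
rewrite -integral_mkcondr (_ : pos `&` I n m.+1 = I n m.+1); last first.
  apply/setIidPr => r; rewrite /I/= !in_itv/= andbT => /andP[+ _]; exact: lt_le_trans.
have dF (r : R) : 0 < r -> is_derive r 1 (fun x : R => x * x / 2) (id r).
  by move=> _; apply: is_derive_eq; rewrite /GRing.scale/=; field.
have ss : Num.sqrt (m.+1%:R / n.+1%:R) <= Num.sqrt (m.+2%:R / n.+1%:R) :> R.
  by apply: ler_wsqrtr; rewrite ler_wpM2r ?invr_ge0// ler_nat.
rewrite (FTC_pos s0 ss dF) => [|r _]; last exact: cvg_id.
rewrite -!expr2 !sqr_sqrtr ?divr_ge0//; congr EFin; rewrite -[m.+2%:R]natr1; field.
by rewrite nat1r gt_eqF.
Qed.

(** As [1 / (2 n.+1) = 2 * step n], the powers of [step n] agree on both sides; the one genuine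
    inequality is [L], the lower bound on the Laguerre polynomial at 0. *)
Let c_le n m : c n m.+1 / (2 * n.+1%:R) <= 4 `^ nu * Gamma (nu + 1) ^+ 2 *
  (A n m.+1 ^+ 2 * (laguerre nu m.+1).[0] * (2 * step n `^ (nu + 1) / (1 * Gamma (nu + 1)))).
Proof.
have L : ell m.+1 `^ nu <= Gamma (nu + 1) * (laguerre nu m.+1).[0].
  have f0 : 0 < m.+1`!%:R :> R by rewrite ltr0n fact_gt0.
  have -> : Gamma (nu + 1) * (laguerre nu m.+1).[0] = Gamma (m.+1%:R + nu + 1) / m.+1`!%:R.
    rewrite (laguerre0_Gamma nuN1) addrA; field.
    by rewrite !gt_eqF.
  rewrite ler_pdivlMr// mulrC /ell; case: ltP => n0; last by rewrite addn0 Gamma_ge_pow.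
  by rewrite addn1 Gamma_ge_pow_le0// ltW.
rewrite /c powRM ?(ltW (step_gt0 n)) ?ler0n// powRD_gt0// powRr1 ?(ltW (step_gt0 n))//.
have := powR_ge0 (step n) nu; have := powR_ge0 (4 : R) nu; have := sqr_ge0 (A n m.+1).
have N0 : 0 < n.+1%:R :> R by [].
move: G0 N0 L; rewrite /step.
move: (ell m.+1 `^ nu) ((laguerre nu m.+1).[0]) (A n m.+1 ^+ 2) (4 `^ nu) ((4 * n.+1%:R)^-1 `^ nu).
move: (n.+1%:R : R) (Gamma (nu + 1)) => N G l L a q d G_gt0 N0 lL a0 q0 d0.
rewrite [leLHS](_ : _ = a * d * q / (2 * N) * l); last by field; rewrite gt_eqF.
rewrite [leRHS](_ : _ = a * d * q / (2 * N) * (G * L)); last by field; rewrite !gt_eqF.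
by rewrite ler_wpM2l// divr_ge0 ?mulr_ge0 ?(ltW N0).
Qed.

Let int_f n : (\int[leb]_(r in pos) f n r <= (4 `^ nu * Gamma (nu + 1) ^+ 2 * \int[mu]_t (h t ^+ 2))%:E)%E.
Proof.
rewrite integral_nneseries//; last 2 first.
- exact: mterm.
- by move=> m r; rewrite /= in_itv/= andbT; exact: term_ge0.
have g0 : 0 <= 4 `^ nu * Gamma (nu + 1) ^+ 2 by rewrite mulr_ge0 ?powR_ge0 ?sqr_ge0.
have iE m : (\int[leb]_(r in pos) ((c n m.+1)%:E * (r * \1_(I n m.+1) r)%:E) = (c n m.+1 / (2 * n.+1%:R))%:E)%E.
  rewrite ge0_integralZl//.
  - by rewrite int_I.
  - apply/measurable_EFinP/measurable_funTS; apply: measurable_funM => //.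
    by apply: measurable_indic; exact: measurable_itv.
  - by move=> r; rewrite /= in_itv/= andbT => /ltW r0; rewrite lee_fin mulr_ge0.
  - by rewrite lee_fin c_ge0.
rewrite (eq_eseriesr (fun m _ => iE m)).
apply: lime_le.
  by apply: is_cvg_nneseries => m _ _; rewrite lee_fin divr_ge0 ?c_ge0.
apply: nearW => M; rewrite sumEFin lee_fin big_mkord.
apply: le_trans (ler_wpM2l g0 (laguerre_bessel_inequality ltr01 nuN1 (step_gt0 n) M.+1 mh int_h2)).
rewrite mulr_sumr big_ord_recl ler_wpDl//.
  rewrite mulr_ge0// mulr_ge0//; first by rewrite mulr_ge0 ?sqr_ge0 ?laguerre0_ge0.
  by rewrite divr_ge0 ?mulr_ge0 ?powR_ge0 ?Gamma_ge0.
by apply: ler_sum => m _; rewrite lift0; exact: c_le.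
Qed.

Let nat_at n (r : R) := Num.truncn (r ^+ 2 * n.+1%:R).

Let X n (r : R) : \bar R := if nat_at n r is m.+1 then (c n m.+1 * r)%:E else 0%E.

Let X_le_f n r : 0 < r -> (X n r <= f n r)%E.
Proof.
move=> r0; rewrite /X; case E : (nat_at n r) => [|m].
  by apply: nneseries_ge0 => m _ _; exact: term_ge0.
apply: le_trans (nneseries_lim_ge m.+1 _); last by move=> k _ _; exact: term_ge0.
rewrite big_mkord big_ord_recr/=.
apply: (le_trans _ (leeDr _ _)); last by apply: sume_ge0 => k _; exact: term_ge0.
have N0 : 0 < n.+1%:R :> R by [].
have /andP[l1 l2] : m.+1%:R <= r ^+ 2 * n.+1%:R < m.+2%:R.
  by rewrite -E; apply: truncn_itv; rewrite mulr_ge0 ?sqr_ge0.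
rewrite indicE mem_set ?mulr1//= /I/= in_itv/=.
have rr : Num.sqrt (r ^+ 2) = r by rewrite sqrtr_sqr ger0_norm// ltW.
apply/andP; split.
  by rewrite -[leRHS]rr ler_wsqrtr// ler_pdivrMr.
by rewrite -[leLHS]rr ler_wsqrtr// ler_pdivlMr// ltW.
Qed.

Let cvg_nat_at r : 0 < r -> (nat_at n r)%:R / n.+1%:R @[n --> \oo] --> r ^+ 2.
Proof.
move=> r0; apply: (@squeeze_cvgr _ _ _ _ (fun n => r ^+ 2 - n.+1%:R^-1) (fun=> r ^+ 2)).
- near=> n; have N0 : 0 < n.+1%:R :> R by [].
  have /andP[l1 l2] : (nat_at n r)%:R <= r ^+ 2 * n.+1%:R < (nat_at n r).+1%:R.
    by apply: truncn_itv; rewrite mulr_ge0 ?sqr_ge0.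
  rewrite ler_pdivrMr// l1 andbT ler_pdivlMr// mulrBl mulVf ?gt_eqF// lerBlDr natr1.
  exact: ltW.
- by rewrite -[X in _ --> X]subr0; apply: cvgB; [exact: cvg_cst|exact: cvg_harmonic].
- exact: cvg_cst.
Unshelve. all: by end_near. Qed.

Let cvg_A r : 0 < r -> A n (nat_at n r) @[n --> \oo] --> \int[mu]_t (h t * bessel_j nu (r * t)).
Proof.
(* Bounds degree times [step n * t ^ 2] for [t] in the support, uniformly in [n], hence the
   exponential of [norm_laguerre_fun_le]. *)
move=> r0; pose W := r ^+ 2 * `|b| ^+ 2 / 4.
apply: (@Rdominated_cvg _ _ _ mu _ _ (fun t => B * (2 * expR W) * \1_(`[0, b]%classic) t)).
- by move=> n; apply: measurable_funM => //; exact: measurable_lag_fun.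
- move=> t; apply: cvgMr; rewrite bessel_jE//.
  rewrite (_ : (r * t) ^+ 2 = 4 * (r ^+ 2 * (t ^+ 2 / 4))); last by field.
  have s0 : step n @[n --> \oo] --> (0 : R).
    rewrite /step; under eq_fun do rewrite invfM.
    have := cvgM (cvg_cst (4^-1 : R)) (@cvg_harmonic R); rewrite mulr0; exact.
  apply: (@cvg_laguerre_bessel _ _ hnu _ (fun n => step n * t ^+ 2)).
  + by move=> n; rewrite mulr_ge0 ?sqr_ge0 ?(ltW (step_gt0 n)).
  + by rewrite -[X in _ --> X](mul0r (t ^+ 2)); exact: cvgMl.
  + rewrite (_ : (fun n => _) = (fun n => (nat_at n r)%:R / n.+1%:R * (t ^+ 2 / 4))).
      by apply: cvgMl; exact: cvg_nat_at.
    apply/funext => n; rewrite /step; field.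
    by rewrite nat1r gt_eqF.
- apply: (integrable_mpow_bounded 1 p0 (B := B * (2 * expR W)) (b := b)).
  + apply: measurable_funM => //; apply: measurable_indic; exact: measurable_itv.
  + move=> t; rewrite ger0_norm ?mulr_ge0 ?expR_ge0//.
    by rewrite ler_piMr ?mulr_ge0 ?expR_ge0// indicE lern1; case: (_ \in _).
  + by move=> t nt; rewrite indicE memNset ?mulr0.
- move=> n t; have [tI|/hs ->] := pselect (`[0, b]%classic t); last first.
    by rewrite mul0r normr0 !mulr_ge0 ?expR_ge0.
  rewrite indicE mem_set// mulr1 normrM ler_pM//.
  have st0 : 0 <= step n * t ^+ 2 by rewrite mulr_ge0 ?sqr_ge0 ?(ltW (step_gt0 n)).
  rewrite (le_trans (norm_laguerre_fun_le hnu _ st0))// ler_wpM2l// ler_expR.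
  move: tI; rewrite /= in_itv/= => /andP[t0 tb].
  have N0 : 0 < n.+1%:R :> R by [].
  have -> : (nat_at n r)%:R * (step n * t ^+ 2) = (nat_at n r)%:R / n.+1%:R * t ^+ 2 / 4.
    by rewrite /step invfM; ring.
  rewrite /W ler_wpM2r//; apply: ler_pM; rewrite ?sqr_ge0 ?divr_ge0//.
    rewrite ler_pdivrMr//; have /andP[+ _] := truncn_itv (mulr_ge0 (sqr_ge0 r) (ltW N0)); exact.
  by rewrite lerXn2r ?nnegrE ?normr_ge0// (le_trans tb)// ler_norm.
Qed.

(* [f n] is a step function built from the Bessel inequality at scale [step n], with the
   coefficient of degree [m] spread over [I n m]; its value at [r] involves the degree
   [nat_at n r] close to [r ^ 2 * n]. *)
Lemma hankel_inequality :
  (\int[leb]_(r in pos) ((\int[mu]_t (h t * bessel_j nu (r * t))) ^+ 2 * r `^ (2 * nu + 1))%:E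
   <= (4 `^ nu * Gamma (nu + 1) ^+ 2 * \int[mu]_t (h t ^+ 2))%:E)%E.
Proof.
apply: (@fatou_le _ _ _ leb pos f X) => //.
- move=> n; apply: ge0_emeasurable_sum => [m r|m _]; last exact: mterm.
  by move=> + _; rewrite /= in_itv/= andbT; exact: term_ge0.
- move=> n r /=; rewrite in_itv/= andbT => r0.
  by apply: nneseries_ge0 => m _ _; exact: term_ge0.
- by move=> r _; rewrite lee_fin mulr_ge0 ?sqr_ge0 ?powR_ge0.
- by move=> n r /=; rewrite in_itv/= andbT; exact: X_le_f.
move=> r /=; rewrite in_itv/= andbT => r0.
have X_near : \forall n \near \oo, (c n (nat_at n r) * r)%:E = X n r.
  (* From this index on [r ^ 2 * n.+1 >= 1], so the degree is positive and [X] is out of its zero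
     branch. *)
  exists (Num.truncn (r ^- 2)) => //= n /= nn; rewrite /X; case E : (nat_at n r) => //=.
  suff : (0 < nat_at n r)%N by rewrite E.
  rewrite truncn_gt0 -ler_pdivrMl ?exprn_gt0// mulr1.
  by rewrite ltW// (lt_le_trans (truncnS_gt _))// ler_nat.
apply: cvg_trans; first exact: (near_eq_cvg X_near).
apply: cvg_EFin; first exact: nearW.
have w0 : 0 < r ^+ 2 / 4 by rewrite divr_gt0// exprn_gt0.
have cw : step n * ell (nat_at n r) @[n --> \oo] --> r ^+ 2 / 4.
  rewrite (_ : (fun n => _) = (fun n => (nat_at n r)%:R / n.+1%:R / 4 + (nu < 0)%R%:R / 4 * n.+1%:R^-1)).
    have c2 : (nu < 0)%R%:R / 4 * n.+1%:R^-1 @[n --> \oo] --> (0 : R).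
      have := cvgM (cvg_cst ((nu < 0)%R%:R / 4 : R)) (@cvg_harmonic R); rewrite mulr0; exact.
    rewrite -[r ^+ 2 / 4]addr0; apply: cvgD => //.
    by apply: cvgMl; exact: cvg_nat_at.
  apply/funext => n; rewrite /step /ell natrD; field.
  by rewrite nat1r gt_eqF.
have cp := cvg_comp _ _ cw (@continuous_powR R nu _ w0).
rewrite (_ : _ * r `^ (2 * nu + 1) = (\int[mu]_t (h t * bessel_j nu (r * t))) ^+ 2 * (r ^+ 2 / 4) `^ nu * 4 `^ nu * r).
  by apply: cvgMl; apply: cvgMl; apply: cvgM; [apply: cvgM; exact: cvg_A|exact: cp].
have -> : r `^ (2 * nu + 1) = (r ^+ 2 / 4) `^ nu * 4 `^ nu * r.
  by rewrite -powRM ?(ltW w0)// divfK// powRD_gt0// powRr1 ?(ltW r0)// powRrM powR_mulrn// ltW.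
ring.
Qed.


End hankel.

(** * The Plancherel inequality *)

Section measurable_parametric_integral.
Context d1 d2 (T1 : measurableType d1) (T2 : measurableType d2) (R : realType).
Variable m2 : {sigma_finite_measure set T2 -> \bar R}.

Lemma measurable_parametric_integral (f : T1 * T2 -> \bar R) : measurable_fun setT f ->
  measurable_fun setT (fun x => \int[m2]_y f (x, y))%E.
Proof.
move=> mf; under eq_fun do rewrite integralE.
apply: emeasurable_funB.
  rewrite (_ : (fun x => _) = fubini_F m2 (f^\+)%E).
    by apply: measurable_fun_fubini_tonelli_F; [exact: measurable_funepos|move=> z; exact: funepos_ge0].
  by apply/funext => x; apply: eq_integral => y _; rewrite !funeposE.
rewrite (_ : (fun x => _) = fubini_F m2 (f^\-)%E).
  by apply: measurable_fun_fubini_tonelli_F; [exact: measurable_funeneg|move=> z; exact: funeneg_ge0].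
by apply/funext => x; apply: eq_integral => y _; rewrite !funenegE.
Qed.

Lemma measurable_parametric_Rintegral (f : T1 -> T2 -> R) :
  measurable_fun setT (fun z => f z.1 z.2) ->
  measurable_fun setT (fun x => \int[m2]_y f x y).
Proof.
move=> /measurable_EFinP mf; have h := measurable_parametric_integral mf.
exact: (measurableT_comp (@fine_measurable R setT measurableT)).
Qed.

End measurable_parametric_integral.

Lemma measurable_nat_slices d d' (T : measurableType d) (U : measurableType d')
    (F : T * nat -> U) :
  (forall m, measurable_fun setT (fun x => F (x, m))) -> measurable_fun setT F.
Proof.
move=> mF _ Y mY; rewrite setTI.
have -> : F @^-1` Y = \bigcup_m (((fun x => F (x, m)) @^-1` Y) `*` [set m]).
  apply/seteqP; split => [[x m] Yx|[x m] [k _ [/= Yx ->]]//].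
  by exists m.
apply: bigcup_measurable => m _; apply: measurableX => //.
by rewrite -[X in measurable X]setTI; exact: mF.
Qed.

Section kernel_bounds.
Context {R : realType}.
Variable alpha : R.
Hypothesis halpha : 0 <= alpha.

Let hnu : - 2^-1 <= alpha - 2^-1.
Proof. by move: halpha; lra. Qed.

Lemma norm_phi_le1 w z : 0 <= w.1 -> `|phi alpha w z| <= 1.
Proof.
move=> w0; rewrite /phi normrM mulr_ile1//.
- exact: norm_bessel_j_le1.
- by apply: norm_laguerre_fun_le1 => //; rewrite mulr_ge0 ?sqr_ge0.
Qed.

Lemma measurable_laguerre_fun m : measurable_fun setT (laguerre_fun alpha m).
Proof.
apply: measurable_funM => //; apply: measurable_funM.
  apply: measurableT_comp => //; apply: measurable_funM => //; exact: measurableT_comp.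
by apply: continuous_measurable_fun; exact: continuous_horner.
Qed.

Lemma measurable_bessel : measurable_fun setT (bessel_j (alpha - 2^-1)).
Proof. by apply: continuous_measurable_fun; exact: continuous_bessel_j. Qed.

Lemma measurable_phi w : measurable_fun setT (phi alpha w).
Proof.
apply: measurable_funM.
  apply: (measurableT_comp measurable_bessel); apply: measurable_funM => //.
apply: (measurableT_comp (measurable_laguerre_fun _)); apply: measurable_funM => //.
exact: measurable_funX.
Qed.

Lemma integral_m_alpha (f : R * R -> \bar R) :
  (\int[m_alpha alpha]_z f z = \int[mx alpha \x mt alpha]_z f z)%E.
Proof. by apply: eq_measure_integral => A mA _; exact: m_alphaE. Qed.

(* [|w.1|] instead of [w.1] makes the kernel bounded on the whole of [R * nat]. *)
Definition LB_real (f : R * R -> R) (w : R * nat) : R :=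
  \int[m_alpha alpha]_z (f z * phi alpha (`|w.1|, w.2) z).

End kernel_bounds.

(** * The Plancherel inequality for bounded functions supported in a square *)

Section plancherel_bounded.
Context {R : realType}.
Variables (alpha b B : R) (f : R * R -> R).
Hypothesis halpha : 0 <= alpha.
Hypothesis mf : measurable_fun setT f.
Hypothesis fB : forall z, `|f z| <= B.
Hypothesis fs : forall z, ~ (`[0, b]%classic z.1 /\ `[0, b]%classic z.2) -> f z = 0.
Local Notation mx := (mx alpha).
Local Notation mt := (mt alpha).
Local Notation leb := (@lebesgue_measure R).
Local Notation pos := (`]0, +oo[%classic : set R).

Let hnu : - 2^-1 <= alpha - 2^-1.
Proof. by move: halpha; lra. Qed.

Let a1 : -1 < alpha.
Proof. by move: halpha; lra. Qed.

Let p1 : 0 <= 2 * alpha + 1.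
Proof. by rewrite addr_ge0 ?mulr_ge0. Qed.

Let p2 : 0 <= 2 * alpha.
Proof. by rewrite mulr_ge0. Qed.

Let B0 : 0 <= B.
Proof. exact: le_trans (fB (0, 0)). Qed.

Let G0 : 0 < Gamma (alpha + 1).
Proof. by apply: Gamma_gt0; rewrite ltr_wpDl. Qed.

Let k0 : 0 < m_coef alpha.
Proof. by rewrite invr_gt0 mulr_gt0 ?pi_gt0. Qed.

Lemma integrable_prod_bounded (g : R * R -> R) C : measurable_fun setT g ->
  (forall z, `|g z| <= C) ->
  (forall z, ~ (`[0, b]%classic z.1 /\ `[0, b]%classic z.2) -> g z = 0) ->
  (mx \x mt)%E.-integrable setT (EFin \o g).
Proof.
move=> mg gC gs; pose Q : set (R * R) := `[0, b]%classic `*` `[0, b]%classic.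
have mI : measurable (`[0, b]%classic : set R) by exact: measurable_itv.
have mQ : measurable Q by exact: measurableX.
have -> : EFin \o g = (EFin \o g) \_ Q.
  apply/funext => z; rewrite /patch; case: ifPn => // /negP nt /=.
  by rewrite gs// => tI; apply: nt; rewrite inE.
apply/(integrable_mkcond _ mQ).
apply: measurable_bounded_integrable => //.
- rewrite /= product_measure1E//; apply: lte_mul_pinfty; first exact: measure_ge0.
  + by rewrite ge0_fin_numE; [exact: mpow_itv_lty|exact: measure_ge0].
  + exact: mpow_itv_lty.
- exact: measurable_funTS.
- exists C; split; first by rewrite num_real.
  by move=> M CM z _ /=; rewrite (le_trans (gC z))// ltW.
Qed.

(** The Hankel part of the transform at fixed [x]; the Laguerre part is then applied in [x] by
    [LB_realE]. *)
Let J (l x : R) : R := \int[mt]_t (f (x, t) * bessel_j (alpha - 2^-1) (`|l| * t)).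

Let mJ : measurable_fun setT (fun z : R * R => J z.1 z.2).
Proof.
apply: (@measurable_parametric_Rintegral _ _ (R * R)%type R R mt
  (fun u t => f (u.2, t) * bessel_j (alpha - 2^-1) (`|u.1| * t))).
apply: measurable_funM.
  apply: (measurableT_comp mf); apply: measurable_fun_pair => //.
  exact: (measurableT_comp measurable_snd measurable_fst).
apply: (measurableT_comp (measurable_bessel halpha)); apply: measurable_funM => //.
apply: measurableT_comp => //; exact: (measurableT_comp measurable_fst measurable_fst).
Qed.

Let f_section x : measurable_fun setT (fun t => f (x, t)).
Proof. exact: (measurableT_comp mf (measurable_pair1 x)). Qed.

Let f_sectionB x t : `|f (x, t)| <= B. Proof. exact: fB. Qed.
Let f_sections x t : ~ `[0, b]%classic t -> f (x, t) = 0.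
Proof. by move=> nt; apply: fs => -[]. Qed.

Let integrable_bessel_section (l x : R) :
  mt.-integrable setT (fun t => (f (x, t) * bessel_j (alpha - 2^-1) (`|l| * t))%:E).
Proof.
apply: (integrable_mpow_bounded 1 p2 (B := B) (b := b)).
- apply: measurable_funM => //; apply: (measurableT_comp (measurable_bessel halpha)).
  exact: measurable_funM.
- by move=> t; rewrite normrM -[leRHS]mulr1 ler_pM// norm_bessel_j_le1.
- by move=> t /(f_sections x) ->; rewrite mul0r.
Qed.

Let LB_realE (l : R) m : 0 < l ->
  LB_real alpha f (l, m) = \int[mx]_x (J l x * lag_fun alpha l m x).
Proof.
move=> l0; rewrite /LB_real /Rintegral/= integral_m_alpha; congr fine.
rewrite -integral12_prod_meas1/=; last first.
  apply: (@integrable_prod_bounded _ B).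
  - by apply: measurable_funM => //; exact: measurable_phi.
  - by move=> z; rewrite normrM -[leRHS]mulr1 ler_pM// norm_phi_le1/=.
  - by move=> z /fs ->; rewrite mul0r.
apply: eq_integral => x _; rewrite /fubini_F/=.
under eq_integral do rewrite /phi/= mulrA mulrC EFinM.
transitivity ((laguerre_fun alpha m (`|l| * x ^+ 2))%:E *
   \int[mt]_t (f (x, t) * bessel_j (alpha - 2^-1) (`|l| * t))%:E)%E.
  exact: (integralZl measurableT (integrable_bessel_section l x)).
rewrite [RHS]EFinM muleC /lag_fun -[in RHS](gtr0_norm l0); congr (_ * _)%E.
by rewrite /J /Rintegral !normr_id fineK// integrable_fin_num.
Qed.

Let JB l x : `|J l x| <= B * fine (mt `[0, b]%classic).
Proof.
have mI : measurable (`[0, b]%classic : set R) by exact: measurable_itv.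
have i1 : mt.-integrable setT (fun t => (B * \1_(`[0, b]%classic) t)%:E).
  apply: (integrable_mpow_bounded 1 p2 (B := B) (b := b)).
  - by apply: measurable_funM => //; exact: measurable_indic.
  - by move=> t; rewrite ger0_norm ?mulr_ge0// ler_piMr// indicE lern1; case: (_ \in _).
  - by move=> t nt; rewrite indicE memNset ?mulr0.
rewrite (le_trans (le_normr_Rintegral measurableT (integrable_bessel_section l x)))//.
apply: (@le_trans _ _ (\int[mt]_t (B * \1_(`[0, b]%classic) t))).
  apply: le_Rintegral => //; first exact: integrable_norm (integrable_bessel_section l x).
  move=> t _; have [tI|nt] := pselect (`[0, b]%classic t).
    by rewrite indicE mem_set// mulr1 normrM -[leRHS]mulr1 ler_pM// norm_bessel_j_le1.
  by rewrite f_sections// mul0r normr0 mulr_ge0.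
rewrite /Rintegral; under eq_integral do rewrite EFinM.
rewrite ge0_integralZl//.
- rewrite integral_indic// setIT fineM// ge0_fin_numE ?measure_ge0//; exact: mpow_itv_lty.
- by apply/measurable_EFinP; exact: measurable_indic.
Qed.

Let Js l x : ~ `[0, b]%classic x -> J l x = 0.
Proof.
move=> nx; rewrite /J /Rintegral (eq_integral (cst 0%E)) ?integral0//.
by move=> t _; rewrite fs ?mul0r// => -[].
Qed.

Let mJ1 l : measurable_fun setT (J l).
Proof. exact: (measurableT_comp mJ (measurable_pair1 l)). Qed.

Let mJ2 x : measurable_fun setT (J^~ x).
Proof. exact: (measurableT_comp mJ (measurable_pair2 x)). Qed.

Let integrable_J2 l : mx.-integrable setT (fun x => (J l x ^+ 2)%:E).
Proof.
set C := B * fine (mt `[0, b]%classic).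
apply: (integrable_mpow_bounded (m_coef alpha) p1 (B := C ^+ 2) (b := b)).
- exact: measurable_funX.
- by move=> x; rewrite normrX lerXn2r ?nnegrE// (le_trans _ (JB l x)).
- by move=> x /(Js l) ->; rewrite expr0n.
Qed.

(** [c_alpha] divided by the factor [2 / (m_coef * Gamma (alpha + 1))] of the Laguerre inequality.
    [C1E] confronts it with the Hankel constant, and it is there that the value of [c_alpha]
    matters. *)
Let C1 : R := c_alpha alpha * m_coef alpha * Gamma (alpha + 1) / 2.

Let C1E : C1 * (4 `^ (alpha - 2^-1) * Gamma (alpha - 2^-1 + 1) ^+ 2) = 1.
Proof.
rewrite /C1 /c_alpha /m_coef (_ : alpha - 2^-1 + 1 = alpha + 2^-1); last by field.
have -> : (4 : R) `^ (alpha - 2^-1) = 2 `^ (2 * alpha - 1).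
  by rewrite (_ : 2 * alpha - 1 = 2 * (alpha - 2^-1)) ?powRrM ?powR_mulrn -?natrX//; field.
have g1 := G0; have g2 : 0 < Gamma (alpha + 2^-1) by rewrite Gamma_gt0 ?ltr_wpDl.
have q0 : 0 < (2 : R) `^ (2 * alpha - 1) by exact: powR_gt0.
have pi0 := pi_gt0 R.
move: g1 g2 q0 pi0; move: (Gamma _) (Gamma _) (_ `^ _) (pi : R) => x y z w x0 y0 z0 w0.
by field; rewrite !gt_eqF.
Qed.

Let C1_ge0 : 0 <= C1.
Proof.
apply: divr_ge0 => //; apply: mulr_ge0; last exact: Gamma_ge0.
by apply: mulr_ge0; [exact: c_alpha_ge0|exact: m_coef_ge0].
Qed.

Lemma measurable_LB_real_bounded : measurable_fun setT (LB_real alpha f).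
Proof.
apply: measurable_nat_slices => m.
have -> : (fun l => LB_real alpha f (l, m)) =
    (fun l => fine (\int[mx]_x \int[mt]_t (f (x, t) * phi alpha (`|l|, m) (x, t))%:E)%E).
  apply/funext => l; rewrite /LB_real /Rintegral/= integral_m_alpha; congr fine.
  rewrite -integral12_prod_meas1//=.
  apply: (@integrable_prod_bounded _ B).
  - by apply: measurable_funM => //; exact: measurable_phi.
  - by move=> z; rewrite normrM -[leRHS]mulr1 ler_pM// norm_phi_le1/=.
  - by move=> z /fs ->; rewrite mul0r.
apply: (measurableT_comp (@fine_measurable R setT measurableT)).
apply: (@measurable_parametric_integral _ _ R R R mx (fun z => \int[mt]_t (f (z.2, t) * phi alpha (`|z.1|, m) (z.2, t))%:E)%E).
apply: (@measurable_parametric_integral _ _ (R * R)%type R R mt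
  (fun u => (f (u.1.2, u.2) * phi alpha (`|u.1.1|, m) (u.1.2, u.2))%:E)).
have m11 : measurable_fun setT (fun u : R * R * R => u.1.1).
  exact: (measurableT_comp measurable_fst measurable_fst).
have m12 : measurable_fun setT (fun u : R * R * R => u.1.2).
  exact: (measurableT_comp measurable_snd measurable_fst).
apply/measurable_EFinP; apply: measurable_funM.
  by apply: (measurableT_comp mf); exact: measurable_fun_pair.
apply: measurable_funM => /=.
  apply: (measurableT_comp (measurable_bessel halpha)); apply: measurable_funM => //.
  exact: measurableT_comp.
apply: (measurableT_comp (measurable_laguerre_fun alpha m)); apply: measurable_funM.
  exact: measurableT_comp.
exact: measurable_funX.
Qed.

(* The scaling parameter of the Laguerre functions is the frequency [l] itself. *)
Let laguerre_sum_le (l : R) M : 0 < l ->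
  \sum_(m < M) g_coef alpha m * LB_real alpha f (l, m : nat) ^+ 2 * l `^ (3 * alpha + 1) <=
  C1 * (\int[mx]_x (J l x ^+ 2)) * l `^ (2 * alpha).
Proof.
move=> l0; have := laguerre_bessel_inequality k0 a1 l0 M (mJ1 l) (integrable_J2 l).
set S := \int[_]_x _ => h.
have p0 : 0 < l `^ (alpha + 1) by exact: powR_gt0.
have q0 := powR_gt0 (2 * alpha) l0.
have c0 := c_alpha_ge0 alpha.
rewrite [leLHS](_ : _ = C1 * (\sum_(m < M) (\int[mx]_t (J l t * lag_fun alpha l m t)) ^+ 2 * (laguerre alpha m).[0] *
   (2 * l `^ (alpha + 1) / (m_coef alpha * Gamma (alpha + 1)))) * l `^ (2 * alpha)).
  by apply: ler_wpM2r; [exact: powR_ge0|exact: ler_wpM2l].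
rewrite mulr_sumr mulr_suml; apply: eq_bigr => m _; rewrite LB_realE// /g_coef.
(* The spectral weight splits: the power [alpha + 1] is consumed by the Laguerre inequality at scale
   [l], and [2 * alpha] is the Hankel weight of order [alpha - 1/2]. *)
rewrite (_ : 3 * alpha + 1 = (alpha + 1) + 2 * alpha); last by ring.
rewrite (powRD_gt0 _ _ l0) /C1; move: G0 k0.
move: (Gamma _) (m_coef _) (Rintegral _ _ _) (c_alpha _) (l `^ (alpha + 1)) (l `^ (2 * alpha)) => g k A c u v g0 kk0.
by field; rewrite !gt_eqF.
Qed.

Lemma plancherel_bounded :
  (\int[gamma_alpha alpha]_w (LB_real alpha f w ^+ 2)%:E <= \int[m_alpha alpha]_z (f z ^+ 2)%:E)%E.
Proof.
have mLB := measurable_LB_real_bounded.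
have mLB2 : measurable_fun setT (fun w => (LB_real alpha f w ^+ 2)%:E).
  by apply/measurable_EFinP; exact: measurable_funX.
rewrite ge0_integral_gamma_alpha//; last by move=> w; rewrite lee_fin sqr_ge0.
pose t m (l : R) : \bar R := (g_coef alpha m * LB_real alpha f (l, m) ^+ 2 * l `^ (3 * alpha + 1))%:E.
have mLBm m : measurable_fun setT (fun l => LB_real alpha f (l, m)).
  exact: (measurableT_comp mLB (measurable_pair2 m)).
have mtm m : measurable_fun pos (t m).
  apply/measurable_EFinP/measurable_funTS; apply: measurable_funM; last exact: measurable_powR.
  by apply: measurable_funM => //; exact: measurable_funX.
have t0 m l : (0 <= t m l)%E.
  rewrite lee_fin; apply: mulr_ge0; last exact: powR_ge0.
  by apply: mulr_ge0; [exact: g_coef_ge0|exact: sqr_ge0].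
have -> : (\sum_(0 <= m <oo) ((g_coef alpha m)%:E * \int[m_spec alpha]_l (LB_real alpha f (l, m) ^+ 2)%:E) =
    \int[leb]_(l in pos) \sum_(m <oo) t m l)%E.
  rewrite integral_nneseries//; apply: eq_eseriesr => m _.
  rewrite ge0_integral_mpow_pos; last 2 first.
  - by apply/measurable_EFinP; exact: measurable_funX.
  - by move=> l; rewrite lee_fin sqr_ge0.
  rewrite -ge0_integralZl//.
  - by apply: eq_integral => l _; rewrite normr1 mul1r -!EFinM mulrA.
  - apply: emeasurable_funM; apply/measurable_EFinP/measurable_funTS.
      apply: (measurable_funX 2); exact: mLBm.
    by apply: measurable_funM => //; exact: measurable_powR.
  - by move=> l _; rewrite -EFinM lee_fin mulr_ge0 ?sqr_ge0 ?mulr_ge0 ?powR_ge0.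
  - by rewrite lee_fin g_coef_ge0.
pose g (l x : R) : \bar R := (C1 * J l x ^+ 2)%:E.
have g0 l x : (0 <= g l x)%E by rewrite lee_fin mulr_ge0 ?sqr_ge0.
have mg : measurable_fun setT (fun z : R * R => g z.1 z.2).
  by apply/measurable_EFinP; apply: measurable_funM => //; exact: measurable_funX.
(* The sum over degrees is bounded at each fixed [l]; the remaining power of [l] is the density of
   [mt], now in the frequency variable. *)
apply: (@le_trans _ _ (\int[mt]_l \int[mx]_x g l x))%E.
  rewrite ge0_integral_mpow_pos; last 2 first.
  - exact: (measurable_parametric_integral mx mg).
  - by move=> l; apply: integral_ge0.
  apply: le_integral_ge0 => l /=; rewrite in_itv/= andbT => l0; first exact: nneseries_ge0.
  apply: lime_le; first by apply: is_cvg_nneseries.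
  apply: nearW => M; rewrite sumEFin big_mkord.
  have -> : (\int[mx]_x g l x = (C1 * \int[mx]_x (J l x ^+ 2))%:E)%E.
    rewrite /g; under eq_integral do rewrite EFinM.
    rewrite integralZl//; rewrite [RHS]EFinM; congr (_ * _)%E.
    by rewrite /Rintegral fineK// integrable_fin_num.
  rewrite normr1 mul1r -EFinM lee_fin; exact: laguerre_sum_le.
(* Exchanged so that at fixed [x] the integral in [l] is the one bounded by [hankel_inequality]. *)
have -> : (\int[mt]_l \int[mx]_x g l x = \int[mx]_x \int[mt]_l g l x)%E.
  exact: (@fubini_tonelli _ _ _ _ _ mt mx (fun z : R * R => g z.1 z.2) mg (fun z => g0 z.1 z.2)).
rewrite integral_m_alpha fubini_tonelli1//=; last 2 first.
- by apply/measurable_EFinP; exact: measurable_funX.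
- by move=> z; rewrite lee_fin sqr_ge0.
apply: le_integral_ge0 => x _; first exact: integral_ge0.
rewrite /fubini_F/= /fubini_G/=.
have i2 : mt.-integrable setT (fun t => (f (x, t) ^+ 2)%:E).
  apply: (integrable_mpow_bounded 1 p2 (B := B ^+ 2) (b := b)).
  - exact: measurable_funX.
  - by move=> u; rewrite normrX lerXn2r// ?nnegrE.
  - by move=> u /(f_sections x) ->; rewrite expr0n.
have hk := hankel_inequality hnu (f_section x) (f_sectionB x) (@f_sections x).
rewrite ge0_integral_mpow_pos//; last first.
  by apply/measurable_EFinP; apply: measurable_funM => //; exact: measurable_funX.
apply: (@le_trans _ _ (C1%:E * \int[leb]_(l in pos) (J l x ^+ 2 * l `^ (2 * alpha))%:E))%E.
  rewrite -ge0_integralZl//.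
  - by rewrite le_eqVlt; apply/predU1P; left; apply: eq_integral => l _; rewrite normr1 mul1r -!EFinM; congr EFin; ring.
  - apply/measurable_EFinP/measurable_funTS; apply: measurable_funM; last exact: measurable_powR.
    by apply: (measurable_funX 2); exact: mJ2.
  - by move=> l _; rewrite lee_fin mulr_ge0 ?sqr_ge0 ?powR_ge0.
have -> : (\int[mt]_t (f (x, t) ^+ 2)%:E = (\int[mt]_t (f (x, t) ^+ 2))%:E)%E.
  by rewrite /Rintegral fineK// integrable_fin_num.
have e : 2 * (alpha - 2^-1) + 1 = 2 * alpha by field.
rewrite e in hk.
apply: (@le_trans _ _ (C1%:E * (4 `^ (alpha - 2^-1) * Gamma (alpha - 2^-1 + 1) ^+ 2 *
  \int[mt]_t (f (x, t) ^+ 2))%:E)%E); last by rewrite -EFinM mulrA C1E mul1r.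
apply: lee_wpmul2l; first by rewrite lee_fin.
apply: le_trans hk.
apply: le_integral_ge0 => l /=; rewrite in_itv/= andbT => l0.
  by rewrite lee_fin mulr_ge0 ?sqr_ge0 ?powR_ge0.
by rewrite /J (gtr0_norm l0).
Qed.

End plancherel_bounded.

(** * Extension to integrable functions by truncation *)

Section plancherel_L1.
Context {R : realType}.
Variables (alpha : R) (f : R * R -> R).
Hypothesis halpha : 0 <= alpha.
Hypothesis intf : (m_alpha alpha).-integrable setT (EFin \o f).
Hypothesis fs : forall z, ~ KK z -> f z = 0.

Let mf : measurable_fun setT f.
Proof. by apply/measurable_EFinP; exact: measurable_int intf. Qed.

(** Cuts in space and in height, to meet the hypotheses of [plancherel_bounded]; the transforms
    converge pointwise by domination by [|f|], and the inequality passes by Fatou. *)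
Let Q (n : nat) : set (R * R) :=
  (`[0, n%:R]%classic `*` `[0, n%:R]%classic) `&` (f @^-1` `[- n%:R, n%:R]%classic).

Let mQ n : measurable (Q n).
Proof.
apply: measurableI; first by apply: measurableX; exact: measurable_itv.
by rewrite -[X in measurable X]setTI; apply: mf => //; exact: measurable_itv.
Qed.

Let fQ n z : R := f z * \1_(Q n) z.

Let mfQ n : measurable_fun setT (fQ n).
Proof. by apply: measurable_funM => //; exact: measurable_indic. Qed.

Let fQB n z : `|fQ n z| <= n%:R.
Proof.
rewrite /fQ indicE; case: (boolP (z \in Q n)) => [|_]; last by rewrite mulr0 normr0.
by rewrite inE => -[_ /=]; rewrite in_itv/= mulr1 ler_norml.
Qed.

Let fQs n z : ~ (`[0, n%:R]%classic z.1 /\ `[0, n%:R]%classic z.2) -> fQ n z = 0.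
Proof. by move=> nz; rewrite /fQ indicE memNset ?mulr0// => -[]. Qed.

Let fQ_le n z : `|fQ n z| <= `|f z|.
Proof. by rewrite normrM ler_piMr// indicE ger0_norm// lern1; case: (_ \in _). Qed.

Let cvg_fQ z : fQ n z @[n --> \oo] --> f z.
Proof.
have [[/= x0 t0]|nK] := pselect (KK z); last first.
  by under eq_fun do rewrite /fQ fs// mul0r; rewrite fs//; exact: cvg_cst.
apply: cvg_near_cst; exists (Num.truncn (z.1 + z.2 + `|f z|)).+1 => //= n nn.
have h : z.1 + z.2 + `|f z| <= n%:R.
  by apply/ltW/(lt_le_trans (truncnS_gt _)); rewrite ler_nat.
rewrite /fQ indicE mem_set ?mulr1//; split => /=; rewrite !in_itv/=.
  by rewrite x0 t0/=; split; apply: le_trans h; move: (normr_ge0 (f z)) x0 t0; lra.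
by rewrite -ler_norml; apply: le_trans h; rewrite lerDr addr_ge0.
Qed.

Let cvg_LB w : LB_real alpha (fQ n) w @[n --> \oo] --> LB_real alpha f w.
Proof.
apply: (@Rdominated_cvg _ _ _ _ _ _ (fun z => `|f z|)).
- by move=> n; apply: measurable_funM => //; exact: measurable_phi.
- by move=> z; apply: cvgMl; exact: cvg_fQ.
- exact: integrable_norm intf.
- move=> n z; rewrite normrM -[leRHS]mulr1 ler_pM// ?norm_phi_le1//=.
Qed.

Lemma measurable_LB_real : measurable_fun setT (LB_real alpha f).
Proof.
apply: (@measurable_fun_cvg _ _ _ setT (fun n => LB_real alpha (fQ n))) => //.
  by move=> n; exact: measurable_LB_real_bounded (mfQ n) (fQB n) (@fQs n).
Qed.

Lemma plancherel_L1 :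
  (\int[gamma_alpha alpha]_w (LB_real alpha f w ^+ 2)%:E <= \int[m_alpha alpha]_z (f z ^+ 2)%:E)%E.
Proof.
pose X n w : \bar R := (LB_real alpha (fQ n) w ^+ 2)%:E.
apply: (@fatou_le _ _ _ (gamma_alpha alpha) setT X X) => //.
- move=> n; apply/measurable_EFinP; apply: (measurable_funX 2).
  exact: measurable_LB_real_bounded (mfQ n) (fQB n) (@fQs n).
- by move=> n w _; rewrite lee_fin sqr_ge0.
- by move=> w _; rewrite lee_fin sqr_ge0.
- move=> w _; apply: cvg_EFin; first exact: nearW.
  by apply: cvgM; exact: cvg_LB.
move=> n; apply: le_trans (plancherel_bounded halpha (mfQ n) (fQB n) (@fQs n)) _.
apply: le_integral_ge0 => z _; rewrite lee_fin ?sqr_ge0//.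
by rewrite -[leLHS]real_normK ?num_real// -[leRHS]real_normK ?num_real// lerXn2r ?nnegrE.
Qed.

End plancherel_L1.

Lemma ge0_le_poweR (R : realType) (x y : \bar R) (r : R) : 0 <= r ->
  (0 <= x -> x <= y -> x `^ r <= y `^ r)%E.
Proof.
move=> r0 x0 xy; have y0 := le_trans x0 xy.
by apply: gt0_ler_poweR => //; rewrite in_itv/= leey andbT.
Qed.

(** * Norms of complex-valued functions *)

Section complex_norms.
Context d (T : measurableType d) (R : realType) (mu : {measure set T -> \bar R}).
Variable D : set T.
Hypothesis mD : measurable D.
Implicit Types f g : T -> R[i].
Local Notation normc := ComplexField.Normc.normc.

Lemma normc_ge0 (x : R[i]) : 0 <= normc x.
Proof. by case: x => a b; rewrite sqrtr_ge0. Qed.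

Lemma sqr_normc (x : R[i]) : normc x ^+ 2 = complex.Re x ^+ 2 + complex.Im x ^+ 2.
Proof. by case: x => a b /=; rewrite sqr_sqrtr// addr_ge0 ?sqr_ge0. Qed.

Lemma normRe_le (x : R[i]) : `|complex.Re x| <= normc x.
Proof.
by rewrite -(ler_pXn2r (n := 2))// ?nnegrE ?normc_ge0// sqr_normc real_normK ?num_real// lerDl sqr_ge0.
Qed.

Lemma normIm_le (x : R[i]) : `|complex.Im x| <= normc x.
Proof.
by rewrite -(ler_pXn2r (n := 2))// ?nnegrE ?normc_ge0// sqr_normc real_normK ?num_real// lerDr sqr_ge0.
Qed.

Lemma measurable_normc f : cmeasurable D f -> measurable_fun D (fun x => normc (f x)).
Proof.
move=> [mr mi].
rewrite (_ : (fun x => _) = (fun x => Num.sqrt (complex.Re (f x) ^+ 2 + complex.Im (f x) ^+ 2))).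
  have ms : measurable_fun setT (@Num.sqrt R).
    by apply: continuous_measurable_fun; exact: sqrt_continuous.
  by apply: (measurableT_comp ms); apply: measurable_funD; exact: measurable_funX.
by apply/funext => x; rewrite -sqr_normc sqrtr_sqr ger0_norm ?normc_ge0.
Qed.

Lemma cmeasurableB f g : cmeasurable D f -> cmeasurable D g -> cmeasurable D (fun x => f x - g x).
Proof.
move=> [f1 f2] [g1 g2]; split.
  rewrite (_ : (fun x => _) = (fun x => complex.Re (f x) - complex.Re (g x))); first exact: measurable_funB.
  by apply/funext => x; case: (f x) (g x) => [a b] [c e].
rewrite (_ : (fun x => _) = (fun x => complex.Im (f x) - complex.Im (g x))); first exact: measurable_funB.
by apply/funext => x; case: (f x) (g x) => [a b] [c e].
Qed.

Let cnorm f x : R := normc (f x) * \1_D x.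

Let cnormE f : (fun x => (normc (f x))%:E) \_ D = EFin \o cnorm f.
Proof.
by apply/funext => x; rewrite patchE /cnorm /= indicE; case: ifP => /= _; rewrite ?mulr1 ?mulr0.
Qed.

Lemma cLnorm2E f : cLnorm mu D 2%:E f = ((\int[mu]_(x in D) (normc (f x) ^+ 2)%:E) `^ 2^-1)%E.
Proof.
rewrite /cLnorm unlock; congr (_ `^ _)%E.
rewrite [RHS]integral_mkcond; apply: eq_integral => x _.
rewrite !patchE; case: ifP => _ /=; last by rewrite normr0 powR0.
by rewrite ger0_norm ?normc_ge0// powR_mulrn ?normc_ge0.
Qed.

Lemma cLnorm1E f : cLnorm mu D 1%:E f = (\int[mu]_(x in D) (normc (f x))%:E)%E.
Proof.
rewrite /cLnorm Lnorm1 [RHS]integral_mkcond; apply: eq_integral => x _.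
rewrite patchE; case: ifP => _ /=; last by rewrite normr0.
by rewrite ger0_norm ?normc_ge0.
Qed.

(** Stated for any [h] dominated in modulus, so that the real Minkowski inequality for the moduli
    serves sums, differences and intermediate points alike. *)
Lemma cLnorm_triangle f g h : cmeasurable D f -> cmeasurable D g ->
  (forall x, normc (h x) <= normc (f x) + normc (g x)) ->
  (cLnorm mu D 2%:E h <= cLnorm mu D 2%:E f + cLnorm mu D 2%:E g)%E.
Proof.
move=> mf mg hfg.
have mc u : cmeasurable D u -> measurable_fun setT (cnorm u).
  move=> /measurable_normc mu'; apply/measurable_EFinP; rewrite -cnormE.
  by apply/(measurable_restrictT _ mD)/measurable_EFinP.
have : ('N[mu]_2%:E[EFin \o (cnorm f \+ cnorm g)%R] <= cLnorm mu D 2%:E f + cLnorm mu D 2%:E g)%E.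
  by rewrite /cLnorm !cnormE; apply: minkowski_EFin; rewrite ?ler1n//; exact: mc.
apply: le_trans; rewrite /cLnorm cnormE unlock.
apply: ge0_le_poweR => //; first by rewrite integral_ge0// => x _; exact: poweR_ge0.
apply: le_integral_ge0 => x _; first exact: poweR_ge0.
have c0 u : 0 <= cnorm u x by rewrite mulr_ge0 ?normc_ge0.
rewrite /= lee_fin ge0_ler_powR ?nnegrE ?normr_ge0// !ger0_norm ?addr_ge0//.
by rewrite /cnorm -mulrDl ler_wpM2r.
Qed.

End complex_norms.

(** * The transform of complex-valued functions *)

Section complex_transform.
Context {R : realType}.
Variable alpha : R.
Hypothesis halpha : 0 <= alpha.
Implicit Types f g : R * R -> R[i].
Local Notation normc := ComplexField.Normc.normc.
Local Notation mu := (m_alpha alpha).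
Local Notation gam := (gamma_alpha alpha).

Let re f z : R := complex.Re (f z) * \1_KK z.
Let im f z : R := complex.Im (f z) * \1_KK z.

Let mKK : measurable (KK : set (R * R)) := measurable_KK.
Let mKKh : measurable (KKhat : set (R * nat)) := measurable_KKhat.

Let patch_indic_KK (u : R * R -> R) : EFin \o (fun z => u z * \1_KK z) = (EFin \o u) \_ KK.
Proof.
by apply/funext => z; rewrite patchE /= indicE; case: ifP => /= _; rewrite ?mulr1 ?mulr0.
Qed.

Let integrable_part (u : R[i] -> R) f : measurable_fun KK (fun z => u (f z)) ->
  (forall x, `|u x| <= normc x) -> (cLnorm mu KK 1%:E f < +oo)%E ->
  mu.-integrable setT (EFin \o (fun z => u (f z) * \1_KK z)).
Proof.
move=> mf uN; rewrite cLnorm1E => fin; rewrite patch_indic_KK.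
apply/(integrable_mkcond _ mKK)/integrableP; split; first exact/measurable_EFinP.
by apply: le_lt_trans fin; apply: le_integral_ge0 => z _ //=; rewrite lee_fin uN.
Qed.

Let int_re f : cLp mu KK 1%:E f -> mu.-integrable setT (EFin \o re f).
Proof. by move=> [[h _] fin]; apply: integrable_part => //; exact: normRe_le. Qed.

Let int_im f : cLp mu KK 1%:E f -> mu.-integrable setT (EFin \o im f).
Proof. by move=> [[_ h] fin]; apply: integrable_part => //; exact: normIm_le. Qed.

Let re_supp f z : ~ KK z -> re f z = 0.
Proof. by move=> nz; rewrite /re indicE memNset ?mulr0. Qed.

Let im_supp f z : ~ KK z -> im f z = 0.
Proof. by move=> nz; rewrite /im indicE memNset ?mulr0. Qed.

Let ReM (x : R[i]) (r : R) : complex.Re (x * r%:C)%C = complex.Re x * r.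
Proof. by case: x => a b /=; rewrite mulr0 subr0. Qed.

Let ImM (x : R[i]) (r : R) : complex.Im (x * r%:C)%C = complex.Im x * r.
Proof. by case: x => a b /=; rewrite mulr0 add0r. Qed.

Let F_LB_re f w : KKhat w -> complex.Re (F_LB alpha f w) = LB_real alpha (re f) w.
Proof.
case: w => l m; rewrite /KKhat/= => l0; rewrite /LB_real /= Rintegral_mkcond.
apply: eq_Rintegral => z _; rewrite patchE ReM /re (ger0_norm l0) indicE mulrAC.
by case: ifP => /= _; rewrite ?mulr1 ?mulr0.
Qed.

Let F_LB_im f w : KKhat w -> complex.Im (F_LB alpha f w) = LB_real alpha (im f) w.
Proof.
case: w => l m; rewrite /KKhat/= => l0; rewrite /LB_real /= Rintegral_mkcond.
apply: eq_Rintegral => z _; rewrite patchE ImM /im (ger0_norm l0) indicE mulrAC.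
by case: ifP => /= _; rewrite ?mulr1 ?mulr0.
Qed.

Lemma cmeasurable_F_LB f : cLp mu KK 1%:E f -> cmeasurable KKhat (F_LB alpha f).
Proof.
move=> hf; split.
  apply: (eq_measurable_fun (LB_real alpha (re f))).
    by move=> w; rewrite inE => Kw; rewrite F_LB_re.
  by apply: measurable_funTS; exact: measurable_LB_real halpha (int_re hf) (@re_supp f).
apply: (eq_measurable_fun (LB_real alpha (im f))).
  by move=> w; rewrite inE => Kw; rewrite F_LB_im.
by apply: measurable_funTS; exact: measurable_LB_real halpha (int_im hf) (@im_supp f).
Qed.

(** The kernel is real, so real and imaginary parts are transformed separately and their squared
    norms add up. *)
Lemma plancherel_le f : cLp mu KK 1%:E f ->
  (cLnorm gam KKhat 2%:E (F_LB alpha f) <= cLnorm mu KK 2%:E f)%E.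
Proof.
move=> hf; rewrite !cLnorm2E; apply: ge0_le_poweR => //.
  by rewrite integral_ge0// => x _; rewrite lee_fin sqr_ge0.
have mr := measurable_LB_real halpha (int_re hf) (@re_supp f).
have mi := measurable_LB_real halpha (int_im hf) (@im_supp f).
have mre : measurable_fun setT (re f) by apply/measurable_EFinP; exact: measurable_int (int_re hf).
have mim : measurable_fun setT (im f) by apply/measurable_EFinP; exact: measurable_int (int_im hf).
have sq d (T : measurableType d) (u : T -> R) : measurable_fun setT u -> measurable_fun setT (fun x => (u x ^+ 2)%:E).
  by move=> mu'; apply/measurable_EFinP; exact: measurable_funX.
apply: (@le_trans _ _ (\int[gam]_w ((LB_real alpha (re f) w ^+ 2)%:E + (LB_real alpha (im f) w ^+ 2)%:E))%E).
  rewrite integral_mkcond; apply: le_integral_ge0 => w _.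
    by apply: erestrict_ge0 => x _; rewrite lee_fin sqr_ge0.
  rewrite patchE; case: ifP => [|_]; last by rewrite adde_ge0 ?lee_fin ?sqr_ge0.
  by rewrite inE => Kw; rewrite sqr_normc F_LB_re// F_LB_im.
rewrite ge0_integralD//; last 4 first.
- by move=> w _; rewrite lee_fin sqr_ge0.
- exact: sq.
- by move=> w _; rewrite lee_fin sqr_ge0.
- exact: sq.
apply: le_trans (leeD (plancherel_L1 halpha (int_re hf) (@re_supp f)) (plancherel_L1 halpha (int_im hf) (@im_supp f))) _.
rewrite -ge0_integralD//; last 4 first.
- by move=> w _; rewrite lee_fin sqr_ge0.
- exact: sq.
- by move=> w _; rewrite lee_fin sqr_ge0.
- exact: sq.
rewrite [leRHS]integral_mkcond; apply: le_integral_ge0 => z _; first by rewrite adde_ge0 ?lee_fin ?sqr_ge0.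
rewrite patchE /re /im indicE sqr_normc; case: (z \in KK) => /=.
  by rewrite !mulr1.
by rewrite !mulr0 expr0n/= adde0.
Qed.

Lemma F_LBB f g w : cLp mu KK 1%:E f -> cLp mu KK 1%:E g -> KKhat w ->
  F_LB alpha (fun z => f z - g z) w = F_LB alpha f w - F_LB alpha g w.
Proof.
move=> hf hg Kw.
have LBB u v : mu.-integrable setT (EFin \o u) -> mu.-integrable setT (EFin \o v) ->
    LB_real alpha (fun z => u z - v z) w = LB_real alpha u w - LB_real alpha v w.
  move=> hu hv.
  have ip h : mu.-integrable setT (EFin \o h) ->
      mu.-integrable setT (EFin \o (fun z => h z * phi alpha (`|w.1|, w.2) z)).
    move=> hh; have /measurable_EFinP mh := measurable_int _ hh.
    apply: le_integrable hh => //.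
      by apply/measurable_EFinP; apply: measurable_funM => //; exact: measurable_phi.
    by move=> z _ /=; rewrite lee_fin normrM -[leRHS]mulr1 ler_pM// norm_phi_le1/=.
  rewrite /LB_real -(RintegralB measurableT (ip _ hu) (ip _ hv)).
  by apply: eq_Rintegral => z _; rewrite mulrBl.
have eR : complex.Re (F_LB alpha (fun z => f z - g z) w) = complex.Re (F_LB alpha f w) - complex.Re (F_LB alpha g w).
  rewrite !F_LB_re// -LBB; [|exact: int_re..].
  by congr (LB_real _ _ _); apply/funext => z; rewrite /re -mulrBl; case: (f z) (g z) => [a b] [c e].
have eI : complex.Im (F_LB alpha (fun z => f z - g z) w) = complex.Im (F_LB alpha f w) - complex.Im (F_LB alpha g w).
  rewrite !F_LB_im// -LBB; [|exact: int_im..].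
  by congr (LB_real _ _ _); apply/funext => z; rewrite /im -mulrBl; case: (f z) (g z) => [a b] [c e].
move: eR eI; case: (F_LB alpha (fun z => f z - g z) w) (F_LB alpha f w) (F_LB alpha g w) => a b [c e] [p q] /=.
by move=> -> ->.
Qed.

(** Multiplying by the modulus [N] makes the left side [X ^ 2 + Y ^ 2], one real integral of
    [X * Re f + Y * Im f] against the kernel. Pointwise Cauchy-Schwarz in the plane, in the form of
    Lagrange's identity, bounds the integrand by [N * |f|]. *)
Lemma normc_F_LB_le f w : cLp mu KK 1%:E f -> KKhat w ->
  ((normc (F_LB alpha f w))%:E <= cLnorm mu KK 1%:E f)%E.
Proof.
move=> hf Kw; have [mf fin] := hf.
set N := normc _; have N0 : 0 <= N by exact: normc_ge0.
have [->|Nn0] := eqVneq N 0; first by rewrite cLnorm1E integral_ge0// => z _; rewrite lee_fin normc_ge0.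
have Npos : 0 < N by rewrite lt_def Nn0.
pose X := complex.Re (F_LB alpha f w); pose Y := complex.Im (F_LB alpha f w).
pose p z := phi alpha (`|w.1|, w.2) z.
have ip h : mu.-integrable setT (EFin \o h) -> mu.-integrable setT (EFin \o (fun z => h z * p z)).
  move=> hh; have /measurable_EFinP mh := measurable_int _ hh.
  apply: le_integrable hh => //.
    by apply/measurable_EFinP; apply: measurable_funM => //; exact: measurable_phi.
  by move=> z _ /=; rewrite lee_fin normrM -[leRHS]mulr1 ler_pM// norm_phi_le1/=.
have ir := ip _ (int_re hf); have ii := ip _ (int_im hf).
have iN : mu.-integrable setT (EFin \o (fun z => normc (f z) * \1_KK z)).
  by apply: integrable_part => //; [exact: measurable_normc|move=> x; rewrite ger0_norm ?normc_ge0].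
have -> : cLnorm mu KK 1%:E f = (\int[mu]_z (normc (f z) * \1_KK z))%:E.
  rewrite cLnorm1E /Rintegral fineK; last exact: integrable_fin_num.
  by rewrite integral_mkcond -patch_indic_KK.
rewrite lee_fin -(ler_pM2l Npos) -expr2 sqr_normc -/X -/Y.
have -> : X ^+ 2 + Y ^+ 2 = \int[mu]_z (X * (re f z * p z) + Y * (im f z * p z)).
  have iX := integrableZl measurableT X ir; have iY := integrableZl measurableT Y ii.
  rewrite (RintegralD measurableT iX iY).
  rewrite (@RintegralZl _ _ _ mu setT _ X measurableT ir) (@RintegralZl _ _ _ mu setT _ Y measurableT ii).
  by rewrite /X /Y F_LB_re// F_LB_im.
rewrite -(@RintegralZl _ _ _ mu setT _ N measurableT iN).
apply: le_Rintegral => //.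
- by apply: (integrableD measurableT (integrableZl measurableT X ir) (integrableZl measurableT Y ii)).
- exact: (integrableZl measurableT N iN).
move=> z _.
have := @norm_phi_le1 _ _ halpha (`|w.1|, w.2) z (normr_ge0 _); rewrite -/(p z) /re /im.
rewrite indicE; case: (z \in KK) => /= hp; rewrite ?mulr1 ?mulr0 ?mul0r ?mulr0 ?addr0//.
set a := complex.Re (f z); set b := complex.Im (f z).
rewrite -[X in X <= _]/(_ + _) mulrA mulrA -mulrDl (le_trans (ler_norm _))// normrM.
rewrite -[leRHS]mulr1 ler_pM//.
rewrite -(ler_pXn2r (n := 2))// ?nnegrE ?mulr_ge0 ?normc_ge0//.
rewrite real_normK ?num_real// exprMn !sqr_normc -/X -/Y -/a -/b.
by rewrite -subr_ge0 (_ : _ - _ = (X * b - Y * a) ^+ 2) ?sqr_ge0//; ring.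
Qed.

End complex_transform.

(** * Integral of a power of the homogeneous norm over a ball *)

Section scaling.
Context {R : realType}.
Local Notation leb := (@lebesgue_measure R).
Variable c : R.
Hypothesis c0 : 0 < c.

Let scale : measurableTypeR R -> measurableTypeR R := fun x => c * x.

Let mscale_fun : measurable_fun setT scale.
Proof. exact: measurable_funM. Qed.


Lemma lebesgue_measure_scale (A : set (measurableTypeR R)) : measurable A ->
  (leb A = c%:E * leb (scale @^-1` A))%E.
Proof.
move=> mA.
have c1 : 0 <= c by exact: ltW.
rewrite (@lebesgue_measure_unique _ (mscale (NngNum c1) (pushforward leb scale)))//.
move=> _ [[a b] _ <-] /=; rewrite /mscale/= /pushforward.
rewrite (_ : scale @^-1` _ = `]a / c, b / c]%classic); last first.
  by apply/seteqP; split => x /=; rewrite !in_itv/= /scale (mulrC c x) ltr_pdivrMr// ler_pdivlMr.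
rewrite !lebesgue_measure_itv/= !lte_fin ltr_pM2r ?invr_gt0//.
case: ifP => _; last by rewrite mule0.
by rewrite -!EFinD -EFinM; congr EFin; field; rewrite gt_eqF.
Qed.

Lemma ge0_integral_scale (f : R -> \bar R) : measurable_fun setT f -> (forall x, 0 <= f x)%E ->
  (\int[leb]_x f x = \int[leb]_x (f (c * x)%R * c%:E))%E.
Proof.
move=> mf f0.
apply: (@ge0_integral_density _ _ _ _ _ leb leb scale (fun=> c)) => //; first by move=> x; exact: ltW.
move=> A mA; rewrite integral_cst//; first exact: lebesgue_measure_scale.
by rewrite -[X in measurable X]setTI; exact: mscale_fun.
Qed.

Lemma ge0_integral_mpow_scale k p (f : R -> \bar R) : measurable_fun setT f -> (forall x, 0 <= f x)%E ->
  (\int[mpow k p]_x f x = (c `^ (p + 1))%:E * \int[mpow k p]_x f (c * x)%R)%E.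
Proof.
move=> mf f0.
have mfc : measurable_fun setT (fun x : R => f (c * x)) by apply: (measurableT_comp mf); exact: measurable_funM.
have mw : measurable_fun setT (fun x => (wpow k p x)%:E) by apply/measurable_EFinP; exact: measurable_wpow.
rewrite ge0_integral_mpow// ge0_integral_scale; last 2 first.
- exact: emeasurable_funM.
- by move=> x; rewrite mule_ge0// lee_fin wpow_ge0.
rewrite ge0_integral_mpow// -ge0_integralZl//.
- apply: eq_integral => x _; rewrite -muleA [RHS]muleCA; congr (_ * _)%E.
  rewrite -!EFinM; congr EFin; rewrite /wpow !indicE.
  have -> : (c * x \in (`[0, +oo[%classic : set R)) = (x \in (`[0, +oo[%classic : set R)).
    by apply/idP/idP; rewrite !inE/= !in_itv/= !andbT pmulr_rge0.
  case: (boolP (x \in _)) => /= [|_]; last by rewrite !mulr0 mul0r.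
  rewrite inE/= in_itv/= andbT => x0; rewrite powRM ?(ltW c0)// powRD_gt0// powRr1 ?(ltW c0)//.
  ring.
- exact: emeasurable_funM.
- by move=> x _; rewrite mule_ge0// lee_fin wpow_ge0.
- by rewrite lee_fin powR_ge0.
Qed.

End scaling.

Section ball_integral.
Context {R : realType}.
Local Notation leb := (@lebesgue_measure R).
Local Notation pos := (`]0, +oo[%classic : set R).

Lemma integral_powR_le (q r : R) : 0 < q -> 0 < r ->
  (\int[leb]_(y in `]0%R, r]) (y `^ (q - 1))%:E <= (r `^ q / q)%:E)%E.
Proof.
move=> q0 r0; pose F n : set R := `[r / n.+1%:R, r]%classic.
have FU : \bigcup_n F n = `]0, r]%classic.
  apply/seteqP; split => x /=.
    move=> [n _]; rewrite /F/= !in_itv/= => /andP[nx ->]; rewrite andbT.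
    by apply: lt_le_trans nx; rewrite divr_gt0.
  rewrite in_itv/= => /andP[x0 xr]; exists (Num.truncn (r / x)) => //.
  rewrite /F/= in_itv/= xr andbT ler_pdivrMr// mulrC -ler_pdivrMr//.
  by apply/ltW/truncnS_gt.
have nF : nondecreasing_seq F.
  move=> m n mn; apply/subsetPset => x; rewrite /F/= !in_itv/= => /andP[mx ->].
  by rewrite andbT (le_trans _ mx)// ler_wpM2l ?(ltW r0)// lef_pV2 ?posrE// ler_nat.
have mp : measurable_fun setT (fun y : R => (y `^ (q - 1))%:E).
  by apply/measurable_EFinP; exact: measurable_powR.
have h : (\int[leb]_(y in F n) (y `^ (q - 1))%:E)%E @[n --> \oo] -->
    (\int[leb]_(y in \bigcup_n F n) (y `^ (q - 1))%:E)%E.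
  apply: ge0_nondecreasing_set_cvg_integral => //.
  - by move=> n; exact: measurable_itv.
  - by move=> n; exact: measurable_funTS.
  - by move=> n y _; rewrite lee_fin powR_ge0.
rewrite -FU -(cvg_lim _ h)//; apply: lime_le; first by apply/cvg_ex; eexists; exact: h.
apply: nearW => n.
have rn0 : 0 < r / n.+1%:R by rewrite divr_gt0.
have rn : r / n.+1%:R <= r by rewrite ler_pdivrMr// ler_peMr ?(ltW r0)// ler1n.
have dF (x : R) : 0 < x -> is_derive x 1 (fun y : R => y `^ q / q) (x `^ (q - 1)).
  move=> x0; have d := is_derive_powR q x0.
  apply: is_derive_eq; rewrite /GRing.scale/=; field.
  by rewrite gt_eqF.
rewrite (FTC_pos rn0 rn dF) => [|x x0]; last exact: continuous_powR.
by rewrite lee_fin lerBlDr lerDl divr_ge0 ?powR_ge0// ltW.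
Qed.

Lemma integral_powRN_le (q : R) : 0 < q ->
  (\int[leb]_(y in `[1%R, +oo[) (y `^ (- q - 1))%:E <= q^-1%:E)%E.
Proof.
move=> q0; pose F n : set R := `[1, n.+1%:R]%classic.
have FU : \bigcup_n F n = `[1, +oo[%classic.
  apply/seteqP; split => x /=; first by move=> [n _]; rewrite /F/= !in_itv/= => /andP[-> _].
  rewrite in_itv/= andbT => x1; exists (Num.truncn x) => //.
  by rewrite /F/= in_itv/= x1/=; apply/ltW/truncnS_gt.
have nF : nondecreasing_seq F.
  move=> m n mn; apply/subsetPset => x; rewrite /F/= !in_itv/= => /andP[-> xm].
  by rewrite (le_trans xm)// ler_nat.
have mp : measurable_fun setT (fun y : R => (y `^ (- q - 1))%:E).
  by apply/measurable_EFinP; exact: measurable_powR.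
have h : (\int[leb]_(y in F n) (y `^ (- q - 1))%:E)%E @[n --> \oo] -->
    (\int[leb]_(y in \bigcup_n F n) (y `^ (- q - 1))%:E)%E.
  apply: ge0_nondecreasing_set_cvg_integral => //.
  - by move=> n; exact: measurable_itv.
  - by move=> n; exact: measurable_funTS.
  - by move=> n y _; rewrite lee_fin powR_ge0.
rewrite -FU -(cvg_lim _ h)//; apply: lime_le; first by apply/cvg_ex; eexists; exact: h.
apply: nearW => n.
have n1 : 1 <= n.+1%:R :> R by rewrite ler1n.
have dF (x : R) : 0 < x -> is_derive x 1 (fun y : R => - (y `^ (- q) / q)) (x `^ (- q - 1)).
  move=> x0; have d := is_derive_powR (- q) x0.
  apply: is_derive_eq; rewrite /GRing.scale/=; field.
  by rewrite gt_eqF.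
rewrite (FTC_pos ltr01 n1 dF) => [|x x0]; last exact: continuous_powR.
by rewrite lee_fin opprK powR1 mul1r gerDr oppr_le0 divr_ge0 ?powR_ge0// ltW.
Qed.

(** Compared with [u ^ (2 b - 1)] below 1 and with [u ^ (- 2 a - 1)] above 1. Finiteness on this
    side is what allows [EFin_Beta] to remove [fine] from [Beta]. *)
Lemma integral_Beta_half_lty (a b : R) : 0 < a -> 0 < b ->
  (\int[leb]_(u in pos) (u `^ (2 * b - 1) * (1 + u ^+ 2) `^ (- (a + b)))%:E < +oo)%E.
Proof.
move=> a0 b0.
have a2 : 0 < 2 * a by rewrite mulr_gt0.
have b2 : 0 < 2 * b by rewrite mulr_gt0.
have u1 (u : R) : 1 <= 1 + u ^+ 2 by rewrite lerDl sqr_ge0.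
have ab : - (a + b) <= 0 by rewrite oppr_le0 addr_ge0 ?ltW.
have g0 (u : R) : (0 <= (u `^ (2 * b - 1) * (1 + u ^+ 2) `^ (- (a + b)))%:E)%E.
  by rewrite lee_fin mulr_ge0 ?powR_ge0.
have mg : measurable_fun setT (fun u : R => (u `^ (2 * b - 1) * (1 + u ^+ 2) `^ (- (a + b)))%:E).
  apply/measurable_EFinP; apply: measurable_funM; first exact: measurable_powR.
  by apply: (measurableT_comp (measurable_powR _)); apply: measurable_funD => //; exact: measurable_funX.
have -> : pos = `]0, 1]%classic `|` `]1, +oo[%classic.
  apply/seteqP; split => x /=; rewrite !in_itv/= !andbT.
    by move=> x0; case: (leP x 1) => x1; [left; rewrite x0|right].
  by case=> [/andP[]//|]; exact: lt_trans.
rewrite ge0_integral_setU//; last 2 first.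
- exact: measurable_funTS.
- apply/disj_setPS => x [/=]; rewrite !in_itv/= andbT => /andP[_ x1] /(le_lt_trans x1).
  by rewrite ltxx.
apply: lte_add_pinfty.
  apply: (@le_lt_trans _ _ (1 `^ (2 * b) / (2 * b))%:E); last exact: ltry.
  apply: le_trans (integral_powR_le b2 ltr01).
  apply: le_integral_ge0 => [x _|x /=]; first exact: g0.
  rewrite in_itv/= => /andP[x0 x1]; rewrite lee_fin ler_piMr ?powR_ge0//.
  by rewrite -[leRHS](powRr0 (1 + x ^+ 2)) ler_powR.
apply: (@le_lt_trans _ _ (2 * a)^-1%:E); last exact: ltry.
apply: le_trans (integral_powRN_le a2).
apply: (@le_trans _ _ (\int[leb]_(u in `]1%R, +oo[) (u `^ (- (2 * a) - 1))%:E)%E).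
  apply: le_integral_ge0 => [x _|x /=]; first exact: g0.
  rewrite in_itv/= andbT => x1; have x0 : 0 < x by exact: lt_trans x1.
  rewrite lee_fin (_ : - (2 * a) - 1 = 2 * b - 1 + 2 * (- (a + b))); last by ring.
  rewrite (@powRD_gt0 _ x (2 * b - 1) (2 * - (a + b)) x0) ler_wpM2l ?powR_ge0//.
  rewrite powRrM powR_mulrn ?(ltW x0)// !powRN.
  have p1 : 0 < (1 + x ^+ 2) `^ (a + b) by rewrite powR_gt0// (lt_le_trans ltr01).
  rewrite lef_pV2 ?posrE ?p1 ?powR_gt0 ?exprn_gt0//.
  rewrite ge0_ler_powR ?nnegrE ?sqr_ge0 ?lerDr//; first by rewrite addr_ge0 ?ltW.
  by rewrite (le_trans ler01).
apply: ge0_subset_integral => //.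
- by apply: measurable_funTS; apply/measurable_EFinP; exact: measurable_powR.
- by move=> x _; rewrite lee_fin powR_ge0.
- by move=> x /=; rewrite !in_itv/= !andbT; exact: ltW.
Qed.

(** With [p = 1 / (1 + u ^ 2)] one has [1 - p = u ^ 2 * p] and [|dp| = 2 u p ^ 2 du], whence the
    factor 1/2. *)
Lemma integral_Beta_half (a b : R) : 0 < a -> 0 < b ->
  (\int[leb]_(u in pos) (u `^ (2 * b - 1) * (1 + u ^+ 2) `^ (- (a + b)))%:E =
   2^-1%:E * \int[leb]_(p in `]0%R, 1%R[) (p `^ (a - 1) * (1 - p) `^ (b - 1))%:E)%E.
Proof.
move=> a0 b0.
pose F (u : R) := (1 + u * u)^-1; pose f (u : R) := - (2 * u * (F u * F u)).
have u1 (u : R) : 0 < 1 + u * u by rewrite ltr_pwDl// -expr2 sqr_ge0.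
have dF (u : R) : is_derive u 1 F (f u).
  have d : is_derive u 1 (fun u : R => 1 + u * u) (2 * u).
    by apply: is_derive_eq; rewrite /GRing.scale/=; ring.
  have := @is_deriveV _ (fun u : R => 1 + u * u) u (2 * u) 1 (lt0r_neq0 (u1 u)) d.
  by congr (is_derive _ _ _ _); rewrite /GRing.scale/= /f /F expr2 invfM; ring.
have cF (u : R) : {for u, continuous F}.
  by apply: differentiable_continuous; apply/derivable1_diffP; have [] := dF u.
have cf (u : R) : 0 < u -> {for u, continuous f}.
  move=> _; apply: cvgN; apply: cvgM; last by apply: cvgM; exact: cF.
  by apply: cvgM; [exact: cvg_cst|exact: cvg_id].
have imF : `]0, 1[%classic = F @` pos.
  apply/seteqP; split => [p|_ [u + <-]] /=; rewrite !in_itv/=.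
    move=> /andP[p0 p1]; exists (Num.sqrt (p^-1 - 1)).
      by rewrite /= in_itv/= andbT sqrtr_gt0 subr_gt0 invf_gt1.
    by rewrite /F -expr2 sqr_sqrtr ?subr_ge0 ?invf_ge1 ?ltW// addrC subrK invrK.
  by rewrite in_itv/= andbT => u0; rewrite invr_gt0 u1/= invf_lt1// ltrDl mulr_gt0.
pose G p := p `^ (a - 1) * (1 - p) `^ (b - 1).
have cG (p : R) : `]0, 1[%classic p -> {for p, continuous G}.
  rewrite /= in_itv/= => /andP[p0 p1]; apply: cvgM; first exact: continuous_powR.
  apply: (@continuous_comp _ _ _ (fun p : R => 1 - p) (fun x => x `^ (b - 1))).
    by apply: cvgB; [exact: cvg_cst|exact: cvg_id].
  by apply: continuous_powR; rewrite subr_gt0.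
have G0 (p : R) : `]0, 1[%classic p -> 0 <= G p by move=> _; rewrite mulr_ge0 ?powR_ge0.
have f0 (u : R) : 0 < u -> f u <= 0.
  by move=> u0; rewrite oppr_le0 mulr_ge0 ?mulr_ge0 ?(ltW u0)// invr_ge0 ltW.
have decrF (u v : R) : 0 < u -> u < v -> F v < F u.
  by move=> u0 uv; rewrite ltf_pV2 ?posrE// ltrD2l -!expr2 ltrXn2r ?nnegrE ?(ltW u0) ?(ltW (lt_trans u0 uv)).
rewrite -[X in (_ * X)%E]/(\int[leb]_(p in _) (G p)%:E)%E.
rewrite (ge0_substitution_decr (fun u _ => dF u) cf imF cG G0 f0 decrF) -ge0_integralZl//.
- apply: eq_integral => u; rewrite inE/= in_itv/= andbT => u0; rewrite -EFinM; congr EFin.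
  have v0 := u1 u; have w0 : 0 < F u by rewrite invr_gt0.
  have e : 1 - F u = u ^+ 2 * F u by rewrite /F; field; rewrite gt_eqF.
  rewrite /G e powRM ?sqr_ge0 ?(ltW w0)// (_ : 2 * b - 1 = 2 * (b - 1) + 1); last by ring.
  rewrite (powRD_gt0 _ _ u0) powRrM powR_mulrn ?(ltW u0)// powRr1 ?(ltW u0)//.
  have -> : (1 + u ^+ 2) `^ (- (a + b)) = F u `^ (a - 1) * F u `^ (b - 1) * (F u * F u).
    have FF : F u * F u = F u `^ 2 by rewrite powR_mulrn ?(ltW w0)// expr2.
    have Fv : F u = (1 + u ^+ 2) `^ (- 1) by rewrite expr2 powR_inv1// ltW.
    by rewrite FF -!(powRD_gt0 _ _ w0) Fv -powRrM; congr (_ `^ _); ring.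
  by rewrite /f; field.
- apply/measurable_EFinP; apply: continuous_pos_measurable => u u0.
  apply: continuousM; last by apply: continuousN; exact: cf.
  apply: continuous_comp; first exact: cF.
  by apply: cG; rewrite imF; exists u => //=; rewrite in_itv/= andbT.
- move=> u; rewrite /= in_itv/= andbT => u0; rewrite lee_fin mulr_ge0 ?oppr_ge0 ?f0//.
  by rewrite mulr_ge0 ?powR_ge0.
Qed.


Lemma EFin_Beta (a b : R) : 0 < a -> 0 < b -> (Beta a b)%:E =
  (\int[leb]_(p in `]0%R, 1%R[) (p `^ (a - 1) * (1 - p) `^ (b - 1))%:E)%E.
Proof.
move=> a0 b0; rewrite /Beta /Rintegral fineK// ge0_fin_numE; last first.
  by apply: integral_ge0 => p _; rewrite lee_fin mulr_ge0 ?powR_ge0.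
rewrite ltey; apply/eqP => Iy; have := integral_Beta_half_lty a0 b0.
by rewrite integral_Beta_half// Iy gt0_muley ?lte_fin ?invr_gt0.
Qed.

Lemma Beta_gt0 (a b : R) : 0 < a -> 0 < b -> 0 < Beta a b.
Proof.
move=> a0 b0; pose c : R := 4^-1 `^ a * 2^-1 `^ b.
have c0 : 0 < c by rewrite mulr_gt0 ?powR_gt0 ?invr_gt0.
have S : `[4^-1, 2^-1] `<=` (`]0, 1[%classic : set R).
  by move=> p; rewrite /= !in_itv/= => /andP[p1 p2]; apply/andP; split; lra.
rewrite -lte_fin EFin_Beta//.
apply: (@lt_le_trans _ _ (\int[leb]_(p in `[(4^-1)%R, (2^-1)%R]) c%:E)%E).
  rewrite integral_cst//= lebesgue_measure_itv/= lte_fin.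
  rewrite (_ : (4^-1 < 2^-1 :> R) = true) ?mule_gt0 ?lte_fin//; last by lra.
  by lra.
apply: (@le_trans _ _ (\int[leb]_(p in `[(4^-1)%R, (2^-1)%R]) (p `^ (a - 1) * (1 - p) `^ (b - 1))%:E)%E).
  apply: le_integral_ge0 => p /=; first by rewrite lee_fin ltW.
  rewrite in_itv/= => /andP[p1 p2]; have p0 : 0 < p by lra.
  have q0 : 0 < 1 - p by lra.
  (* [y ^ (t - 1) = y ^ t / y >= y ^ t >= x ^ t], whatever the sign of [t - 1]. *)
  have lowp (x y t : R) : 0 < x -> x <= y -> y <= 1 -> 0 < t -> x `^ t <= y `^ (t - 1).
    move=> x0 xy y1 t0; have y0 : 0 < y by exact: lt_le_trans xy.
    rewrite powRB_gt0// powRr1 ?(ltW y0)// ler_pdivlMr//.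
    apply: (@le_trans _ _ (x `^ t)); first by rewrite ler_piMr ?powR_ge0.
    by rewrite ge0_ler_powR ?nnegrE ?(ltW t0) ?(ltW x0) ?(ltW y0).
  by rewrite lee_fin ler_pM ?powR_ge0// lowp ?invr_gt0//; lra.
apply: ge0_subset_integral => //.
- apply/measurable_EFinP/measurable_funTS; apply: measurable_funM; first exact: measurable_powR.
  by apply: (measurableT_comp (measurable_powR _)); exact: measurable_funB.
- by move=> p _; rewrite lee_fin mulr_ge0 ?powR_ge0.
Qed.

Lemma measurable_hnorm : measurable_fun setT (@hnorm R).
Proof.
apply: (measurableT_comp (measurable_powR _)); apply: measurable_funD.
  exact: measurable_funX.
by apply: measurable_funM => //; exact: measurable_funX.
Qed.

Lemma hnorm_parabola (x u : R) : 0 <= x -> hnorm (x, x ^+ 2 / 2 * u) = x * (1 + u ^+ 2) `^ 4^-1.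
Proof.
move=> x0; rewrite /hnorm/= (_ : _ + _ = x ^+ 4 * (1 + u ^+ 2)); last by field.
rewrite powRM ?exprn_ge0 ?addr_ge0 ?sqr_ge0//; congr (_ * _).
by rewrite -powR_mulrn// -powRrM divff ?pnatr_eq0// powRr1.
Qed.

Variables (alpha s : R).
Hypothesis halpha : 0 <= alpha.
Hypothesis hs : s < 3 * alpha + 2.
Local Notation D := (3 * alpha + 2).

Let ball_fun (r y : R) : R := y `^ (- (2 * s)) * \1_(`]-oo, r]%classic) y.

Let ball_fun_ge0 r y : 0 <= ball_fun r y.
Proof. by rewrite mulr_ge0 ?powR_ge0. Qed.

Let mball_fun r : measurable_fun setT (ball_fun r).
Proof.
apply: measurable_funM; first exact: measurable_powR.
by apply: measurable_indic; exact: measurable_itv.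
Qed.

(** In [t = x ^ 2 u / 2] the measure [t ^ (2 alpha) dt] produces [(x ^ 2 / 2) ^ (2 alpha + 1)]; its
    power of [x] raises the exponent [2 alpha + 1] to [2 D - 1], and its power of 2 is absorbed
    here. *)
Let k' : R := m_coef alpha / 2 `^ (2 * alpha + 1).

Let k'_ge0 : 0 <= k'.
Proof. by rewrite divr_ge0 ?m_coef_ge0 ?powR_ge0. Qed.

Let radial r : 0 < r ->
  (\int[mpow k' (2 * D - 1)]_y (ball_fun r y)%:E <= (k' * (r `^ (2 * (D - s)) / (2 * (D - s))))%:E)%E.
Proof.
move=> r0; have q0 : 0 < 2 * (D - s) by rewrite mulr_gt0// subr_gt0.
rewrite ge0_integral_mpow_pos; last 2 first.
- exact/measurable_EFinP.
- by move=> y; rewrite lee_fin.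
apply: (@le_trans _ _ (\int[leb]_(y in `]0%R, r]) (k'%:E * (y `^ (2 * (D - s) - 1))%:E))%E).
  rewrite [leLHS]integral_mkcond [leRHS]integral_mkcond; apply: le_integral_ge0 => y _.
    by apply: erestrict_ge0 => x _; rewrite mule_ge0 ?lee_fin ?mulr_ge0 ?powR_ge0.
  rewrite !patchE; case: ifP => [|_]; last first.
    by case: ifP => // _; rewrite mule_ge0 ?lee_fin ?powR_ge0.
  rewrite inE/= in_itv/= andbT => y0.
  rewrite -EFinM /ball_fun indicE; case: ifP => [yI|/negbT yI]; last first.
    rewrite memNset ?mulr0 ?mul0r// => /= yr.
    by move: yI => /negP; rewrite inE/= in_itv/= y0/=; apply; move: yr; rewrite in_itv.
  rewrite (_ : y \in _) /=; last first.
    by move: yI; rewrite !inE/= !in_itv/= => /andP[].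
  rewrite mulr1 (ger0_norm k'_ge0) -EFinM lee_fin mulrCA ler_wpM2l// -(powRD_gt0 _ _ y0).
  by rewrite le_eqVlt; apply/predU1P; left; congr (_ `^ _); ring.
rewrite ge0_integralZl//.
- by rewrite [leRHS]EFinM; apply: lee_wpmul2l; [rewrite lee_fin|exact: integral_powR_le].
- by apply/measurable_EFinP/measurable_funTS; exact: measurable_powR.
- by move=> y _; rewrite lee_fin powR_ge0.
Qed.

Lemma ball_integral_le r : 0 < r ->
  (\int[m_alpha alpha]_z (hnorm z `^ (- (2 * s)) * \1_(`]-oo, r]%classic) (hnorm z))%:E <=
   (Beta ((alpha + 1) / 2) ((2 * alpha + 1) / 2) / (4 `^ (alpha + 1) * pi * Gamma (alpha + 1))
     * r `^ (2 * (D - s)) / (2 * (D - s)))%:E)%E.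
Proof.
move=> r0.
have mh : measurable_fun setT (fun z : R * R => (ball_fun r (hnorm z))%:E).
  by apply/measurable_EFinP; apply: measurableT_comp => //; exact: measurable_hnorm.
rewrite -[X in (\int[_]_z X z)%E]/(fun z : R * R => (ball_fun r (hnorm z))%:E).
rewrite integral_m_alpha fubini_tonelli1//= /fubini_F/=; last by move=> z; rewrite lee_fin.
pose g (x u : R) : \bar R := (ball_fun r (hnorm (x, x ^+ 2 / 2 * u)))%:E.
have g0 x u : (0 <= g x u)%E by rewrite lee_fin.
have mg : measurable_fun setT (fun z : R * R => g z.1 z.2).
  apply: (measurableT_comp mh); apply: measurable_fun_pair => //.
  by apply: measurable_funM => //; apply: measurable_funM => //; exact: measurable_funX.
have mg1 x : measurable_fun setT (g x) by exact: (measurableT_comp mg (measurable_pair1 x)).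
have mg2 u : measurable_fun setT (g^~ u) by exact: (measurableT_comp mg (measurable_pair2 u)).
have -> : (\int[mx alpha]_x \int[mt alpha]_t (ball_fun r (hnorm (x, t)))%:E =
   \int[mpow k' (2 * D - 1)]_x \int[mt alpha]_u g x u)%E.
  rewrite ge0_integral_mpow_pos; last 2 first.
  - exact: (measurable_parametric_integral (mt alpha) mg).
  - by move=> x; apply: integral_ge0.
  rewrite [LHS]ge0_integral_mpow_pos; last 2 first.
  - exact: (measurable_parametric_integral (mt alpha) mh).
  - by move=> x; apply: integral_ge0 => t _; rewrite lee_fin.
  apply: eq_integral => x; rewrite inE/= in_itv/= andbT => x0.
  have c0 : 0 < x ^+ 2 / 2 by rewrite divr_gt0// exprn_gt0.
  rewrite (ge0_integral_mpow_scale c0); last 2 first.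
  - exact: (measurableT_comp mh (measurable_pair1 x)).
  - by move=> t; rewrite lee_fin.
  rewrite muleAC muleC; congr (_ * _)%E; rewrite -EFinM; congr EFin.
  rewrite (ger0_norm k'_ge0) (ger0_norm (m_coef_ge0 alpha)) /k'.
  have -> : (x ^+ 2 / 2) `^ (2 * alpha + 1) = x `^ (2 * (2 * alpha + 1)) / 2 `^ (2 * alpha + 1).
    by rewrite powRM ?sqr_ge0 ?invr_ge0// powRrM powR_mulrn ?(ltW x0)// -(powR_inv1 (a := 2))// -powRrM mulN1r powRN.
  rewrite (_ : 2 * D - 1 = 2 * (2 * alpha + 1) + (2 * alpha + 1)); last by ring.
  by rewrite [in RHS](powRD_gt0 _ _ x0); ring.
have -> : (\int[mpow k' (2 * D - 1)]_x \int[mt alpha]_u g x u =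
    \int[mt alpha]_u \int[mpow k' (2 * D - 1)]_x g x u)%E.
  exact: (@fubini_tonelli _ _ _ _ _ (mpow k' (2 * D - 1)) (mt alpha) (fun z : R * R => g z.1 z.2) mg (fun z => g0 z.1 z.2)).
pose C := k' * (r `^ (2 * (D - s)) / (2 * (D - s))).
have C0 : 0 <= C by rewrite mulr_ge0// divr_ge0 ?powR_ge0// mulr_ge0// subr_ge0 ltW.
apply: (@le_trans _ _ (\int[mt alpha]_u (C%:E * ((1 + u ^+ 2) `^ (- (D / 2)))%:E))%E).
  apply: le_integral_ge0 => u _; first exact: integral_ge0.
  have v0 : 0 < 1 + u ^+ 2 by rewrite ltr_pwDl// sqr_ge0.
  have c0 : 0 < (1 + u ^+ 2) `^ (- 4^-1) by exact: powR_gt0.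
  (* Dilating [x] by [(1 + u ^ 2) ^ (- 1/4)] makes the homogeneous norm equal to [x], independent of
     [u]; the factor released is part of the Beta integrand. *)
  rewrite (ge0_integral_mpow_scale c0)// muleC.
  have -> : (1 + u ^+ 2) `^ (- 4^-1) `^ (2 * D - 1 + 1) = (1 + u ^+ 2) `^ (- (D / 2)).
    by rewrite -powRrM; congr (_ `^ _); field.
  apply: lee_wpmul2r; first by rewrite lee_fin powR_ge0.
  apply: le_trans (radial r0).
  rewrite ge0_integral_mpow_pos//; last first.
    by apply: (measurableT_comp (mg2 u)); exact: measurable_funM.
  rewrite [leRHS]ge0_integral_mpow_pos; last 2 first.
  - by apply/measurable_EFinP; exact: mball_fun.
  - by move=> y; rewrite lee_fin.
  rewrite le_eqVlt; apply/predU1P; left; apply: eq_integral => x; rewrite inE/= in_itv/= andbT => x0.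
  congr (_ * _)%E; rewrite /g hnorm_parabola ?mulr_ge0 ?powR_ge0 ?(ltW x0)//.
  by rewrite mulrAC -(powRD_gt0 _ _ v0) addNr powRr0 mul1r.
rewrite ge0_integral_mpow_pos; last 2 first.
- apply: emeasurable_funM => //; apply/measurable_EFinP.
  apply: (measurableT_comp (measurable_powR _)); apply: measurable_funD => //; exact: measurable_funX.
- by move=> u; rewrite -EFinM lee_fin mulr_ge0 ?powR_ge0.
(* The Beta parameters solve [2 b - 1 = 2 alpha] and [a + b = D / 2]. *)
have a0 : 0 < (alpha + 1) / 2 by rewrite divr_gt0// ltr_wpDl.
have b0 : 0 < (2 * alpha + 1) / 2 by rewrite divr_gt0// ltr_wpDl// mulr_ge0.
have BE := integral_Beta_half a0 b0.

have BetaE : (\int[leb]_(u in pos) (u `^ (2 * ((2 * alpha + 1) / 2) - 1) * (1 + u ^+ 2) `^ (- ((alpha + 1) / 2 + (2 * alpha + 1) / 2)))%:E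
    = (2^-1 * Beta ((alpha + 1) / 2) ((2 * alpha + 1) / 2))%:E)%E.
  by rewrite EFinM BE EFin_Beta.
apply: (@le_trans _ _ (C%:E * (2^-1 * Beta ((alpha + 1) / 2) ((2 * alpha + 1) / 2))%:E)%E).
  rewrite -BetaE -ge0_integralZl//; last 2 first.
  - apply/measurable_EFinP/measurable_funTS; apply: measurable_funM; first exact: measurable_powR.
    by apply: (measurableT_comp (measurable_powR _)); apply: measurable_funD => //; exact: measurable_funX.
  - by move=> u _; rewrite lee_fin mulr_ge0 ?powR_ge0.
  rewrite le_eqVlt; apply/predU1P; left; apply: eq_integral => u _.
  rewrite -muleA; congr (_ * _)%E; rewrite normr1 mul1r -EFinM mulrC; congr (_ * _)%:E.
    by congr (_ `^ _); field.
  by congr (_ `^ _); field.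
have G0 : 0 < Gamma (alpha + 1) by apply: Gamma_gt0; rewrite ltr_wpDl.
have p0 := pi_gt0 R; have D0 : 0 < D - s by rewrite subr_gt0.
have -> : (4 : R) `^ (alpha + 1) = 2 `^ (2 * alpha + 1) * 2.
  rewrite (_ : 4 = 2 `^ 2) -?powRrM; last by rewrite powR_mulrn// -natrX.
  by rewrite -[X in _ = _ * X]powRr1// -powRD_gt0//; congr (_ `^ _); ring.
have q0 := powR_gt0 (2 * alpha + 1) (ltr0Sn R 1).
rewrite -EFinM lee_fin /C /k' /m_coef le_eqVlt; apply/predU1P; left.
move: G0 p0 D0 q0; move: (Gamma _) (pi : R) (2 `^ _) (Beta _ _) (r `^ _) => G p q B rr G0 p0 D0 q0.
by field; rewrite !gt_eqF.
Qed.

End ball_integral.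

(** * The uncertainty inequality *)

Section complex_norms_more.
Context d (T : measurableType d) (R : realType) (mu : {measure set T -> \bar R}).
Implicit Types (D E : set T) (f g h : T -> R[i]).
Local Notation normc := ComplexField.Normc.normc.

Lemma cLnorm_ge0 D p f : (0 <= cLnorm mu D p f)%E.
Proof. exact: Lnorm_ge0. Qed.

Lemma le_normcB (x y : R[i]) : normc (x - y) <= normc x + normc y.
Proof. by rewrite -(normcN y); exact: le_normcD. Qed.

Lemma le_normcBr (x y z : R[i]) : normc (x - z) <= normc (x - y) + normc (y - z).
Proof.
by rewrite (_ : x - z = (x - y) + (y - z)); [exact: le_normcD|rewrite addrA subrK].
Qed.

Lemma le_cLnorm2 D f g : (forall x, D x -> normc (f x) <= normc (g x)) ->
  (cLnorm mu D 2%:E f <= cLnorm mu D 2%:E g)%E.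
Proof.
move=> fg; rewrite !cLnorm2E; apply: ge0_le_poweR => //.
  by apply: integral_ge0 => x _; rewrite lee_fin sqr_ge0.
apply: le_integral_ge0 => x Dx; first by rewrite lee_fin sqr_ge0.
by rewrite lee_fin lerXn2r ?nnegrE ?normc_ge0// fg.
Qed.

Lemma cLnorm2_subset D E f : measurable D -> measurable E -> cmeasurable D f -> E `<=` D ->
  (cLnorm mu E 2%:E f <= cLnorm mu D 2%:E f)%E.
Proof.
move=> mD mE mf ED; rewrite !cLnorm2E; apply: ge0_le_poweR => //.
  by apply: integral_ge0 => x _; rewrite lee_fin sqr_ge0.
apply: ge0_subset_integral => //; last by move=> x _; rewrite lee_fin sqr_ge0.
by apply/measurable_EFinP; apply: measurable_funX; exact: measurable_normc.
Qed.

Lemma cLnorm2_bounded D f (c : R) : measurable D -> 0 <= c ->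
  (forall x, D x -> normc (f x) <= c) ->
  (cLnorm mu D 2%:E f <= c%:E * mu D `^ 2^-1)%E.
Proof.
move=> mD c0 fc; have cE : c%:E = ((c ^+ 2)%:E `^ 2^-1)%E.
  by rewrite poweR_EFin -powR_mulrn// -powRrM divff ?powRr1.
rewrite cLnorm2E {1}cE -poweRM ?lee_fin ?sqr_ge0// -integral_cst//.
apply: ge0_le_poweR => //; first by apply: integral_ge0 => x _; rewrite lee_fin sqr_ge0.
apply: le_integral_ge0 => x Dx; first by rewrite lee_fin sqr_ge0.
by rewrite lee_fin lerXn2r ?nnegrE ?normc_ge0// fc.
Qed.

Lemma cLp1B D f g : measurable D -> cLp mu D 1%:E f -> cLp mu D 1%:E g ->
  cLp mu D 1%:E (fun x => f x - g x).
Proof.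
move=> mD [mf ff] [mg fg]; split; first exact: cmeasurableB.
move: ff fg; rewrite !cLnorm1E => ff fg.
apply: (@le_lt_trans _ _ (\int[mu]_(x in D) ((normc (f x))%:E + (normc (g x))%:E))%E).
  apply: le_integral_ge0 => x _; first by rewrite lee_fin normc_ge0.
  by rewrite -EFinD lee_fin le_normcB.
rewrite ge0_integralD//; first exact: lte_add_pinfty.
- by move=> x _; rewrite lee_fin normc_ge0.
- by apply/measurable_EFinP; exact: measurable_normc.
- by move=> x _; rewrite lee_fin normc_ge0.
- by apply/measurable_EFinP; exact: measurable_normc.
Qed.

Lemma cmeasurable_subset D E f : measurable D -> E `<=` D -> cmeasurable D f -> cmeasurable E f.
Proof. by move=> mD ED [m1 m2]; split; [exact: measurable_funS m1|exact: measurable_funS m2]. Qed.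

Lemma cLnorm2_trans D f g h : measurable D -> cmeasurable D f -> cmeasurable D g ->
  cmeasurable D h -> (cLnorm mu D 2%:E (fun x => (f x - h x)%R) <=
    cLnorm mu D 2%:E (fun x => (f x - g x)%R) + cLnorm mu D 2%:E (fun x => (g x - h x)%R))%E.
Proof.
move=> mD mf mg mh; apply: cLnorm_triangle; [by []|exact: cmeasurableB..|].
by move=> x; exact: le_normcBr.
Qed.

End complex_norms_more.

(** * Splitting at a radius and transfer to the image in [L^2] *)

Section split.
Context {R : realType}.
Variables (alpha s : R) (f : R * R -> R[i]).
Hypothesis halpha : 0 <= alpha.
Hypothesis hs0 : 0 < s.
Hypothesis hs : s < 3 * alpha + 2.
Hypothesis hf : cLp (m_alpha alpha) KK 2%:E f.
Local Notation normc := ComplexField.Normc.normc.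
Local Notation mu := (m_alpha alpha).
Local Notation gam := (gamma_alpha alpha).
Local Notation D := (3 * alpha + 2).
Local Notation N := (cLnorm (m_alpha alpha) KK 2%:E (fun z => ((hnorm z `^ s)%:C%C * f z)%R)).

Let mKK : measurable (KK : set (R * R)) := measurable_KK.
Let mKKh : measurable (KKhat : set (R * nat)) := measurable_KKhat.

Let normc_real (r : R) : normc r%:C%C = `|r|.
Proof. by rewrite /= expr0n/= addr0 sqrtr_sqr. Qed.

Let ball r : set (R * R) := [set z | hnorm z <= r].

Let mball r : measurable (ball r).
Proof.
rewrite (_ : ball r = @hnorm R @^-1` `]-oo, r]%classic).
  by rewrite -[X in measurable X]setTI; apply: measurable_hnorm => //; exact: measurable_itv.
by apply/seteqP; split => z /=; rewrite in_itv.
Qed.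

Let inner (r : R) z : R[i] := f z * (\1_(ball r) z)%:C%C.

Let normc_inner r z : normc (inner r z) = normc (f z) * \1_(ball r) z.
Proof. by rewrite ComplexField.Normc.normcM normc_real ger0_norm. Qed.

Let mf : cmeasurable KK f := hf.1.

Let cmeasurableM (u : R * R -> R) : measurable_fun setT u -> cmeasurable KK (fun z => f z * (u z)%:C%C).
Proof.
have [m1 m2] := mf; move=> /(@measurable_funTS _ _ _ _ KK) mu'; split.
  rewrite (_ : (fun z => _) = (fun z => complex.Re (f z) * u z)); first exact: measurable_funM.
  by apply/funext => z; case: (f z) => a b /=; rewrite mulr0 subr0.
rewrite (_ : (fun z => _) = (fun z => complex.Im (f z) * u z)); first exact: measurable_funM.
by apply/funext => z; case: (f z) => a b /=; rewrite mulr0 add0r.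
Qed.

Let minner r : cmeasurable KK (inner r).
Proof. by apply: cmeasurableM; exact: measurable_indic. Qed.

Let mhs (p : R) : measurable_fun setT (fun z : R * R => hnorm z `^ p).
Proof. exact: (measurableT_comp (measurable_powR _) measurable_hnorm). Qed.

Let w z : R := hnorm z `^ s * normc (f z).

Let w_ge0 z : 0 <= w z.
Proof. by rewrite mulr_ge0 ?powR_ge0 ?normc_ge0. Qed.

Let mnf : measurable_fun KK (fun z => normc (f z)).
Proof. exact: measurable_normc. Qed.

Let mw : measurable_fun KK w.
Proof. by apply: measurable_funM => //; exact: measurable_funTS. Qed.

Let NE : N = ((\int[mu]_(z in KK) (w z ^+ 2)%:E) `^ 2^-1)%E.
Proof.
rewrite cLnorm2E; congr (_ `^ _)%E; apply: eq_integral => z _.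
by rewrite ComplexField.Normc.normcM normc_real ger0_norm ?powR_ge0.
Qed.

Let W2 : (\int[mu]_(z in KK) (w z ^+ 2)%:E = N `^ 2)%E.
Proof.
rewrite NE -poweRrM mulVf ?pnatr_eq0// poweRe1//.
by apply: integral_ge0 => z _; rewrite lee_fin sqr_ge0.
Qed.

(** At the origin, and only there, the weight [hnorm ^ s] vanishes and cannot be undone by
    [hnorm ^ (- s)]; this lets arguments dividing by the weight hold almost everywhere. *)
Lemma m_alpha_origin : mu [set 0] = 0%E.
Proof.
rewrite /m_alpha (eq_integral (cst 0%E)) ?integral0// => z; rewrite inE => -[-> _].
by rewrite /m_density/= powR0 ?mulr0 ?mul0r// gt_eqF// ltr_wpDl// mulr_ge0.
Qed.

Lemma hnorm_gt0 (z : R * R) : z != 0 -> 0 < hnorm z.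
Proof.
move=> z0; apply: powR_gt0.
have h1 : 0 <= z.1 ^+ 4 by rewrite exprn_even_ge0.
have h2 : 0 <= 4 * z.2 ^+ 2 by rewrite mulr_ge0 ?sqr_ge0.
rewrite lt_neqAle addr_ge0// andbT eq_sym paddr_eq0//; apply/negP => /andP[].
rewrite expf_eq0/= => /eqP z1; rewrite mulf_eq0 pnatr_eq0/= expf_eq0/= => /eqP z2.
move/negP: z0; apply.
by apply/eqP; case: z z1 z2 {h1 h2} => /= a b -> ->.
Qed.

Let outer_le r : 0 < r -> (cLnorm mu KK 2%:E (fun z => (f z - inner r z)%R) <= (r `^ (- s))%:E * N)%E.
Proof.
move=> r0; have rs : (r `^ (- s))%:E = ((r `^ (- s) ^+ 2)%:E `^ 2^-1)%E.
  by rewrite poweR_EFin -powR_mulrn ?powR_ge0// -powRrM divff ?pnatr_eq0// powRr1 ?powR_ge0.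
have I0 : (0 <= \int[mu]_(z in KK) (w z ^+ 2)%:E)%E by apply: integral_ge0 => z _; rewrite lee_fin sqr_ge0.
rewrite cLnorm2E NE {1}rs -poweRM ?lee_fin ?sqr_ge0//.
apply: ge0_le_poweR => //; first by apply: integral_ge0 => x _; rewrite lee_fin sqr_ge0.
rewrite -ge0_integralZl//; last 3 first.
- by apply/measurable_EFinP; exact: measurable_funX.
- by move=> z _; rewrite lee_fin sqr_ge0.
- by rewrite lee_fin sqr_ge0.
apply: le_integral_ge0 => z _; first by rewrite lee_fin sqr_ge0.
suff e : normc (f z - inner r z) <= r `^ (- s) * w z.
  rewrite -EFinM lee_fin -exprMn; apply: lerXn2r => //; rewrite nnegrE ?normc_ge0//.
  by rewrite mulr_ge0 ?powR_ge0.
rewrite /inner indicE; case: (boolP (z \in ball r)) => [_|/negP rz].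
  by rewrite mulr1 subrr ComplexField.Normc.normc0 mulr_ge0 ?powR_ge0.
rewrite mulr0 subr0 /w mulrA ler_peMl ?normc_ge0//.
have hr : r < hnorm z by rewrite ltNge; apply/negP => hz; apply: rz; rewrite inE.
have hz := lt_trans r0 hr.
by rewrite powRN ler_pdivlMl ?powR_gt0// mulr1 ge0_ler_powR ?nnegrE ?(ltW hs0) ?(ltW r0) ?(ltW hz) ?ltW.
Qed.

Let I r : \bar R := (\int[mu]_z (hnorm z `^ (- (2 * s)) * \1_(`]-oo, r]%classic) (hnorm z))%:E)%E.

Let inner_le r : 0 < r -> (cLnorm mu KK 1%:E (inner r) <= (I r) `^ 2^-1 * N)%E.
Proof.
move=> r0.
pose u z : R := hnorm z `^ (- s) * \1_(ball r) z * \1_KK z.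
pose v z : R := w z * \1_KK z.
have mu_ : measurable_fun setT u.
  by apply: measurable_funM; [apply: measurable_funM => //; exact: measurable_indic|exact: measurable_indic].
have mv : measurable_fun setT v.
  apply/measurable_EFinP; rewrite (_ : _ \o _ = (EFin \o w) \_ KK).
    by apply/(measurable_restrictT _ mKK)/measurable_EFinP.
  by apply/funext => z; rewrite patchE /v /= indicE; case: ifP => /= _; rewrite ?mulr1 ?mulr0.
have half : 2^-1 + 2^-1 = 1 :> R by field.
have h := @hoelder _ _ R mu u v 2 2 mu_ mv (ltr0Sn _ _) (ltr0Sn _ _) half.
rewrite Lnorm1 in h.
have nu : (Lnorm mu 2%:E (EFin \o u) <= I r `^ 2^-1)%E.
  rewrite unlock; apply: ge0_le_poweR => //; first by apply: integral_ge0 => z _; exact: poweR_ge0.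
  apply: le_integral_ge0 => z _; first exact: poweR_ge0.
  rewrite /= lee_fin powR_mulrn// real_normK ?num_real// /u !exprMn.
  rewrite -(powR_mulrn 2 (powR_ge0 _ _)) -powRrM (_ : - s * 2 = - (2 * s)); last by ring.
  rewrite -mulrA ler_wpM2l ?powR_ge0// !indicE.
  have -> : (hnorm z \in (`]-oo, r]%classic : set R)) = (z \in ball r).
    by apply/idP/idP; rewrite !inE/= in_itv.
  by case: (z \in ball r); case: (z \in KK) => /=; rewrite ?expr1n ?expr0n/= ?mulr1 ?mul1r ?mulr0 ?mul0r.
have nv : Lnorm mu 2%:E (EFin \o v) = N.
  rewrite NE unlock; congr (_ `^ _)%E; rewrite [RHS]integral_mkcond; apply: eq_integral => z _.
  rewrite patchE /v /= indicE; case: ifP => /= _; last by rewrite mulr0 normr0 powR0.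
  by rewrite mulr1 powR_mulrn// real_normK ?num_real.
rewrite nv in h; apply: (@le_trans _ _ (Lnorm mu 2%:E (EFin \o u) * N)%E); last first.
  by apply: lee_wpmul2r => //; exact: cLnorm_ge0.
apply: le_trans h; rewrite cLnorm1E integral_mkcond.
have m1 : measurable_fun setT ((fun z => (normc (inner r z))%:E) \_ KK).
  apply/(measurable_restrictT _ mKK)/measurable_EFinP; exact: measurable_normc (minner r).
have m2 : measurable_fun setT (fun z => `|(u z * v z)%:E|)%E.
  by apply: measurableT_comp => //; apply/measurable_EFinP; exact: measurable_funM.
rewrite le_eqVlt; apply/predU1P; left; apply: ge0_ae_eq_integral => //.
  by move=> z _; apply: erestrict_ge0 => y _; rewrite lee_fin normc_ge0.
exists [set 0]; split; [|exact: m_alpha_origin|].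
  rewrite (_ : [set 0] = [set 0 : R] `*` [set 0 : R]); first exact: measurableX.
  by apply/seteqP; split => [_ ->//|[x y] [/= -> ->]].
move=> z /= nz; apply: contrapT => z0; apply: nz => _.
have hz : 0 < hnorm z by apply: hnorm_gt0; apply/eqP.
rewrite patchE normc_inner /u /v /w !indicE; case: ifP => _ /=; last by rewrite !mulr0 normr0.
rewrite !mulr1 (_ : _ * _ * _ = normc (f z) * (z \in ball r)%:R).
  by rewrite ger0_norm// mulr_ge0 ?normc_ge0.
rewrite powRN mulrA mulrAC; field.
exact: lt0r_neq0 (powR_gt0 _ hz).
Qed.

Definition ball_const : R :=
  Beta ((alpha + 1) / 2) ((2 * alpha + 1) / 2) / (4 `^ (alpha + 1) * pi * Gamma (alpha + 1)).

Lemma ball_const_gt0 : 0 < ball_const.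
Proof.
rewrite divr_gt0//; last by rewrite !mulr_gt0 ?powR_gt0 ?pi_gt0 ?Gamma_gt0// ltr_wpDl.
by apply: Beta_gt0; rewrite divr_gt0// ltr_wpDl// mulr_ge0.
Qed.

(** The weight vanishes only on a null set. Strictness of the theorem rests on this positivity,
    since the gain in the constant is multiplied by the weighted norm. *)
Lemma weighted_norm_gt0 : ~ {ae mu, forall z, KK z -> f z = 0} -> (0 < N)%E.
Proof.
move=> nz; rewrite lt0e cLnorm_ge0 andbT; apply/eqP => N0; apply: nz.
have W0 : (\int[mu]_(z in KK) `|(w z ^+ 2)%:E| = 0)%E.
  under eq_integral do rewrite gee0_abs ?lee_fin ?sqr_ge0//.
  by rewrite W2 N0 poweR0r.
have mw2 : measurable_fun KK (fun z => (w z ^+ 2)%:E).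
  by apply/measurable_EFinP; exact: measurable_funX.
have [Z [mZ Z0 hZ]] := (ae_eq_integral_abs mu mKK mw2).1 W0.
have m0 : measurable [set 0 : R * R].
  rewrite (_ : [set 0] = [set 0 : R] `*` [set 0 : R]); first exact: measurableX.
  by apply/seteqP; split => [_ ->//|[x y] [/= -> ->]].
exists (Z `|` [set 0]); split; first exact: measurableU.
  by apply: null_set_setU => //; exact: m_alpha_origin.
move=> z /= nfz; apply: contrapT => /not_orP[nZ z0]; apply: nfz => Kz.
have : (w z ^+ 2)%:E = 0%E.
  by apply: contrapT => wz; apply: nZ; apply: hZ => /= h; exact: wz (h Kz).
move=> [/eqP]; rewrite expf_eq0/= mulf_eq0 gt_eqF/=; last first.
  by apply: powR_gt0; apply: hnorm_gt0; apply/eqP.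
by move=> /eqP; exact: ComplexField.Normc.eq0_normc.
Qed.

Let inner_le_ball r : 0 < r ->
  (cLnorm mu KK 1%:E (inner r) <= ((ball_const * r `^ (2 * (D - s)) / (2 * (D - s))) `^ 2^-1)%:E * N)%E.
Proof.
move=> r0; apply: le_trans (inner_le r0) _; apply: lee_wpmul2r; first exact: cLnorm_ge0.
rewrite -poweR_EFin; apply: ge0_le_poweR => //; last exact: ball_integral_le.
by apply: integral_ge0 => z _; rewrite lee_fin mulr_ge0 ?powR_ge0.
Qed.

Variables (g : R * nat -> R[i]) (E : set (R * nat)).
Hypothesis hg : is_F_LB2 alpha f g.
Hypothesis hE : E `<=` KKhat.
Hypothesis mE : measurable E.
Hypothesis Nfin : (N < +oo)%E.

Let inner_L1 r : 0 < r -> cLp mu KK 1%:E (inner r).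
Proof.
move=> r0; split; first exact: minner.
by apply: le_lt_trans (inner_le_ball r0) _; rewrite lte_mul_pinfty ?lee_fin ?powR_ge0.
Qed.

(** [plancherel_le] applies to integrable functions, and the outer part of [f] is only square
    integrable. It is therefore applied to [f_ n] minus the inner part, at distance at most [c n]
    plus the outer norm; the errors [a n] and [c n] then tend to 0. *)
Lemma transform_bound r : 0 < r ->
  (cLnorm gam E 2%:E g <=
    ((ball_const * r `^ (2 * (D - s)) / (2 * (D - s))) `^ 2^-1)%:E * N * gam E `^ 2^-1 + (r `^ (- s))%:E * N)%E.
Proof.
move=> r0; have [[mg gfin] [f_ [fL cvf cvg]]] := hg.
pose C := (((ball_const * r `^ (2 * (D - s)) / (2 * (D - s))) `^ 2^-1)%:E * N * gam E `^ 2^-1 + (r `^ (- s))%:E * N)%E.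
pose a n := cLnorm gam KKhat 2%:E (fun x => (F_LB alpha (f_ n) x - g x)%R).
pose c n := cLnorm mu KK 2%:E (fun z => (f_ n z - f z)%R).
have key n : (cLnorm gam E 2%:E g <= a n + (c n + C))%E.
  have f1 := (fL n).1; have [mf_ _] := f1.
  have hi := inner_L1 r0.
  have mFn := cmeasurable_F_LB halpha f1; have mFi := cmeasurable_F_LB halpha hi.
  have mz : cmeasurable KKhat (fun=> 0 : R[i]) by split; exact: measurable_cst.
  have sub u : cmeasurable KKhat u -> cmeasurable E u by exact: cmeasurable_subset.
  have normcC (x y : R[i]) : normc (x - y) = normc (y - x) by rewrite -normcN opprB.
  have g1 : (cLnorm gam E 2%:E g <= cLnorm gam E 2%:E (fun x => (g x - F_LB alpha (f_ n) x)%R) +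
      cLnorm gam E 2%:E (F_LB alpha (f_ n)))%E.
    apply: cLnorm_triangle => //; [by apply: cmeasurableB; exact: sub|exact: sub|].
    by move=> x; have := le_normcBr (g x) (F_LB alpha (f_ n) x) 0; rewrite !subr0.
  apply: le_trans g1 _; apply: leeD.
    apply: (@le_trans _ _ (cLnorm gam KKhat 2%:E (fun x => (g x - F_LB alpha (f_ n) x)%R))).
      by apply: cLnorm2_subset => //; exact: cmeasurableB.
    by apply: le_cLnorm2 => x _; rewrite normcC.
  have g2 : (cLnorm gam E 2%:E (F_LB alpha (f_ n)) <=
      cLnorm gam E 2%:E (fun x => (F_LB alpha (f_ n) x - F_LB alpha (inner r) x)%R) +
      cLnorm gam E 2%:E (F_LB alpha (inner r)))%E.
    apply: cLnorm_triangle => //; [by apply: cmeasurableB; exact: sub|exact: sub|].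
    by move=> x; have := le_normcBr (F_LB alpha (f_ n) x) (F_LB alpha (inner r) x) 0; rewrite !subr0.
  apply: le_trans g2 _; rewrite /C [X in (c n + X)%E]addeC addeA; apply: leeD.
    apply: (@le_trans _ _ (cLnorm gam KKhat 2%:E (F_LB alpha (fun z => f_ n z - inner r z)))).
      apply: (@le_trans _ _ (cLnorm gam KKhat 2%:E (fun x => (F_LB alpha (f_ n) x - F_LB alpha (inner r) x)%R))).
        by apply: cLnorm2_subset => //; exact: cmeasurableB.
      by apply: le_cLnorm2 => x Kx; rewrite F_LBB.
    apply: le_trans (plancherel_le halpha (cLp1B mKK f1 hi)) _.
    apply: le_trans (cLnorm2_trans mu mKK mf_ mf (minner r)) _.
    by apply: leeD => //; exact: outer_le.
  have fin1 : cLnorm mu KK 1%:E (inner r) \is a fin_num.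
    by rewrite ge0_fin_numE ?cLnorm_ge0//; exact: hi.2.
  apply: (@le_trans _ _ (cLnorm mu KK 1%:E (inner r) * gam E `^ 2^-1)%E).
    rewrite -(fineK fin1); apply: cLnorm2_bounded => //.
      by rewrite fine_ge0// cLnorm_ge0.
    by move=> x Ex; rewrite -lee_fin fineK//; apply: normc_F_LB_le => //; exact: hE.
  by apply: lee_wpmul2r; [exact: poweR_ge0|exact: inner_le_ball].
have c0 : (c n + C)%E @[n --> \oo] --> (0 + C)%E.
  apply: cvgeD => //; last exact: cvg_cst.
have h : (a n + (c n + C))%E @[n --> \oo] --> (0 + (0 + C))%E.
  by apply: cvgeD => //.
rewrite -/C -[leRHS]add0e -[X in (0 + X)%E]add0e -(cvg_lim _ h)//.
by apply: lime_ge; [apply/cvg_ex; eexists; exact: h|exact: nearW].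
Qed.

End split.

(** * Choice of the radius and conclusion *)

Lemma exists_best_radius (R : realType) (D s b G : R) : 0 < s -> s < D -> 0 < b -> 0 < G ->
  exists2 r, 0 < r &
    (b * r `^ (2 * (D - s)) / (2 * (D - s))) `^ 2^-1 * G `^ 2^-1 + r `^ (- s) <
    (b * (D - s) / s ^+ 2) `^ (s / (2 * D)) * (D / (D - s)) * G `^ (s / (2 * D)).
Proof.
move=> s0 sD b0 G0; have D0 : 0 < D := lt_trans s0 sD.
have d0 : 0 < D - s by rewrite subr_gt0.
(* Value of [r ^ (2 D)] at the critical point in [r] of the left side, where the inner term is
   [s / (D - s)] times the outer one. *)
pose Q := 2 * s ^+ 2 / (b * G * (D - s)).
have Q0 : 0 < Q by rewrite divr_gt0 ?mulr_gt0 ?exprn_gt0.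
pose r := Q `^ (2 * D)^-1; have r0 : 0 < r by exact: powR_gt0.
exists r => //.
have rs0 : 0 < r `^ (- s) by exact: powR_gt0.
have rQ : r `^ (2 * (D - s)) = Q * r `^ (- s) ^+ 2.
  rewrite -powR_mulrn ?(ltW rs0)// -powRrM (_ : 2 * (D - s) = 2 * D + - s * 2); last by ring.
  by rewrite (powRD_gt0 _ _ r0) -[r `^ (2 * D)]powRrM mulVf ?gt_eqF ?mulr_gt0// powRr1 ?ltW.
have -> : (b * r `^ (2 * (D - s)) / (2 * (D - s))) `^ 2^-1 * G `^ 2^-1 = s / (D - s) * r `^ (- s).
  rewrite -powRM ?(ltW G0)//; last by rewrite divr_ge0 ?mulr_ge0 ?powR_ge0 ?(ltW b0) ?(ltW d0).
  rewrite rQ (_ : _ * _ = (s / (D - s) * r `^ (- s)) ^+ 2); last first.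
    by rewrite /Q; field; rewrite !gt_eqF.
  have x0 : 0 <= s / (D - s) * r `^ (- s) by rewrite ltW// mulr_gt0 ?divr_gt0.
  by rewrite -(powR_mulrn 2 x0) -powRrM divff ?pnatr_eq0// powRr1.
have -> : s / (D - s) * r `^ (- s) + r `^ (- s) = D / (D - s) * r `^ (- s).
  by field; rewrite gt_eqF.
rewrite [ltRHS]mulrAC [ltRHS]mulrC ltr_pM2l ?divr_gt0// -powRM ?(ltW G0)//; last first.
  by rewrite ltW// divr_gt0 ?mulr_gt0 ?exprn_gt0.
have -> : r `^ (- s) = (Q^-1) `^ (s / (2 * D)).
  have Qi : Q^-1 = Q `^ (- 1) by rewrite powR_inv1// ltW.
  rewrite Qi /r -!powRrM; congr (_ `^ _); field.
  by rewrite gt_eqF.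
apply: gt0_ltr_powR; rewrite ?nnegrE ?divr_gt0 ?mulr_gt0//.
- by rewrite invr_ge0 ltW.
- by rewrite ltW// mulr_gt0 ?divr_gt0 ?mulr_gt0 ?exprn_gt0.
(* [Q^-1] is exactly half of the base on the right. *)
rewrite /Q invf_div -subr_gt0.
rewrite (_ : _ - _ = b * G * (D - s) / (2 * s ^+ 2)); last by field; rewrite gt_eqF.
by rewrite divr_gt0 ?mulr_gt0 ?exprn_gt0.
Qed.

Local Open Scope complex_scope.

Theorem theorem4p1 (R : realType) (alpha s : R)
    (halpha : 0 <= alpha) (hs0 : 0 < s) (hs : s < 3 * alpha + 2)
    (f : R * R -> R[i])
    (hf : cLp (m_alpha alpha) KK 2%:E f)
    (hfneq0 : ~ {ae m_alpha alpha, forall z, KK z -> f z = 0})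
    (E : set (R * nat)) (hEsub : E `<=` KKhat) (hEm : measurable E)
    (hE0 : (0 < gamma_alpha alpha E)%E) (hEfin : (gamma_alpha alpha E < +oo)%E) :
  ((\int[gamma_alpha alpha]_(w in E)
      (ComplexField.Normc.normc (F_LB2 alpha f w) ^+ 2)%:E) `^ 2^-1
   < (K_const alpha s)%:E
     * gamma_alpha alpha E `^ (s / (2 * (3 * alpha + 2)))
     * cLnorm (m_alpha alpha) KK 2%:E (fun z => ((hnorm z `^ s)%:C * f z)%R))%E.
Proof.
set D := 3 * alpha + 2; set N := cLnorm _ _ _ _.
have D0 : 0 < D := lt_trans hs0 hs.
have b0 := ball_const_gt0 halpha.
have KE : K_const alpha s = (ball_const alpha * (D - s) / s ^+ 2) `^ (s / (2 * D)) * (D / (D - s)).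
  by rewrite /K_const /ball_const -/D; congr (_ `^ _ * _); rewrite invfM; ring.
have G0 : 0 < fine (gamma_alpha alpha E) by apply: fine_gt0; rewrite hE0.
have GE : gamma_alpha alpha E = (fine (gamma_alpha alpha E))%:E.
  by rewrite fineK// ge0_fin_numE// ltW.
have K0 : 0 < K_const alpha s.
  rewrite KE mulr_gt0 ?divr_gt0 ?subr_gt0//.
  apply: powR_gt0; apply: divr_gt0; last exact: exprn_gt0.
  by apply: mulr_gt0 => //; rewrite subr_gt0.
have N0 : (0 < N)%E by exact: weighted_norm_gt0.
have KG0 : (0 < (K_const alpha s)%:E * gamma_alpha alpha E `^ (s / (2 * D)))%E.
  by rewrite mule_gt0 ?poweR_gt0 ?lte_fin.
rewrite -cLnorm2E.
(* Without an image, [xget] returns its default 0 and the left side vanishes. *)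
have [[g hg]|nog] := pselect (exists g, is_F_LB2 alpha f g); last first.
  have -> : F_LB2 alpha f = fun=> 0.
    by apply: xgetPN => g hg; apply: nog; exists g.
  rewrite cLnorm2E (eq_integral (cst 0%E)) ?integral0 ?poweR0r ?invr_neq0//.
    exact: mule_gt0.
  by move=> w _; rewrite ComplexField.Normc.normc0 expr0n.
have {hg} hg : is_F_LB2 alpha f (F_LB2 alpha f) by exact: (xgetPex _ (ex_intro _ g hg)).
(* If the weighted norm is infinite, so is the right side, while the left side is finite because the
   image is square integrable. *)
have [Ninf|Nfin] := leP +oo%E N.
  have -> : N = +oo%E by apply/eqP; rewrite eq_le leey.
  rewrite gt0_muley//; have [[mg gfin] _] := hg; apply: le_lt_trans gfin.
  exact: cLnorm2_subset measurable_KKhat hEm mg hEsub.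
have [r r0 hr] := exists_best_radius hs0 hs b0 G0.
apply: le_lt_trans (transform_bound halpha hs0 hs hf hg hEsub hEm Nfin r0) _.
have NE : N = (fine N)%:E by rewrite fineK// ge0_fin_numE// cLnorm_ge0.
have n0 : 0 < fine N by apply: fine_gt0; rewrite N0.
rewrite -/N NE GE !poweR_EFin -!EFinM -EFinD lte_fin KE.
by rewrite mulrAC -mulrDl ltr_pM2r.
Qed.
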